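(* Let $F$ and $E$ be two incommensurable Bedford-McMullen carpets with defining exponents $(m_1,n_1)$ and $(m_2,n_2)$ and allowed digit sets $\Gamma$ and $\Lambda$, respectively, and let $\mu\in P(F)$ and $\nu\in P(E)$ be two self affine measures. Let $\kappa:=\max\{\dim_H\mu,\dim_H\nu\}$. 1. If $$\kappa>\max_{(i,j)\in[n_1]\times[n_2]}\Big\{\frac{\log|\Gamma_i|}{\log m_1}+\frac{\log|\Lambda_j|}{\log m_2}-1,0\Big\}+\max\{\dim_H P_2(F)+\dim_H P_2(E)-1,0\},$$ then for any affine map $g:\mathbb{R}^2\to\mathbb{R}^2$ such that the linear part of $g$ is a diagonal matrix, the measures $g\mu$ and $\nu$ are mutually singular. 2. If $$\kappa>\max_{i\in[n_1]}\Big\{\frac{\log|\Gamma_i|}{\log m_1}+\dim_H P_2(E)-1,0\Big\}+\max_{j\in[n_2]}\Big\{\frac{\log|\Lambda_j|}{\log m_2}+\dim_H P_2(F)-1,0\Big\},$$ then for any affine map $g:\mathbb{R}^2\to\mathbb{R}^2$ such that the linear part of $g$ is an anti-diagonal matrix, the measures $g\mu$ and $\nu$ are mutually singular.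
   Context: For an integer $k\ge1$, $[k]:=\{0,\dots,k-1\}$. For integers $m>n\ge2$ and $\Gamma\subseteq[m]\times[n]$, the Bedford-McMullen carpet with defining exponents $(m,n)$ and allowed digit set $\Gamma$ is $F=\{(\sum_{k\ge1}x_k m^{-k},\sum_{k\ge1}y_k n^{-k}):(x_k,y_k)\in\Gamma\ \forall k\}$. Carpets are always assumed not to lie on a single vertical or horizontal line. For $F$ with digit set $\Gamma\subseteq[m_1]\times[n_1]$ put $\Gamma_i:=\{a\in[m_1]:(a,i)\in\Gamma\}$ for $i\in[n_1]$; for $E$ with digit set $\Lambda\subseteq[m_2]\times[n_2]$ put $\Lambda_j:=\{a\in[m_2]:(a,j)\in\Lambda\}$ for $j\in[n_2]$. Convention: $\log0=-\infty$; and $\max_{i\in I}\{a_i,0\}$ means the maximum of $0$ and all the $a_i$, $i\in I$. $F$ and $E$ are incommensurable if $\frac{\log m_1}{\log m_2},\frac{\log m_1}{\log n_2},\frac{\log n_1}{\log m_2},\frac{\log n_1}{\log n_2}$ are all irrational. $P_2(x,y)=y$. $P(Z)$ is the set of Borel probability measures on $Z$, and $g\mu$ is the push-forward of $\mu$ under $g$. A self affine measure on a carpet $F$ with exponents $(m,n)$ and digit set $\Gamma$ is the push-forward of a Bernoulli measure (stationary product measure $p^{\mathbb{N}}$, $p$ a probability vector on $\Gamma$) on $\Gamma^{\mathbb{N}}$ under $((x_k,y_k))_{k\ge1}\mapsto(\sum_k x_k m^{-k},\sum_k y_k n^{-k})$. For a Borel probability measure $\mu$, $\dim_H\mu:=\inf\{\dim_H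 A: A\text{ Borel},\ \mu(A)>0\}$; on sets $\dim_H$ is Hausdorff dimension.
   Formalization: The affine map g is taken to have an invertible linear part; for singular linear part the claim fails in general (e.g. g = 0 and ν a point mass at the origin given by a degenerate probability vector). *)

(* Defs.v *)
From HB Require Import structures.
From mathcomp Require Import all_boot all_order all_algebra.
From mathcomp Require Import all_classical all_reals all_analysis.

Set Implicit Arguments.
Unset Strict Implicit.
Unset Printing Implicit Defensive.

Import Order.TTheory GRing.Theory Num.Theory.
Import numFieldNormedType.Exports.

Local Open Scope classical_set_scope.
Local Open Scope ring_scope.

Section hausdorff.
Context {R : realType} {T : Type} (dist : T -> T -> R).
Local Open Scope ereal_scope.

(* The diameter of the empty set is -oo. *)
Definition diameter (A : set T) : \bar R :=
  ereal_sup [set (dist x y)%:E | x in A & y in A].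

(* diam(A)^s, with 0^0 = 1 for singletons; the empty set has weight 0 also when
   s = 0, so that empty members of a covering never count. *)
Definition hausdorff_weight (s : R) (A : set T) : \bar R :=
  if A == set0 then 0 else diameter A `^ s.

Definition hausdorff_content (s delta : R) (A : set T) : \bar R :=
  ereal_inf [set \sum_(0 <= i <oo) hausdorff_weight s (U i) |
    U in [set U : (set T)^nat |
            A `<=` \bigcup_i U i /\ forall i, diameter (U i) <= delta%:E]].

Definition hausdorff_measure (s : R) (A : set T) : \bar R :=
  ereal_sup [set hausdorff_content s delta A |
    delta in [set delta : R | (0 < delta)%R]].

Definition hausdorff_dim (A : set T) : \bar R :=
  ereal_inf [set s%:E |
    s in [set s : R | (0 <= s)%R /\ hausdorff_measure s A = 0]].

End hausdorff.

Section euclidean.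
Context {R : realType}.

Definition dist_line (x y : R) : R := `|x - y|.

(* The norm that the library puts on R * R is the sup norm. *)
Definition dist_plane (z w : R * R) : R :=
  Num.sqrt ((z.1 - w.1) ^+ 2 + (z.2 - w.2) ^+ 2).

Definition dimH_line (A : set R) : \bar R := hausdorff_dim dist_line A.
Definition dimH_plane (A : set (R * R)) : \bar R := hausdorff_dim dist_plane A.

Definition dimH_measure (mu : probability (R * R)%type R) : \bar R :=
  ereal_inf [set dimH_plane A |
    A in [set A : set (R * R) | measurable A /\ (0 < mu A)%E]].

End euclidean.

(* Both arguments are meant to be measures. *)
Definition mutually_singular {d} {T : measurableType d} {R : realType}
    (mu nu : set T -> \bar R) : Prop :=
  exists A : set T, [/\ measurable A, mu A = 0%E & nu (~` A) = 0%E].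

(* D^nat for a finite alphabet D. The letter a serves only to make the type
   pointed, as the library requires of measurable types. *)
Definition shift_space (D : finType) (a : D) : Type := nat -> D.

Section shift_space.
Context (D : finType) (a : D).

HB.instance Definition _ := Choice.copy (shift_space a) (nat -> D).
HB.instance Definition _ := isPointed.Build (shift_space a) (fun=> a).

Definition coordinate_cylinders : set (set (shift_space a)) :=
  [set A | exists (k : nat) (c : D), A = [set w : shift_space a | w k = c]].

(* The product sigma-algebra. *)
Definition measurable_shift := g_sigma_algebraType coordinate_cylinders.

End shift_space.

Definition probability_vector {R : realType} {D : finType} (p : D -> R) : Prop :=
  (forall c, 0 <= p c) /\ \sum_c p c = 1.

(* P is the product measure p^nat, pinned down by its values on the initial
   cylinders, which form a generating pi-system. *)
Definition is_bernoulli {R : realType} {D : finType} {a : D} (p : D -> R)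
    (P : probability (measurable_shift a) R) : Prop :=
  forall (k : nat) (u : nat -> D),
    P [set w : shift_space a | forall i, (i < k)%N -> w i = u i] =
    (\prod_(i < k) p (u i))%:E.

Section carpet.
Context (R : realType) {m n : nat}.
Implicit Type Gamma : {set 'I_m * 'I_n}.

(* Digit sequences are indexed from 0, hence the exponents k.+1. *)
Definition coding (w : nat -> 'I_m * 'I_n) : R * R :=
  (limn (series (fun k => (w k).1%:R / m%:R ^+ k.+1 : R)),
   limn (series (fun k => (w k).2%:R / n%:R ^+ k.+1 : R))).

Definition carpet Gamma : set (R * R) :=
  [set coding w | w in [set w | forall k, w k \in Gamma]].

Definition on_axis_parallel_line (F : set (R * R)) : Prop :=
  (exists c, F `<=` [set z | z.1 = c]) \/ (exists c, F `<=` [set z | z.2 = c]).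

Definition row_digits Gamma (i : 'I_n) : {set 'I_m} :=
  [set a : 'I_m | (a, i) \in Gamma]%SET.

(* log |Gamma_i| / log m, equal to -oo for an empty row. *)
Definition row_dim Gamma (i : 'I_n) : \bar R :=
  (lne (#|row_digits Gamma i|%:R)%:E * ((ln m%:R)^-1)%:E)%E.

Definition self_affine_measure Gamma (mu : probability (R * R)%type R) : Prop :=
  exists (a : {c | c \in Gamma}) (p : {c | c \in Gamma} -> R)
         (P : probability (measurable_shift a) R),
    [/\ probability_vector p, is_bernoulli p P &
        forall A, measurable A ->
          mu A = pushforward P
            (fun w : measurable_shift a => coding (fun k => val (w k))) A].

End carpet.

Arguments carpet R {m n} Gamma.
Arguments row_dim R {m n} Gamma i.

Definition incommensurable (R : realType) (m1 n1 m2 n2 : nat) : Prop :=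
  [/\ irrational (ln m1%:R / ln m2%:R : R),
      irrational (ln m1%:R / ln n2%:R : R),
      irrational (ln n1%:R / ln m2%:R : R) &
      irrational (ln n1%:R / ln n2%:R : R)].

Definition affine_map {R : realType} (L : 'M[R]_2) (b z : R * R) : R * R :=
  (L 0 0 * z.1 + L 0 1 * z.2 + b.1, L 1 0 * z.1 + L 1 1 * z.2 + b.2).

Definition is_antidiag_mx {R : realType} {n : nat} (A : 'M[R]_n) : Prop :=
  forall i j, j != rev_ord i -> A i j = 0.

(* Main.v *)
(** The argument is Fourier-analytic. Write T for the diagonal matrix of the
    exponents of nu, and e(h.z) for the characters of the torus; nu is
    T-mixing. Suppose that the Fourier coefficient c of nu at some nonzero
    integer vector h does not vanish. Sparse averages of e(h.T^q z) are then
    L2(nu)-close to c. Along g mu the same averages are L2-close to 0, provided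
    that the marginals of mu at the coordinates which h involves are not point
    masses, because the transform of mu at the frequencies g^*(h.T^q) tends to
    0 on average in q: its modulus is at most a product of N values of the
    digit polynomial of mu, at a point that depends continuously on the
    fractional part of q theta, where theta is a ratio of logarithms of
    exponents, irrational by incommensurability, and for all but countably many
    fractional parts this product tends to 0 as N grows. Hence g mu and nu are
    singular.

    So if they are not singular, then for each pair of coordinates matched by g
    either both marginals are point masses, or the Fourier coefficients of both
    marginals at nonzero integers vanish and, by a Fejer kernel argument, all
    digits are used (all pairs of digits, if this happens for both pairs of
    coordinates). In the four resulting cases the dimensions of both measures
    are at most 0, 1, 1 and 2, and so at most the right-hand side of the
    hypothesis. *)

Require Import Defs.
From mathcomp Require Import all_boot all_order all_algebra.
From mathcomp Require Import all_classical all_reals all_analysis.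
From mathcomp Require Import measurable_realfun complex ring lra zify.

Set Implicit Arguments.
Unset Strict Implicit.
Unset Printing Implicit Defensive.

Import Order.TTheory GRing.Theory Num.Theory.
Import numFieldNormedType.Exports.

Local Open Scope classical_set_scope.
Local Open Scope ring_scope.

(** * Trigonometric functions of period 1 *)

Section trigonometry.
Context {R : realType}.
Implicit Types x y t : R.

(** The obstacle is that the transform of [mu] need not tend to 0 at infinity: on integer vectors it
    is constant along the powers of its own exponents. Decay is available only on average and only
    along powers of foreign exponents. Averages of characters fit this: the square of a sum of
    characters involves the transform only at differences of frequencies, and
    [A P^(r+k) - A P^(r+l)] is a fixed nonzero multiple of [P^r], again on such a progression. As
    decay holds only for most [r], the window of averaging has to slide; for [nu], which is
    invariant, the estimate is uniform in the position of the window, and so [mu] may choose it.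

    The two coordinates come with two ratios, [ln P / ln m] and [ln Q / ln n], about which nothing
    joint is known. Only the rotation by the larger one is used; in the scale that it dictates, the
    amplitude of the other frequency converges.

    The vanishing of coefficients of [nu] says nothing about the digits of [mu]. Since [g] is
    invertible and singularity is symmetric, the argument is run again for the inverse of [g] with
    the measures exchanged. *)

Lemma cos_lip x y : `|cos x - cos y| <= `|x - y|.
Proof.
wlog xy : x y / x <= y => [H|].
  have [xy|/ltW xy] := leP x y; first exact: H.
  by rewrite distrC [in X in _ <= X]distrC; exact: H.
rewrite distrC [in X in _ <= X]distrC.
have h1 z : z \in `]x, y[ -> is_derive z 1 cos (- sin z).
  by move=> _; exact: is_derive_cos.
have h2 : {within `[x, y], continuous (@cos R)}.
  by apply: continuous_subspaceT; exact: continuous_cos.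
have [c _ ->] := @MVT_segment R cos (fun x => - sin x) x y xy h1 h2.
by rewrite normrM normrN ler_piMl// sin_max.
Qed.

Lemma sin_lip x y : `|sin x - sin y| <= `|x - y|.
Proof.
rewrite -!cosBpihalf (le_trans (cos_lip _ _))// opprB addrA subrK.
by rewrite lexx.
Qed.

Definition cos1 t : R := cos (pi *+ 2 * t).
Definition sin1 t : R := sin (pi *+ 2 * t).

Lemma cos1N t : cos1 (- t) = cos1 t.
Proof. by rewrite /cos1 mulrN cosN. Qed.

Lemma sin1N t : sin1 (- t) = - sin1 t.
Proof. by rewrite /sin1 mulrN sinN. Qed.

Lemma cos1D s t : cos1 (s + t) = cos1 s * cos1 t - sin1 s * sin1 t.
Proof. by rewrite /cos1 mulrDr cosD. Qed.

Lemma sin1D s t : sin1 (s + t) = sin1 s * cos1 t + cos1 s * sin1 t.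
Proof. by rewrite /sin1 mulrDr sinD. Qed.

Lemma cos1_0 : cos1 0 = 1. Proof. by rewrite /cos1 mulr0 cos0. Qed.

Lemma sin1_0 : sin1 0 = 0. Proof. by rewrite /sin1 mulr0 sin0. Qed.

Lemma cos1_nat (n : nat) : cos1 n%:R = 1.
Proof.
by rewrite /cos1 mulr_natr -[_ *+ n]add0r (periodicn (@cosD2pi R)) cos0.
Qed.

Lemma sin1_nat (n : nat) : sin1 n%:R = 0.
Proof.
by rewrite /sin1 mulr_natr -[_ *+ n]add0r (periodicn (@sinD2pi R)) sin0.
Qed.

Lemma cos1_int (k : int) : cos1 k%:~R = 1.
Proof.
by case: k => n; rewrite ?NegzE ?mulrNz ?cos1N -pmulrn cos1_nat.
Qed.

Lemma sin1_int (k : int) : sin1 k%:~R = 0.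
Proof.
by case: k => n; rewrite ?NegzE ?mulrNz ?sin1N -pmulrn sin1_nat ?oppr0.
Qed.

Lemma cos1_lip x y : `|cos1 x - cos1 y| <= pi *+ 2 * `|x - y|.
Proof.
by rewrite (le_trans (cos_lip _ _))// -mulrBr normrM ger0_norm// mulrn_wge0// pi_ge0.
Qed.

Lemma sin1_lip x y : `|sin1 x - sin1 y| <= pi *+ 2 * `|x - y|.
Proof.
by rewrite (le_trans (sin_lip _ _))// -mulrBr normrM ger0_norm// mulrn_wge0// pi_ge0.
Qed.

Lemma cos1_max t : `|cos1 t| <= 1. Proof. exact: cos_max. Qed.
Lemma sin1_max t : `|sin1 t| <= 1. Proof. exact: sin_max. Qed.

Lemma cos1_sin1 t : cos1 t ^+ 2 + sin1 t ^+ 2 = 1.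
Proof. exact: cos2Dsin2. Qed.

Lemma nearest_int x : exists k : int, `|x - k%:~R| <= 2^-1.
Proof.
exists (Num.floor (x + 2^-1)).
have := Num.Theory.floor_itv (x + 2^-1).
rewrite intrD => /andP[h1 h2].
by rewrite ler_norml; apply/andP; split; lra.
Qed.

(** By periodicity and evenness [t] may be replaced by its distance to the nearest integer, which
    lies in [[d, 1/2]]; there [cos1] decreases, so the deficit at [d] serves as [e]. *)
Lemma cos1_gap (d : R) : 0 < d -> d <= 2^-1 ->
  exists2 e : R, 0 < e &
    forall t, (forall k : int, d <= `|t - k%:~R|) -> cos1 t <= 1 - e.
Proof.
move=> d0 d2; have p0 := @pi_gt0 R.
have pp : 0 < pi *+ 2 :> R by rewrite mulr2n addr_gt0.
have in0pi (r : R) : 0 <= r -> r <= 2^-1 -> pi *+ 2 * r \in `[0, pi].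
  by move=> r0 r2; rewrite in_itv/=; apply/andP; split; rewrite mulr2n; nra.
exists (1 - cos1 d).
  rewrite subr_gt0 -cos1_0 /cos1 ltr_cos ?in0pi ?(ltW d0)//.
  by rewrite ltr_pM2l.
move=> t ht; have [k hk] := nearest_int t.
have -> : cos1 t = cos1 `|t - k%:~R|.
  rewrite /cos1 -[X in X * `|_|](gtr0_norm pp) -normrM cos_norm.
  rewrite -/(cos1 _) -/(cos1 _) cos1D cos1N cos1_int sin1N sin1_int.
  by rewrite oppr0 mulr0 subr0 mulr1.
rewrite opprB addrCA subrr addr0.
rewrite /cos1 leNgt ltr_cos ?in0pi// ?(ltW d0)//.
by rewrite -leNgt ler_pM2l.
Qed.

End trigonometry.

(** * Averages along irrational rotations *)

Section orbits_of_irrational_rotations.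
Context {R : realType}.
Implicit Types x y theta : R.

Definition orbit_frac theta (n : nat) : R :=
  n%:R * theta - (Num.floor (n%:R * theta))%:~R.

Lemma orbit_frac_itv theta n : 0 <= orbit_frac theta n <= 1.
Proof.
have := Num.Theory.floor_itv (n%:R * theta); rewrite intrD /orbit_frac => /andP[h1 h2].
by apply/andP; split; lra.
Qed.

Lemma irrational_mul_far theta (j : nat) : irrational theta -> (0 < j)%N ->
  exists2 d : R, 0 < d & forall k : int, d <= `|j%:R * theta - k%:~R|.
Proof.
move=> irr j0; have [d d0 hd] : exists2 d : R, 0 < d & d <= orbit_frac theta j /\ d <= 1 -
    orbit_frac theta j.
  have := Num.Theory.floor_itv (j%:R * theta); rewrite intrD => /andP[h1 h2].
  have h3 : 0 < orbit_frac theta j.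
    rewrite lt_neqAle subr_ge0 h1 andbT eq_sym subr_eq0.
    apply/negP => /eqP e; apply: irr; rewrite rationalP.
    exists (Num.floor (j%:R * theta)), j; rewrite -e mulrAC divff ?mul1r//.
    by rewrite pnatr_eq0 -lt0n.
  have h4 : 0 < 1 - orbit_frac theta j by rewrite /orbit_frac; lra.
  exists (Num.min (orbit_frac theta j) (1 - orbit_frac theta j)).
    by rewrite lt_min h3.
  by split; rewrite ge_min lexx ?orbT.
exists d => // k; case: hd => hd1 hd2.
have -> : j%:R * theta - k%:~R = orbit_frac theta j + (Num.floor (j%:R * theta) - k)%:~R.
  by rewrite intrB /orbit_frac; ring.
have [q0|q0] := leP 0 (Num.floor (j%:R * theta) - k).
  have : 0 <= (Num.floor (j%:R * theta) - k)%:~R :> R by rewrite ler0z.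
  by move=> ?; apply: le_trans (ler_norm _); lra.
have : (Num.floor (j%:R * theta) - k)%:~R <= -1 :> R.
  by rewrite -[-1]/((-1)%:~R) ler_int; lia.
by move=> ?; rewrite -normrN; apply: le_trans (ler_norm _); lra.
Qed.

(* Two visits to a short interval are far apart in time. *)
Lemma sparse_visits theta (K : nat) : irrational theta ->
  exists2 d : R, 0 < d & forall y M,
    (\sum_(0 <= n < M) ((`|orbit_frac theta n - y| < d)%R : nat) <= M %/ K.+1 + 1)%N.
Proof.
move=> irr.
have [d d0 hd] : exists2 d : R, 0 < d & forall j, (0 < j <= K)%N ->
    forall k : int, d <= `|j%:R * theta - k%:~R|.
  elim: K => [|K [d d0 hd]]; first by exists 1 => // -[].
  have [d' d'0 hd'] := irrational_mul_far irr (ltn0Sn K).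
  exists (Num.min d d'); first by rewrite lt_min d0.
  move=> j /andP[j0]; rewrite leq_eqVlt => /orP[/eqP ->|jK] k.
    by rewrite ge_min hd' orbT.
  by rewrite ge_min hd// j0.
(* Two visits to the interval of radius [d / 2] at times [j <= K] apart would put [j theta] within
   [d] of an integer, so [K + 1] consecutive times contain at most one visit. *)
exists (d / 2) => [|y M]; first by rewrite divr_gt0.
set b := fun n => `|orbit_frac theta n - y| < d / 2.
have bsep n j : (0 < j <= K)%N -> b n -> b (n + j)%N -> False.
  rewrite /b => jK b1 b2; have := hd _ jK (Num.floor ((n + j)%:R * theta) - Num.floor (n%:R *
      theta)).
  rewrite leNgt => /negP; apply.
  have -> : j%:R * theta - (Num.floor ((n + j)%:R * theta) - Num.floor (n%:R * theta))%:~R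
    = (orbit_frac theta (n + j) - y) - (orbit_frac theta n - y).
    by rewrite intrB /orbit_frac natrD; ring.
  by rewrite (le_lt_trans (ler_normB _ _))//; lra.
have block s r : (r <= K.+1)%N -> (\sum_(s <= n < s + r) b n <= 1)%N.
  elim: r => [|r IH] rK; first by rewrite addn0 big_geq.
  rewrite addnS big_nat_recr ?leq_addr//=.
  have [bsr|] := boolP (b (s + r)%N); last by rewrite addn0 IH// ltnW.
  rewrite big_nat_cond big1 ?add0n//= => i /andP[/andP[si isr] _].
  case: (boolP (b i)) => //= bi; exfalso; apply: (@bsep i (s + r - i)%N) => //.
    by rewrite subn_gt0 isr leq_subLR; lia.
  by rewrite subnKC// ltnW.
have blocks q s r : (r <= K.+1)%N -> (\sum_(s <= n < s + q * K.+1 + r) b n <= q + 1)%N.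
  move=> rK; elim: q s => [|q IH] s; first by rewrite mul0n addn0 add0n block.
  rewrite (@big_cat_nat _ _ _ (s + K.+1)%N) ?leq_addr//=; last by rewrite mulSn -!addnA
      leq_add2l leq_addr.
  rewrite [in X in (X <= _)%N]mulSn addnA [(q.+1 + 1)%N]addSn -[(q + 1).+1]add1n.
  by rewrite leq_add ?block.
have := blocks (M %/ K.+1)%N 0%N (M %% K.+1)%N (ltnW (ltn_pmod _ (ltn0Sn _))).
by rewrite add0n -divn_eq.
Qed.

Lemma compact_increasing_cover (T : topologicalType) (A : set T) (U : nat -> set T) :
  compact A -> (forall j, open (U j)) -> (forall j k, (j <= k)%N -> U j `<=` U k) ->
  A `<=` \bigcup_j U j -> exists j, A `<=` U j.
Proof.
move=> /compact_near_coveringP cA oU incU AU.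
have [] := cA _ \oo (fun i (z : T) => U i z) _.
  move=> x /AU[j _ Ujx].
  exists (U j, [set k | (j <= k)%N]) => /=; first by split; [exact: open_nbhs_nbhs | exists j].
  by move=> [y k] /= [Ujy jk]; exact: (incU _ _ jk).
by move=> j _ h; exists j; exact: (h j (leqnn j)).
Qed.

Lemma sum_half_le1 (J : nat) : \sum_(i < J) (2^-1) ^+ i.+1 <= 1 :> R.
Proof.
suff -> : \sum_(i < J) (2^-1) ^+ i.+1 = 1 - (2^-1) ^+ J :> R.
  by rewrite gerBl exprn_ge0.
elim: J => [|J IH]; first by rewrite big_ord0 expr0 subrr.
by rewrite big_ord_recr/= IH exprS; field.
Qed.

(** A Dini argument. Off the countable set of the [e i] the decreasing sequence [f N] falls below
    every level, and balls around the [e i] can be taken with visit frequencies that sum to at most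
    [eps / 4]. Compactness of [[0, 1]] gives one [J] with [f J < eps / 2] outside the first [J]
    balls. The additive 1 in each visit count is absorbed for large [M]. *)
Lemma orbit_average theta (f : nat -> R -> R) (e : nat -> R) :
  irrational theta ->
  (forall N x, 0 <= f N x <= 1) ->
  (forall N x, f N.+1 x <= f N x) ->
  (forall N, continuous (f N)) ->
  (forall eps x, 0 < eps -> (forall N, eps <= f N x) -> exists i, x = e i) ->
  forall eps, 0 < eps -> exists N M0, forall M, (M0 <= M)%N ->
    \sum_(0 <= n < M) f N (orbit_frac theta n) <= eps * M%:R.
Proof.
move=> irr f01 fdec fcont fexc eps eps0.
have fdec' x j k : (j <= k)%N -> f k x <= f j x.
  by move=> /subnKC <-; elim: (k - j)%N => [|i IH]; rewrite ?addn0// addnS (le_trans (fdec _ _)).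
have /choice[d hd] : forall i : nat, exists d : R, 0 < d /\ forall y (M : nat),
    \sum_(0 <= n < M) (`|orbit_frac theta n - y| < d)%R%:R <= eps / 4 * (2^-1) ^+ i.+1 * M%:R +
        1 :> R.
  move=> i; have q0 : 0 < eps / 4 * (2^-1) ^+ i.+1 by rewrite mulr_gt0 ?divr_gt0 ?exprn_gt0.
  set q := eps / 4 * _ in q0 *.
  have [d d0 h] := sparse_visits (Num.truncn q^-1) irr; exists d; split=> // y M.
  rewrite -natr_sum; apply: (@le_trans _ _ (M %/ (Num.truncn q^-1).+1 + 1)%:R).
    by rewrite ler_nat h.
  rewrite natrD lerD2r.
  have qK : 1 <= q * (Num.truncn q^-1).+1%:R.
    rewrite -ler_pdivrMl// mulr1 ltW//.
    by apply: Num.Theory.truncnS_gt.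
  have dM : (M %/ (Num.truncn q^-1).+1)%:R * (Num.truncn q^-1).+1%:R <= M%:R :> R.
    by rewrite -natrM ler_nat leq_divM.
  have k0 : 0 <= (M %/ (Num.truncn q^-1).+1)%:R :> R by [].
  by nra.
pose U J := [set x | f J x < eps / 2] `|` \bigcup_(i in [set i | (i < J)%N]) ball (e i) (d i).
have [|||J hJ] := @compact_increasing_cover R `[0, 1] U (@segment_compact R 0 1).
- move=> J; apply: openU; last by apply: bigcup_open => i _; exact: ball_open.
  apply: (@open_comp _ _ (f J) [set y | y < eps / 2]); last exact: open_lt.
  by move=> x _; exact: fcont.
- move=> j k jk x [h|[i ij h]]; first by left; rewrite /= (le_lt_trans (fdec' x _ _ jk)).
  by right; exists i => //=; rewrite (leq_trans ij jk).
- move=> x _; have [[N hN]|hn] := pselect (exists N, f N x < eps / 2).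
    by exists N => //; left.
  have [||i xi] := fexc (eps / 2) x; first by rewrite divr_gt0.
    by move=> N; rewrite leNgt; apply/negP => h; apply: hn; exists N.
  exists i.+1 => //; right; exists i => //=; rewrite xi; apply: ballxx.
  by have [] := hd i.
have [M0 hM0] : exists M0 : nat, J%:R <= eps / 4 * M0%:R.
  exists (Num.truncn (J%:R / (eps / 4))).+1.
  by rewrite mulrC -ler_pdivrMr ?divr_gt0// ltW// Num.Theory.truncnS_gt.
exists J, M0 => M M0M.
have pt n : f J (orbit_frac theta n) <= eps / 2 + \sum_(i < J) (`|orbit_frac theta n - e i| < d
    i)%R%:R.
  have s0 : 0 <= \sum_(i < J) (`|orbit_frac theta n - e i| < d i)%R%:R :> R by exact: sumr_ge0.
  have [|h|[i iJ h]] := hJ (orbit_frac theta n).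
  - by rewrite /= in_itv/= orbit_frac_itv.
  - by rewrite (le_trans (ltW h))// lerDl.
  - apply: (@le_trans _ _ 1); first by have /andP[] := f01 J (orbit_frac theta n).
    rewrite (bigD1 (Ordinal iJ))//= distrC h.
    set S := (X in _ + (_ + X)); have : 0 <= S by exact: sumr_ge0.
    by rewrite /=; lra.
apply: (le_trans (ler_sum _ (fun n _ => pt n))).
rewrite big_split/= sumr_const_nat subn0 exchange_big/=.
have : \sum_(i < J) \sum_(0 <= n < M) (`|orbit_frac theta n - e i| < d i)%R%:R
   <= \sum_(i < J) (eps / 4 * M%:R * (2^-1) ^+ i.+1 + 1) :> R.
  by apply: ler_sum => i _; rewrite mulrAC; have [_] := hd i; exact.
move/(lerD (lexx ((eps / 2) *+ M)))/le_trans; apply.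
rewrite big_split/= -mulr_sumr sumr_const card_ord.
have h1 : eps / 4 * M%:R * \sum_(i < J) (2^-1) ^+ i.+1 <= eps / 4 * M%:R.
  by rewrite ler_piMr ?sum_half_le1// mulr_ge0// divr_ge0// ltW.
have h2 : J%:R <= eps / 4 * M%:R :> R.
  by rewrite (le_trans hM0)// ler_pM2l ?divr_gt0// ler_nat.
by rewrite -[_ *+ M]mulr_natr; lra.
Qed.

End orbits_of_irrational_rotations.

(** * Decay of products of digit polynomials *)

Section geometric_progressions_near_integers.
Context {R : realType}.

Lemma nonincr_ratio (f : nat -> R) (eta : R) : 0 < eta ->
  (forall N, eta <= f N) -> (forall N, f N.+1 <= f N) ->
  forall e, 0 < e -> exists N0, forall N, (N0 <= N)%N -> f N - f N.+1 < e.
Proof.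
move=> eta0 fe fd e e0.
have fdec : {homo f : n m / (n <= m)%N >-> m <= n}.
  by move=> j k /subnKC <-; elim: (k - j)%N => [|i IH]; rewrite ?addn0// addnS (le_trans (fd _)).
have cf : cvgn f.
  apply: nonincreasing_is_cvgn fdec _.
  by exists eta => _ [n _ <-].
move: cf => /cvgrPdist_lt /(_ (e / 2)); rewrite divr_gt0// => /(_ isT)[N0 _ h].
exists N0 => N N0N.
have := h N N0N; have := h N.+1 (leq_trans N0N (leqnSn N)).
rewrite /= !ltr_norml => /andP[? ?] /andP[? ?]; lra.
Qed.

(** Once the errors are small, the nearby integers themselves satisfy [w k.+1 = m * w k], so the
    error is multiplied by [m] at each step; being bounded, it is 0. *)
Lemma geometric_near_int (m : nat) (g : R) : (1 < m)%N ->
  (forall e, 0 < e -> exists k0, forall k, (k0 <= k)%N ->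
     exists j : int, `|g * m%:R ^+ k - j%:~R| <= e) ->
  exists k (j : int), g * m%:R ^+ k = j%:~R.
Proof.
(* Chosen so that [e * m + e < 1]: an integer bounded by this quantity vanishes. *)
move=> m1 near; set e : R := (m%:R + 2)^-1.
have m2 : 2 <= m%:R :> R by rewrite ler_nat.
have e0 : 0 < e by rewrite invr_gt0; lra.
have [k0 /choice[w hw]] : exists k0, forall k, exists j : int,
    (k0 <= k)%N -> `|g * m%:R ^+ k - j%:~R| <= e.
  have [k0 h] := near e e0; exists k0 => k.
  by case: (leqP k0 k) => [/h[j hj]|_]; [exists j | exists 0].
pose d k := g * m%:R ^+ k - (w k)%:~R.
have step k : (k0 <= k)%N -> d k.+1 = m%:R * d k.
  move=> kk0; have h1 := hw _ kk0; have h2 := hw _ (leq_trans kk0 (leqnSn k)).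
  have em : e * m%:R + e < 1.
    have : e * (m%:R + 2) = 1 by rewrite mulVf//; apply/eqP; lra.
    by rewrite mulrDr; lra.
  have eqd : d k.+1 - m%:R * d k = (m%:Z * w k - w k.+1)%:~R.
    by rewrite /d exprS intrB intrM; ring.
  have : `|(m%:Z * w k - w k.+1)%:~R| < 1 :> R.
    rewrite -eqd; apply: le_lt_trans (ler_normB _ _) _.
    rewrite normrM ger0_norm ?ler0n// addrC (le_lt_trans _ em)//.
    rewrite lerD// mulrC ler_wpM2r ?ler0n//.
  rewrite -intr_norm -[1]/(1%:~R) ltr_int => h3.
  have : (m%:Z * w k - w k.+1) = 0 by lia.
  by move=> e'; move: eqd; rewrite e' => /eqP; rewrite subr_eq0 => /eqP.
have steps i : d (k0 + i)%N = m%:R ^+ i * d k0.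
  elim: i => [|i IH]; first by rewrite addn0 expr0 mul1r.
  by rewrite addnS step ?leq_addr// IH exprS mulrA.
exists k0, (w k0); apply/eqP; rewrite -subr_eq0 -/(d k0).
apply/negPn/negP => dn0; have nd0 : 0 < `|d k0| by rewrite normr_gt0.
have bd i : m%:R ^+ i * `|d k0| <= e.
  rewrite -[m%:R ^+ i]ger0_norm ?exprn_ge0// -normrM -steps.
  by apply: hw; exact: leq_addr.
have geo i : i%:R <= m%:R ^+ i :> R.
  by rewrite -natrX ler_nat ltnW// ltn_expl.
have := bd (Num.truncn (e / `|d k0|)).+1; rewrite leNgt => /negP; apply.
rewrite -ltr_pdivrMr// (lt_le_trans _ (geo _))//.
exact: Num.Theory.truncnS_gt.
Qed.

End geometric_progressions_near_integers.

Section digit_polynomial.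
Context {R : realType} (D : finType) (p : D -> R) (u v : D -> nat).
Hypothesis p_prob : probability_vector p.
Implicit Types s t x a b : R.

Let p0 c : 0 <= p c. Proof. by case: p_prob. Qed.
Let p1 : \sum_c p c = 1. Proof. by case: p_prob. Qed.

(** Real and imaginary parts of the digit polynomial, the characteristic function of a single digit
    pair with law [p]; [digit_sq] is its squared modulus. *)
Definition digit_re s t : R := \sum_c p c * cos1 ((u c)%:R * s + (v c)%:R * t).
Definition digit_im s t : R := \sum_c p c * sin1 ((u c)%:R * s + (v c)%:R * t).
Definition digit_sq s t : R := digit_re s t ^+ 2 + digit_im s t ^+ 2.

Let ang c d s t : R := ((u c)%:R - (u d)%:R) * s + ((v c)%:R - (v d)%:R) * t.

Lemma digit_sqE s t :
  digit_sq s t = \sum_c \sum_d p c * p d * cos1 (((u c)%:R - (u d)%:R) * s + ((v c)%:R - (v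
      d)%:R) * t).
Proof.
rewrite /digit_sq !expr2 /digit_re /digit_im !mulr_suml -big_split/=.
apply: eq_bigr => c _; rewrite !mulr_sumr -big_split/=; apply: eq_bigr => d _.
have -> : ((u c)%:R - (u d)%:R) * s + ((v c)%:R - (v d)%:R) * t =
  ((u c)%:R * s + (v c)%:R * t) + - ((u d)%:R * s + (v d)%:R * t) by ring.
by rewrite [cos1 (_ - _)]cos1D cos1N sin1N; ring.
Qed.

Lemma digit_sq_ge0 s t : 0 <= digit_sq s t.
Proof. by rewrite addr_ge0 ?sqr_ge0. Qed.

Lemma digit_sq_compl s t : 1 - digit_sq s t = \sum_c \sum_d p c * p d * (1 - cos1 (ang c d s t)).
Proof.
rewrite digit_sqE; have {1}-> : 1 = \sum_c \sum_d p c * p d.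
  by under eq_bigr do rewrite -mulr_sumr p1 mulr1.
rewrite -sumrB; apply: eq_bigr => c _; rewrite -sumrB; apply: eq_bigr => d _.
by rewrite mulrBr mulr1.
Qed.

Let term_ge0 c d s t : 0 <= p c * p d * (1 - cos1 (ang c d s t)).
Proof.
rewrite !mulr_ge0// subr_ge0; exact: le_trans (ler_norm _) (cos1_max _).
Qed.

Lemma digit_sq_le1 s t : digit_sq s t <= 1.
Proof.
by rewrite -subr_ge0 digit_sq_compl; do 2 (apply: sumr_ge0 => ? _); exact: term_ge0.
Qed.

(** All terms in the expansion of [1 - digit_sq] are nonnegative. Hence a value near 1 forces the
    phase difference of any two digits of positive weight to be near an integer. *)
Lemma digit_sq_gap c d s t : p c * p d * (1 - cos1 (ang c d s t)) <= 1 - digit_sq s t.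
Proof.
rewrite digit_sq_compl (bigD1 c)//= (bigD1 d)//= -addrA lerDl addr_ge0//.
  by apply: sumr_ge0 => ? _; exact: term_ge0.
by do 2 (apply: sumr_ge0 => ? _); exact: term_ge0.
Qed.

(** Only [t] varies, because in the decay argument the dominant frequency is met exactly and the
    other one up to a small error. *)
Lemma digit_sq_lip : exists2 L : R, 0 <= L &
  forall s t t', `|digit_sq s t - digit_sq s t'| <= L * `|t - t'|.
Proof.
exists (\sum_c \sum_d p c * p d * (pi *+ 2 * `|(v c)%:R - (v d)%:R|)).
  do 2 (apply: sumr_ge0 => ? _); rewrite !mulr_ge0//.
  by rewrite mulrn_wge0 ?pi_ge0.
move=> s t t'; rewrite !digit_sqE -sumrB mulr_suml.
apply: le_trans (ler_norm_sum _ _ _) _; apply: ler_sum => c _.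
rewrite -sumrB mulr_suml.
apply: le_trans (ler_norm_sum _ _ _) _; apply: ler_sum => d _.
rewrite -mulrBr normrM ger0_norm ?mulr_ge0// -[in X in _ <= X]mulrA ler_wpM2l ?mulr_ge0//.
apply: le_trans (cos1_lip _ _) _; rewrite -mulrA -normrM mulrBr.
by rewrite opprD addrACA subrr add0r.
Qed.

End digit_polynomial.

Section continuity.
Context {R : realType}.

Lemma continuous_mul (f g : R -> R) :
  continuous f -> continuous g -> continuous (fun x => f x * g x).
Proof. by move=> cf cg x; apply: cvgM; [exact: cf | exact: cg]. Qed.

Lemma continuous_add (f g : R -> R) :
  continuous f -> continuous g -> continuous (fun x => f x + g x).
Proof. by move=> cf cg x; apply: cvgD; [exact: cf | exact: cg]. Qed.

Lemma continuous_prod (I : Type) (r : seq I) (f : I -> R -> R) :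
  (forall i, continuous (f i)) -> continuous (fun x => \prod_(i <- r) f i x).
Proof.
move=> cf; elim: r => [|i r IH].
  by under eq_fun do rewrite big_nil; exact: cst_continuous.
by under eq_fun do rewrite big_cons; exact: continuous_mul.
Qed.

Lemma continuous_sum (I : Type) (r : seq I) (f : I -> R -> R) :
  (forall i, continuous (f i)) -> continuous (fun x => \sum_(i <- r) f i x).
Proof.
move=> cf; elim: r => [|i r IH].
  by under eq_fun do rewrite big_nil; exact: cst_continuous.
by under eq_fun do rewrite big_cons; exact: continuous_add.
Qed.

End continuity.

Section decay_of_digit_products.
Context {R : realType} (D : finType) (p : D -> R).
Hypothesis p_prob : probability_vector p.
Implicit Types (u v : D -> nat) (m n : nat) (a b x : R).

Lemma digit_sqC u v s t : digit_sq p u v s t = digit_sq p v u t s.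
Proof.
by rewrite /digit_sq; congr (_ ^+ 2 + _ ^+ 2); apply: eq_bigr => c _; rewrite addrC.
Qed.

Definition digit_prod u v m n a b (N : nat) x : R :=
  \prod_(i < N) digit_sq p u v (a * m%:R `^ x * m%:R ^+ i) (b * n%:R `^ x * n%:R ^+ i).

Lemma digit_prod01 u v m n a b N x : 0 <= digit_prod u v m n a b N x <= 1.
Proof.
apply/andP; split; first by apply: prodr_ge0 => i _; exact: digit_sq_ge0.
by apply: prodr_ile1 => i _; rewrite digit_sq_ge0 digit_sq_le1.
Qed.

Lemma digit_prodS u v m n a b N x : digit_prod u v m n a b N.+1 x <= digit_prod u v m n a b N x.
Proof.
rewrite /digit_prod big_ord_recr/= ler_piMr ?digit_sq_le1//.
by have /andP[] := digit_prod01 u v m n a b N x.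
Qed.

Lemma continuous_powR_base m : (0 < m)%N -> continuous (fun x : R => m%:R `^ x).
Proof.
move=> m0; have -> : (fun x : R => m%:R `^ x) = fun x => expR (x * ln m%:R).
  by apply/funext => x; rewrite /powR pnatr_eq0 gtn_eqF.
move=> x; apply: continuous_comp; last exact: continuous_expR.
by apply: mulrr_continuous.
Qed.

Lemma digit_prod_continuous u v m n a b N : (0 < m)%N -> (0 < n)%N ->
  continuous (digit_prod u v m n a b N).
Proof.
move=> m0 n0.
have cA (q k : nat) (e z : R) : (0 < q)%N -> continuous (fun x : R => e * (z * q%:R `^ x * q%:R
    ^+ k)).
  move=> q0; apply: continuous_mul; first exact: cst_continuous.
  apply: continuous_mul; last exact: cst_continuous.
  by apply: continuous_mul; [exact: cst_continuous | exact: continuous_powR_base].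
apply: continuous_prod => i; rewrite /digit_sq.
have cang c : continuous (fun x => pi *+ 2 * ((u c)%:R * (a * m%:R `^ x * m%:R ^+ i) +
    (v c)%:R * (b * n%:R `^ x * n%:R ^+ i))).
  by apply: continuous_mul; [exact: cst_continuous | apply: continuous_add; exact: cA].
under eq_fun do rewrite !expr2.
apply: continuous_add; apply: continuous_mul; apply: continuous_sum => c;
  (apply: continuous_mul; first exact: cst_continuous); move=> x.
1,2: exact: (continuous_comp (cang c x) (@continuous_cos R _)).
all: exact: (continuous_comp (cang c x) (@continuous_sin R _)).
Qed.

(* If the product does not tend to 0, its factors tend to 1, so the frequencies
   z k below approach the integers, and so does z k.+1 - n z k, a multiple of
   m^(x + k); this leaves only countably many values of m^x. *)
Lemma digit_prod_exceptional u v m n a b c d : (1 < m)%N -> (1 < n)%N -> m != n ->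
  a != 0 -> 0 < p c -> 0 < p d -> u c != u d ->
  exists e : nat -> R, forall eta x, 0 < eta ->
    (forall N, eta <= digit_prod u v m n a b N x) -> exists i, x = e i.
Proof.
move=> m1 n1 mn a0 pc0 pd0 ucd.
pose g : R := ((u c)%:R - (u d)%:R) * a * (m%:R - n%:R).
have g0 : g != 0.
  by rewrite /g !mulf_neq0// subr_eq0 eqr_nat.
(* Solves [g m^x m^k = j] for [x]. The pairs [(k, j)] are enumerated by [pickle]; 0 fills the
   numbers that code no pair. *)
exists (fun i => if unpickle i is Some (k, j) then
   ln ((j : int)%:~R / (g * m%:R ^+ (k : nat))) / ln m%:R else 0).
move=> eta x eta0 etaf.
have m0 : 0 < m%:R :> R by rewrite ltr0n ltnW.
have n0 : 0 < n%:R :> R by rewrite ltr0n ltnW.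
pose z k := ((u c)%:R - (u d)%:R) * (a * m%:R `^ x * m%:R ^+ k)
          + ((v c)%:R - (v d)%:R) * (b * n%:R `^ x * n%:R ^+ k).
have znear (e : R) : 0 < e -> exists k0, forall k, (k0 <= k)%N -> exists j : int, `|z k - j%:~R|
    <= e.
  move=> e0; have [||gap gap0 hgap] := @cos1_gap R (Num.min e 2^-1).
  - by rewrite lt_min e0 invr_gt0 ltr0n.
  - by rewrite ge_min lexx orbT.
  (* A factor [r] lowers a product that is at least [eta] by at least [eta * (1 - r)]; a drop below
     this constant therefore gives [1 - cos1 (z k) < gap]. *)
  have q0 : 0 < eta * (p c * p d * gap) by rewrite !mulr_gt0.
  have [k0 hk0] := nonincr_ratio eta0 etaf (fun N => digit_prodS u v m n a b N x) q0.
  exists k0 => k k0k; have := hk0 k k0k.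
  rewrite {2}/digit_prod big_ord_recr/= -/(digit_prod u v m n a b k x).
  set r := digit_sq _ _ _ _ _; have gp := digit_sq_gap u v p_prob c d
    (a * m%:R `^ x * m%:R ^+ k) (b * n%:R `^ x * n%:R ^+ k).
  rewrite -/r -/(z k) in gp => h.
  have h2 : eta * (1 - r) < eta * (p c * p d * gap).
    have : eta * (1 - r) <= digit_prod u v m n a b k x * (1 - r).
      by rewrite ler_wpM2r ?etaf// subr_ge0 digit_sq_le1.
    by lra.
  rewrite ltr_pM2l// in h2.
  have h3 : 1 - cos1 (z k) < gap.
    by have := le_lt_trans gp h2; rewrite ltr_pM2l// mulr_gt0.
  apply: contrapT => nj; have : cos1 (z k) <= 1 - gap; last by lra.
  apply: hgap => j; rewrite leNgt; apply/negP => hj; apply: nj; exists j.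
  by move: hj; rewrite lt_min => /andP[/ltW].
have [|k [j hkj]] := @geometric_near_int R m (g * m%:R `^ x) m1.
  (* The error of [z k.+1 - n * z k] is at most [1 + n] times that of the [z k]. *)
  move=> e e0; have [|k0 hk0] := znear (e / (1 + n%:R)); first by rewrite divr_gt0// addr_gt0.
  exists k0 => k k0k; have [j1 h1] := hk0 k k0k; have [j2 h2] := hk0 k.+1 (leq_trans k0k (leqnSn
      k)).
  exists (j2 - n%:Z * j1).
  have -> : g * m%:R `^ x * m%:R ^+ k - (j2 - n%:Z * j1)%:~R = (z k.+1 - j2%:~R) - n%:R * (z k -
      j1%:~R).
    by rewrite /z /g !exprS intrB intrM -[n%:Z%:~R]/(n%:R); ring.
  apply: le_trans (ler_normB _ _) _; rewrite normrM (ger0_norm (ltW n0)).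
  have -> : e = e / (1 + n%:R) + n%:R * (e / (1 + n%:R)).
    by field; rewrite nat1r pnatr_eq0.
  by rewrite lerD// ler_wpM2l// ltW.
exists (pickle (k, j)); rewrite pickleK.
have mk0 : m%:R ^+ k != 0 :> R by rewrite expf_neq0// gt_eqF.
have -> : j%:~R / (g * m%:R ^+ k) = m%:R `^ x.
  by rewrite -hkj; field; rewrite g0 mk0.
by rewrite ln_powR mulfK// gt_eqF// ln_gt0// ltr1n.
Qed.

End decay_of_digit_products.

Section average_decay.
Context {R : realType} (D : finType) (p : D -> R).
Hypothesis p_prob : probability_vector p.
Implicit Types (u v : D -> nat) (m n : nat) (a b x : R).

Lemma normr_prod_sub (N : nat) (f g : nat -> R) :
  (forall i, 0 <= f i <= 1) -> (forall i, 0 <= g i <= 1) ->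
  `|\prod_(i < N) f i - \prod_(i < N) g i| <= \sum_(i < N) `|f i - g i|.
Proof.
move=> hf hg; elim: N => [|N IH]; first by rewrite !big_ord0 subrr normr0.
rewrite !big_ord_recr/=.
set F := \prod_(i < N) f i in IH *; set G := \prod_(i < N) g i in IH *.
have -> : F * f N - G * g N = (F - G) * f N + G * (f N - g N) by ring.
apply: le_trans (ler_normD _ _) _; rewrite !normrM lerD//.
  apply: le_trans IH; rewrite ler_piMr// ger0_norm; by have /andP[] := hf N.
rewrite ler_piMl// ger0_norm; last by apply: prodr_ge0 => i _; have /andP[] := hg i.
by apply: prodr_ile1.
Qed.

Lemma digit_prod_lip u v m n a N : (0 < n)%N -> exists2 L : R, 0 < L &
  forall b b' x, 0 <= x <= 1 ->
  `|digit_prod p u v m n a b N x - digit_prod p u v m n a b' N x| <= L * `|b - b'|.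
Proof.
move=> n0; have [L L0 hL] := digit_sq_lip u v p_prob.
have n1 : 1 <= n%:R :> R by rewrite ler1n.
(* The summand 1 makes the constant positive, so that one may divide by it. *)
exists (N%:R * (L * (n%:R * n%:R ^+ N)) + 1).
  by rewrite ltr_wpDl// !mulr_ge0// exprn_ge0.
move=> b b' x /andP[x0 x1]; apply: (@le_trans _ _ (N%:R * (L * (n%:R * n%:R ^+ N)) * `|b -
    b'|)); last first.
  by rewrite ler_wpM2r// lerDl.
pose F c (i : nat) := digit_sq p u v (a * m%:R `^ x * m%:R ^+ i) (c * n%:R `^ x * n%:R ^+ i).
have F01 c i : 0 <= F c i <= 1 by rewrite digit_sq_ge0 digit_sq_le1.
apply: le_trans (@normr_prod_sub N (F b) (F b') _ _) _ => //.
have -> : N%:R * (L * (n%:R * n%:R ^+ N)) * `|b - b'| =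
   \sum_(i < N) (L * (n%:R * n%:R ^+ N) * `|b - b'|).
  by rewrite sumr_const card_ord -[RHS]mulr_natl -!mulrA.
apply: ler_sum => i _; apply: le_trans (hL _ _ _) _.
rewrite -[in X in _ <= X]mulrA ler_wpM2l// -!mulrBl -mulrA normrM mulrC ler_wpM2r//.
rewrite ger0_norm ?mulr_ge0 ?powR_ge0 ?exprn_ge0//.
rewrite ler_pM ?powR_ge0 ?exprn_ge0//; last by rewrite ler_weXn2l// ltnW.
by rewrite -[in X in _ <= X](powRr1 (ler0n R n)) ler_powR.
Qed.

Lemma sum_ltn_indicator (k N : nat) : (\sum_(0 <= i < N) (i < k) <= k)%N.
Proof.
suff -> : (\sum_(0 <= i < N) (i < k) = minn N k)%N by rewrite geq_minr.
elim: N => [|N IH]; first by rewrite big_geq// min0n.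
by rewrite big_nat_recr//= IH; case: ltnP => /=; lia.
Qed.

(** The limit is 0 except for [r = 1]. That case does occur, when [ln P / ln m = ln Q / ln n]; this
    is why the products are studied for an arbitrary second amplitude [b]. *)
Lemma geometric_limit (b r : R) : b = 0 \/ 0 <= r <= 1 ->
  exists l : R, forall e, 0 < e -> exists k0, forall k, (k0 <= k)%N -> `|b * r ^+ k - l| <= e.
Proof.
move=> [->|/andP[r0 r1]].
  by exists 0 => e e0; exists 0%N => k _; rewrite mul0r subrr normr0 ltW.
have [->|rn1] := eqVneq r 1.
  by exists b => e e0; exists 0%N => k _; rewrite expr1n mulr1 subrr normr0 ltW.
exists 0 => e e0.
have : (b * r ^+ k @[k --> \oo] --> b * 0)%classic.
  by apply: cvgMl_tmp; apply: cvg_expr; rewrite ger0_norm// lt_neqAle rn1.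
rewrite mulr0 => /cvgrPdist_le /(_ e e0)[k0 _ h]; exists k0 => k /h.
by rewrite sub0r normrN subr0.
Qed.

Lemma powR_floor_frac (q k : nat) (theta : R) : (0 < q)%N -> 0 <= theta ->
  q%:R `^ orbit_frac theta k * q%:R ^+ Num.truncn (k%:R * theta) = (q%:R `^ theta) ^+ k.
Proof.
move=> q0 th0; have kth : 0 <= k%:R * theta by rewrite mulr_ge0.
have qn0 : q%:R != 0 :> R by rewrite pnatr_eq0 -lt0n.
rewrite -!powR_mulrn ?powR_ge0// -powRD ?qn0 ?implybT// -powRrM; congr (_ `^ _).
have fl : Num.floor (k%:R * theta) = Num.truncn (k%:R * theta).
  apply: Num.Theory.floor_def; rewrite intrD; have := Num.Theory.truncn_itv kth.
  by rewrite -natr1.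
by rewrite /orbit_frac fl [RHS]mulrC subrK.
Qed.

(** What self-affinity says about the squared modulus of a characteristic function: splitting off
    the first digit divides the frequencies by the bases. *)
Definition scaling_relation u v m n (M : R -> R -> R) :=
  forall s t, M s t = digit_sq p u v (s / m%:R) (t / n%:R) * M (s / m%:R) (t / n%:R).

Lemma scaling_relation_prod u v m n M : (0 < m)%N -> (0 < n)%N ->
  (forall s t, 0 <= M s t <= 2) ->
  scaling_relation u v m n M -> forall s t l,
  M (s * m%:R ^+ l) (t * n%:R ^+ l) <=
    2 * \prod_(i < l) digit_sq p u v (s * m%:R ^+ i) (t * n%:R ^+ i).
Proof.
move=> m0 n0 M02 MT s t; elim=> [|l IH].
  by rewrite big_ord0 !expr0 !mulr1; have /andP[] := M02 s t.
rewrite MT !exprSr !mulrA !mulfK ?pnatr_eq0 -?lt0n// big_ord_recr/= mulrA mulrC.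
by rewrite ler_wpM2r ?digit_sq_ge0.
Qed.

(** With [x] and [l] the fractional and integer parts of [k theta], [A P^k] is [A m^x m^l] because
    [m^theta = P], while [B Q^k] is [B r^k n^x n^l] with [r = Q / n^theta]. By the dominance
    hypothesis [r <= 1] or [B = 0], so [B r^k] converges to some [b]. Up to a small error the
    scaling relation then bounds [M] by a function of [x] alone, to which [orbit_average]
    applies. *)
Lemma average_decay_dominant u v m n (P Q : nat) (A B : R) c d M :
  (1 < m)%N -> (1 < n)%N -> m != n -> (1 < P)%N ->
  A != 0 -> 0 < p c -> 0 < p d -> u c != u d ->
  irrational (ln P%:R / ln m%:R : R) ->
  (B = 0 \/ ln Q%:R / ln n%:R <= ln P%:R / ln m%:R :> R) -> (0 < Q)%N ->
  (forall s t, 0 <= M s t <= 2) -> scaling_relation u v m n M ->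
  forall e, 0 < e -> exists N0, forall N, (N0 <= N)%N ->
    \sum_(0 <= k < N) M (A * P%:R ^+ k) (B * Q%:R ^+ k) <= e * N%:R.
Proof.
move=> m1 n1 mn P1 A0 pc0 pd0 ucd irr BQ Q0 M02 MT e e0.
set theta := ln P%:R / ln m%:R in irr BQ.
have m0 := ltnW m1; have n0 := ltnW n1.
have lm0 : 0 < ln m%:R :> R by rewrite ln_gt0// ltr1n.
have ln0 : 0 < ln n%:R :> R by rewrite ln_gt0// ltr1n.
have lP0 : 0 < ln P%:R :> R by rewrite ln_gt0// ltr1n.
have th0 : 0 < theta by rewrite divr_gt0.
have powE (q : nat) y : (0 < q)%N -> q%:R `^ y = expR (y * ln q%:R) :> R.
  by move=> q0; rewrite /powR pnatr_eq0 gtn_eqF.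
have mP : m%:R `^ theta = P%:R.
  by rewrite powE// divfK ?gt_eqF// lnK// posrE ltr0n ltnW.
have nth0 : 0 < n%:R `^ theta by rewrite powR_gt0// ltr0n.
pose r : R := Q%:R / n%:R `^ theta.
have [b hb] : exists b : R, forall e, 0 < e -> exists k0, forall k, (k0 <= k)%N -> `|B * r ^+ k
    - b| <= e.
  apply: geometric_limit; case: BQ => [->|BQ]; [by left|right].
  rewrite /r divr_ge0 ?powR_ge0//= ler_pdivrMr// mul1r.
  rewrite -[Q%:R]lnK ?posrE ?ltr0n// powE// ler_expR.
  by rewrite -ler_pdivrMr.
have [E hE] := digit_prod_exceptional p_prob v b m1 n1 mn A0 pc0 pd0 ucd.
have e8 : 0 < e / 8 by rewrite divr_gt0.
have [N [M0 hN]] := orbit_average irr (fun N x => digit_prod01 p_prob u v m n A b N x)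
   (fun N x => digit_prodS p_prob u v m n A b N x)
   (fun N => @digit_prod_continuous _ _ p u v m n A b N m0 n0) hE e8.
have [L L0 hL] := digit_prod_lip u v m A N n0.
have [k1 hk1] := hb (e / 8 / L) (divr_gt0 e8 L0).
(* From [k2] on the integer part of [k theta] is at least [N], so all [N] factors of [digit_prod]
   are present. *)
pose k2 := (Num.truncn (N%:R / theta)).+1.
pose k3 := maxn k1 k2.
(* The indicator pays, with the trivial bound 2, for the finitely many [k < k3]. *)
have pt k : M (A * P%:R ^+ k) (B * Q%:R ^+ k) <=
   2 * (k < k3)%N%:R + (2 * digit_prod p u v m n A b N (orbit_frac theta k) + e / 4).
  have fr := orbit_frac_itv theta k.
  have dp0 : 0 <= digit_prod p u v m n A b N (orbit_frac theta k).
    by have /andP[] := digit_prod01 p_prob u v m n A b N (orbit_frac theta k).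
  have [kk3|] := ltnP k k3.
    by have /andP[_ h] := M02 (A * P%:R ^+ k) (B * Q%:R ^+ k); rewrite mulr1; lra.
  rewrite geq_max => /andP[k1k k2k]; rewrite mulr0 add0r.
  have Nl : (N <= Num.truncn (k%:R * theta))%N.
    have kt0 : 0 <= k%:R * theta by rewrite mulr_ge0 ?(ltW th0).
    rewrite (Num.Theory.truncn_ge_nat _ kt0).
    rewrite -ler_pdivrMr//.
    by apply: le_trans (ltW (Num.Theory.truncnS_gt _)) _; rewrite ler_nat.
  have -> : A * P%:R ^+ k = A * m%:R `^ orbit_frac theta k * m%:R ^+ Num.truncn (k%:R * theta).
    by rewrite -mulrA powR_floor_frac ?mP// ltW.
  have -> : B * Q%:R ^+ k = B * r ^+ k * n%:R `^ orbit_frac theta k * n%:R ^+ Num.truncn (k%:R *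
      theta).
    rewrite -mulrA powR_floor_frac ?(ltW th0)// /r expr_div_n -mulrA divfK// expf_neq0//.
    by rewrite gt_eqF.
  apply: le_trans (scaling_relation_prod m0 n0 M02 MT _ _ _) _.
  have := hL (B * r ^+ k) b (orbit_frac theta k) fr.
  have : L * `|B * r ^+ k - b| <= e / 8.
    by rewrite mulrC -ler_pdivlMr// hk1.
  have : digit_prod p u v m n A (B * r ^+ k) (Num.truncn (k%:R * theta)) (orbit_frac theta k) <=
         digit_prod p u v m n A (B * r ^+ k) N (orbit_frac theta k).
    rewrite -(subnKC Nl); elim: (_ - _)%N => [|i IH]; first by rewrite addn0.
    by rewrite addnS; apply: le_trans (digit_prodS p_prob _ _ _ _ _ _ _ _) _.
  rewrite -/(digit_prod p u v m n A (B * r ^+ k) _ _) ler_norml => h1 h2 /andP[h3 h4].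
  by lra.
have [N1 hN1] : exists N1 : nat, 2 * k3%:R <= e / 4 * N1%:R.
  exists (Num.truncn (2 * k3%:R / (e / 4))).+1.
  by rewrite [in X in _ <= X]mulrC -ler_pdivrMr ?divr_gt0// ltW// Num.Theory.truncnS_gt.
exists (maxn M0 N1) => N'; rewrite geq_max => /andP[M0N' N1N'].
apply: le_trans (ler_sum _ (fun k _ => pt k)) _.
rewrite !big_split/= -!mulr_sumr sumr_const_nat subn0 -natr_sum.
have h1 := hN _ M0N'.
have h2 : (\sum_(0 <= k < N') (k < k3))%:R <= k3%:R :> R by rewrite ler_nat sum_ltn_indicator.
have h3 : e / 4 * N1%:R <= e / 4 * N'%:R by rewrite ler_wpM2l ?divr_ge0 ?(ltW e0)// ler_nat.
have h4 : 0 <= e * N'%:R by rewrite mulr_ge0 ?(ltW e0).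
by rewrite -[_ *+ N']mulr_natr; lra.
Qed.

End average_decay.

Section average_decay_symmetric.
Context {R : realType} (D : finType) (p : D -> R).
Hypothesis p_prob : probability_vector p.

(* The coordinate whose frequencies grow faster relative to its own base
   decides: rescaling by its digits sends the other frequency to 0. *)
Lemma average_decay (u v : D -> nat) (m n P Q : nat) (A B : R) (M : R -> R -> R) :
  (1 < m)%N -> (1 < n)%N -> m != n -> (1 < P)%N -> (1 < Q)%N ->
  irrational (ln P%:R / ln m%:R : R) -> irrational (ln Q%:R / ln n%:R : R) ->
  A != 0 \/ B != 0 ->
  (A != 0 -> exists c d, [/\ 0 < p c, 0 < p d & u c != u d]) ->
  (B != 0 -> exists c d, [/\ 0 < p c, 0 < p d & v c != v d]) ->
  (forall s t, 0 <= M s t <= 2) -> scaling_relation p u v m n M ->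
  forall e, 0 < e -> exists N0, forall N, (N0 <= N)%N ->
    \sum_(0 <= k < N) M (A * P%:R ^+ k) (B * Q%:R ^+ k) <= e * N%:R.
Proof.
move=> m1 n1 mn P1 Q1 irrP irrQ AB hA hB M02 MT.
have MT' : scaling_relation p v u n m (fun s t => M t s).
  by move=> s t; rewrite MT digit_sqC.
have swapped : B != 0 -> A = 0 \/ ln P%:R / ln m%:R <= ln Q%:R / ln n%:R :> R ->
    forall e, 0 < e -> exists N0, forall N, (N0 <= N)%N ->
    \sum_(0 <= k < N) M (A * P%:R ^+ k) (B * Q%:R ^+ k) <= e * N%:R.
  move=> B0 hPQ; have [c [d [pc pd cd]]] := hB B0.
  rewrite eq_sym in mn.
  exact: (average_decay_dominant p_prob n1 m1 mn Q1 B0 pc pd cd irrQ hPQ (ltnW P1)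
    (fun s t => M02 t s) MT').
have [A0|A0] := eqVneq A 0.
  by apply: swapped; [case: AB => //; rewrite A0 eqxx | left].
have [c [d [pc pd cd]]] := hA A0.
have main h := average_decay_dominant p_prob m1 n1 mn P1 A0 pc pd cd irrP h (ltnW Q1) M02 MT.
have [B0|B0] := eqVneq B 0; first by apply: main; left.
have [PQ|/ltW PQ] := leP (ln Q%:R / ln n%:R : R) (ln P%:R / ln m%:R).
  by apply: main; right.
by apply: swapped => //; right.
Qed.

End average_decay_symmetric.

(** * Characteristic functions of bounded random vectors *)

Section means_of_bounded_functions.
Context {R : realType} {d : measure_display} {T : measurableType d} (P : probability T R).
Implicit Types f g : T -> R.

Definition bounded_mfun f : Prop :=
  measurable_fun setT f /\ exists K : R, forall x, `|f x| <= K.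

Definition mean f : R := \int[P]_(x in setT) f x.

Lemma bounded_mfun_cst (c : R) : bounded_mfun (fun=> c).
Proof. by split; [exact: measurable_cst | exists `|c|]. Qed.

Lemma bounded_mfunD f g : bounded_mfun f -> bounded_mfun g -> bounded_mfun (fun x => f x + g x).
Proof.
move=> [mf [K hK]] [mg [L hL]]; split; first exact: measurable_funD.
by exists (K + L) => x; apply: le_trans (ler_normD _ _) _; rewrite lerD.
Qed.

Lemma bounded_mfunM f g : bounded_mfun f -> bounded_mfun g -> bounded_mfun (fun x => f x * g x).
Proof.
move=> [mf [K hK]] [mg [L hL]]; split; first exact: measurable_funM.
by exists (K * L) => x; rewrite normrM ler_pM.
Qed.

Lemma bounded_mfunZ (c : R) f : bounded_mfun f -> bounded_mfun (fun x => c * f x).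
Proof. by apply: bounded_mfunM; exact: bounded_mfun_cst. Qed.

Lemma bounded_mfunN f : bounded_mfun f -> bounded_mfun (fun x => - f x).
Proof. by move=> /(bounded_mfunZ (-1)); under eq_fun do rewrite mulN1r. Qed.

Lemma bounded_mfun_sum (I : Type) (r : seq I) (F : I -> T -> R) :
  (forall i, bounded_mfun (F i)) -> bounded_mfun (fun x => \sum_(i <- r) F i x).
Proof.
move=> bF; elim: r => [|i r IH].
  by under eq_fun do rewrite big_nil; exact: bounded_mfun_cst.
by under eq_fun do rewrite big_cons; exact: bounded_mfunD.
Qed.

Lemma bounded_mfun_indic (A : set T) : measurable A -> bounded_mfun \1_A.
Proof.
move=> mA; split; first exact: measurable_indic.
by exists 1 => x; rewrite indicE; case: (x \in A); rewrite ?normr1 ?normr0.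
Qed.

Lemma bounded_mfun_integrable f : bounded_mfun f -> P.-integrable setT (EFin \o f).
Proof.
move=> [mf [K hK]]; apply: measurable_bounded_integrable => //.
  exact: le_lt_trans (probability_le1 P measurableT) (ltry 1).
exists K; split; first exact: num_real.
by move=> M KM x _; exact: le_trans (hK x) (ltW KM).
Qed.

Lemma mean_cst (c : R) : mean (fun=> c) = c.
Proof.
rewrite /mean Rintegral_cst//.
have -> : fine (P setT) = 1 by rewrite (_ : P setT = 1%E)//; exact: probability_setT.
by rewrite mulr1.
Qed.

Lemma meanD f g : bounded_mfun f -> bounded_mfun g -> mean (fun x => f x + g x) = mean f + mean g.
Proof. by move=> bf bg; rewrite /mean RintegralD//; exact: bounded_mfun_integrable. Qed.

Lemma meanZ (c : R) f : bounded_mfun f -> mean (fun x => c * f x) = c * mean f.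
Proof. by move=> bf; rewrite /mean RintegralZl//; exact: bounded_mfun_integrable. Qed.

Lemma meanN f : bounded_mfun f -> mean (fun x => - f x) = - mean f.
Proof.
by move=> /(meanZ (-1)); rewrite mulN1r => <-; congr mean; apply/funext => x; rewrite mulN1r.
Qed.

Lemma mean_sum (I : Type) (r : seq I) (F : I -> T -> R) :
  (forall i, bounded_mfun (F i)) -> mean (fun x => \sum_(i <- r) F i x) = \sum_(i <- r) mean (F i).
Proof.
move=> bF; elim: r => [|i r IH].
  by under eq_fun do rewrite big_nil; rewrite mean_cst big_nil.
under eq_fun do rewrite big_cons; rewrite meanD ?IH ?big_cons//.
exact: bounded_mfun_sum.
Qed.

Lemma le_mean f g : bounded_mfun f -> bounded_mfun g -> (forall x, f x <= g x) -> mean f <= mean g.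
Proof. by move=> bf bg fg; apply: le_Rintegral => //; exact: bounded_mfun_integrable. Qed.

Lemma mean_indic (A : set T) : measurable A -> (mean \1_A)%:E = P A.
Proof.
move=> mA; rewrite /mean /Rintegral integral_indic// setIT fineK//.
exact: fin_num_measure.
Qed.

Lemma mean_norm_le f (K : R) : bounded_mfun f -> (forall x, `|f x| <= K) -> `|mean f| <= K.
Proof.
move=> bf fK; rewrite ler_norml; apply/andP; split.
  rewrite -[X in X <= _]mean_cst le_mean//; first exact: bounded_mfun_cst.
  by move=> x; have := fK x; rewrite ler_norml => /andP[].
rewrite -[X in _ <= X]mean_cst le_mean//; first exact: bounded_mfun_cst.
by move=> x; have := fK x; rewrite ler_norml => /andP[].
Qed.

Lemma mean_markov f (e : R) (A : set T) : bounded_mfun f -> (forall x, 0 <= f x) ->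
  0 < e -> measurable A -> (forall x, A x -> e <= f x) -> (P A <= (mean f / e)%:E)%E.
Proof.
move=> bf f0 e0 mA Af; rewrite -mean_indic// lee_fin ler_pdivlMr// mulrC.
rewrite -meanZ; last exact: bounded_mfun_indic.
apply: le_mean => //; first by apply: bounded_mfunZ; exact: bounded_mfun_indic.
move=> x; rewrite indicE; have [|_] := boolP (x \in A); last by rewrite mulr0.
by rewrite inE mulr1 => /Af.
Qed.

End means_of_bounded_functions.

Section complex_exponential.
Context {R : realType}.
Implicit Types (s t : R) (z w : R[i]).

Definition cis t : R[i] := Complex (cos1 t) (sin1 t).
Definition nsq z : R := complex.Re z ^+ 2 + complex.Im z ^+ 2.

Lemma cisD s t : cis (s + t) = cis s * cis t.
Proof.
rewrite /cis cos1D sin1D /GRing.mul/=; congr Complex.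
by rewrite addrC.
Qed.

Lemma cis_conj t : cis (- t) = (cis t)^*%C.
Proof. by rewrite /cis cos1N sin1N. Qed.

Lemma cis0 : cis 0 = 1.
Proof. by rewrite /cis cos1_0 sin1_0. Qed.

Lemma nsqM z w : nsq (z * w) = nsq z * nsq w.
Proof. by case: z w => [a b] [c e]; rewrite /nsq/=; ring. Qed.

Lemma nsq_cis t : nsq (cis t) = 1.
Proof. by rewrite /nsq/= cos1_sin1. Qed.

Lemma nsq_ge0 z : 0 <= nsq z.
Proof. by rewrite addr_ge0 ?sqr_ge0. Qed.

Lemma nsqN z : nsq (- z) = nsq z.
Proof. by case: z => [a b]; rewrite /nsq/= !sqrrN. Qed.

Lemma nsq_gt0 z : z != 0 -> 0 < nsq z.
Proof.
case: z => [a b]; rewrite eq_complex/= negb_and => h.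
rewrite lt_neqAle nsq_ge0 andbT eq_sym /nsq/= paddr_eq0 ?sqr_ge0// negb_and.
by rewrite !sqrf_eq0.
Qed.

Lemma nsqE z : nsq z = complex.Re (z * z^*%C).
Proof. by case: z => [a b]; rewrite /nsq/=; ring. Qed.

Lemma nsqD_le z w : nsq (z + w) <= 2 * nsq z + 2 * nsq w.
Proof.
case: z w => [a b] [c e]; rewrite /nsq/=.
by have := sqr_ge0 (a - c); have := sqr_ge0 (b - e); nra.
Qed.

(** Lets a bound on sums of squared moduli control sums of real parts, with no square roots. *)
Lemma Re_le_nsq z (e : R) : 0 < e -> complex.Re z <= e + nsq z / e.
Proof.
move=> e0; rewrite -(ler_pM2r e0) mulrDl divfK ?gt_eqF// /nsq.
by have := sqr_ge0 (complex.Re z - e); have := sqr_ge0 (complex.Im z); nra.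
Qed.

Lemma Re_sum (I : Type) (r : seq I) (F : I -> R[i]) :
  complex.Re (\sum_(i <- r) F i) = \sum_(i <- r) complex.Re (F i).
Proof. by elim: r => [|i r IH]; rewrite ?big_nil// !big_cons -IH; case: (F i) (\sum_(j <- r) _)
    => [? ?] []. Qed.

Lemma Im_sum (I : Type) (r : seq I) (F : I -> R[i]) :
  complex.Im (\sum_(i <- r) F i) = \sum_(i <- r) complex.Im (F i).
Proof. by elim: r => [|i r IH]; rewrite ?big_nil// !big_cons -IH; case: (F i) (\sum_(j <- r) _)
    => [? ?] []. Qed.

Lemma ReM z w : complex.Re (z * w) = complex.Re z * complex.Re w - complex.Im z * complex.Im w.
Proof. by case: z w => [? ?] []. Qed.

Lemma conjcM z w : (z * w)^*%C = z^*%C * w^*%C.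
Proof. exact: rmorphM. Qed.

Lemma nsq_sum (I : Type) (r : seq I) (F : I -> R[i]) :
  nsq (\sum_(i <- r) F i) = \sum_(i <- r) \sum_(j <- r) complex.Re (F i * (F j)^*%C).
Proof.
rewrite nsqE rmorph_sum mulr_suml Re_sum; apply: eq_bigr => i _.
by rewrite mulr_sumr Re_sum.
Qed.

End complex_exponential.

Section characteristic_functions.
Context {R : realType} {d : measure_display} {T : measurableType d} (P : probability T R).
Context (X Y : T -> R).
Hypotheses (mX : measurable_fun setT X) (mY : measurable_fun setT Y).

Lemma measurable_ang (s t : R) : measurable_fun setT (fun w => s * X w + t * Y w).
Proof.
by apply: measurable_funD; apply: measurable_funM => //; exact: measurable_cst.
Qed.

Lemma bounded_mfun_cos1 (f : T -> R) : measurable_fun setT f -> bounded_mfun (fun w => cos1 (f w)).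
Proof.
move=> mf; split; last by exists 1 => w; exact: cos1_max.
apply: (@measurableT_comp _ _ _ _ _ _ (@cos R)).
  by apply: continuous_measurable_fun; exact: continuous_cos.
by apply: measurable_funM => //; exact: measurable_cst.
Qed.

Lemma bounded_mfun_sin1 (f : T -> R) : measurable_fun setT f -> bounded_mfun (fun w => sin1 (f w)).
Proof.
move=> mf; split; last by exists 1 => w; exact: sin1_max.
apply: (@measurableT_comp _ _ _ _ _ _ (@sin R)).
  by apply: continuous_measurable_fun; exact: continuous_sin.
by apply: measurable_funM => //; exact: measurable_cst.
Qed.

Definition charf (s t : R) : R[i] :=
  Complex (mean P (fun w => cos1 (s * X w + t * Y w)))
          (mean P (fun w => sin1 (s * X w + t * Y w))).

Lemma charf00 : charf 0 0 = 1.
Proof.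
have h w : 0 * X w + 0 * Y w = 0 by rewrite !mul0r addr0.
have -> : (1 : R[i]) = Complex 1 0 by [].
congr Complex.
  by rewrite -[RHS](mean_cst P); congr mean; apply/funext => w; rewrite h cos1_0.
by rewrite -[RHS](mean_cst P); congr mean; apply/funext => w; rewrite h sin1_0.
Qed.

Lemma charfN s t : charf (- s) (- t) = (charf s t)^*%C.
Proof.
rewrite /charf /=; congr Complex.
  by congr mean; apply/funext => w; rewrite !mulNr -opprD cos1N.
rewrite -meanN; last exact: bounded_mfun_sin1 (measurable_ang _ _).
by congr mean; apply/funext => w; rewrite !mulNr -opprD sin1N.
Qed.

Lemma nsq_charf_le2 s t : 0 <= nsq (charf s t) <= 2.
Proof.
rewrite nsq_ge0/= -[2]/(1 + 1) lerD// -[X in X <= _]ger0_norm ?sqr_ge0// normrX expr_le1//.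
  apply: mean_norm_le => [|w]; last exact: cos1_max.
  exact: bounded_mfun_cos1 (measurable_ang _ _).
apply: mean_norm_le => [|w]; last exact: sin1_max.
exact: bounded_mfun_sin1 (measurable_ang _ _).
Qed.

(** Source of all the quadratic estimates: expanding the square reduces an L2 norm to values of
    [charf] at differences of frequencies. *)
Lemma mean_trig_polynomial (I : finType) (al : I -> R[i]) (xi et : I -> R) :
  bounded_mfun (fun w => nsq (\sum_i al i * cis (xi i * X w + et i * Y w))) /\
  mean P (fun w => nsq (\sum_i al i * cis (xi i * X w + et i * Y w))) =
  \sum_i \sum_j complex.Re (al i * (al j)^*%C * charf (xi i - xi j) (et i - et j)).
Proof.
pose be i j := al i * (al j)^*%C.
have pt w : nsq (\sum_i al i * cis (xi i * X w + et i * Y w)) =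
  \sum_i \sum_j (complex.Re (be i j) * cos1 ((xi i - xi j) * X w + (et i - et j) * Y w) +
     - complex.Im (be i j) * sin1 ((xi i - xi j) * X w + (et i - et j) * Y w)).
  rewrite nsq_sum; apply: eq_bigr => i _; apply: eq_bigr => j _.
  rewrite conjcM mulrACA -/(be i j). rewrite -cis_conj -cisD ReM mulNr.
  by congr (_ * cos1 _ - _ * sin1 _); ring.
have bc i j := bounded_mfun_cos1 (measurable_ang (xi i - xi j) (et i - et j)).
have bs i j := bounded_mfun_sin1 (measurable_ang (xi i - xi j) (et i - et j)).
under eq_fun do rewrite pt; split.
  by do 2 (apply: bounded_mfun_sum => ?); apply: bounded_mfunD; apply: bounded_mfunZ.
rewrite mean_sum => [|i]; last first.
  by apply: bounded_mfun_sum => j; apply: bounded_mfunD; apply: bounded_mfunZ.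
apply: eq_bigr => i _; rewrite mean_sum => [|j]; last first.
  by apply: bounded_mfunD; apply: bounded_mfunZ.
apply: eq_bigr => j _; rewrite meanD ?meanZ//; do ?exact: bounded_mfunZ.
by rewrite ReM mulNr.
Qed.

Hypotheses (X01 : forall w, 0 <= X w <= 1) (Y01 : forall w, 0 <= Y w <= 1).

Lemma charf_lip s t s' t' : 
  nsq (charf s t - charf s' t') <= 2 * (pi *+ 2 * (`|s - s'| + `|t - t'|)) ^+ 2.
Proof.
have pp : 0 <= pi *+ 2 :> R by rewrite mulrn_wge0 ?pi_ge0.
have ang w : `|(s * X w + t * Y w) - (s' * X w + t' * Y w)| <= `|s - s'| + `|t - t'|.
  rewrite opprD addrACA -!mulrBl; apply: le_trans (ler_normD _ _) _.
  by rewrite !normrM lerD// ler_piMr// ger0_norm; have /andP[] := X01 w; have /andP[] := Y01 w.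
rewrite mulr_natl mulr2n lerD//= -[X in X <= _]ger0_norm ?sqr_ge0// normrX lerXn2r ?nnegrE//.
- by rewrite mulr_ge0// addr_ge0.
- rewrite -meanN; last exact: bounded_mfun_cos1 (measurable_ang _ _).
  have b1 := bounded_mfun_cos1 (measurable_ang s t).
  have b2 := bounded_mfunN (bounded_mfun_cos1 (measurable_ang s' t')).
  rewrite -meanD//; apply: mean_norm_le; first exact: bounded_mfunD.
  by move=> w; apply: le_trans (cos1_lip _ _) _; rewrite ler_wpM2l.
- by rewrite mulr_ge0// addr_ge0.
- rewrite -meanN; last exact: bounded_mfun_sin1 (measurable_ang _ _).
  have b1 := bounded_mfun_sin1 (measurable_ang s t).
  have b2 := bounded_mfunN (bounded_mfun_sin1 (measurable_ang s' t')).
  rewrite -meanD//; apply: mean_norm_le; first exact: bounded_mfunD.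
  by move=> w; apply: le_trans (sin1_lip _ _) _; rewrite ler_wpM2l.
Qed.

End characteristic_functions.

Arguments charf : simpl never.

Lemma charfC {R : realType} {d : measure_display} {T : measurableType d} (P : probability T R)
    (X Y : T -> R) (s t : R) : charf P Y X s t = charf P X Y t s.
Proof. by rewrite /charf; congr Complex; congr mean; apply/funext => w; rewrite addrC. Qed.

(** * Bernoulli measures and digit expansions *)

Section digit_expansions.
Context {R : realType} (m : nat).
Hypothesis m1 : (1 < m)%N.
Implicit Type x : nat -> nat.

Definition expansion x : R := limn (series (fun k => (x k)%:R / m%:R ^+ k.+1 : R)).
Definition expansion_trunc x (k : nat) : R := \sum_(i < k) (x i)%:R / m%:R ^+ i.+1.

Let m0 : 0 < m%:R :> R. Proof. by rewrite ltr0n ltnW. Qed.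

Lemma expansion_truncE x : series (fun k => (x k)%:R / m%:R ^+ k.+1 : R) = expansion_trunc x.
Proof. by apply/funext => k; rewrite /series/= big_mkord. Qed.

Lemma expansion_trunc_nd x : {homo expansion_trunc x : i j / (i <= j)%N >-> i <= j}.
Proof.
move=> i j /subnKC <-; elim: (j - i)%N => [|k IH]; first by rewrite addn0.
rewrite addnS; apply: le_trans IH _; rewrite /expansion_trunc big_ord_recr/= lerDl.
by rewrite divr_ge0 ?exprn_ge0// ltW.
Qed.

(** The right ends of the nested [m]-adic intervals decrease, since a digit is at most [m - 1]. *)
Lemma expansion_trunc_tail x j k : (forall i, (x i < m)%N) -> (k <= j)%N ->
  expansion_trunc x j + (m%:R ^+ j)^-1 <= expansion_trunc x k + (m%:R ^+ k)^-1.
Proof.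
move=> xm /subnKC <-; elim: (j - k)%N => [|i IH]; first by rewrite addn0.
rewrite addnS; apply: le_trans IH; rewrite /expansion_trunc big_ord_recr/= -addrA lerD2l.
set q := (k + i)%N; have mq : 0 < (m%:R ^+ q.+1)^-1 :> R by rewrite invr_gt0 exprn_gt0.
have -> : (m%:R ^+ q)^-1 = m%:R * (m%:R ^+ q.+1)^-1 :> R.
  by rewrite exprS invfM mulrA divff ?mul1r// gt_eqF.
rewrite -[X in _ + X]mul1r -mulrDl ler_pM2r// -[1]/(1%:R) -natrD ler_nat.
by rewrite addn1; exact: xm.
Qed.

Lemma expansion_cvg x : (forall i, (x i < m)%N) ->
  (expansion_trunc x k @[k --> \oo] --> expansion x)%classic.
Proof.
move=> xm; rewrite /expansion expansion_truncE; apply: nondecreasing_is_cvgn.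
  exact: expansion_trunc_nd.
exists (expansion_trunc x 0 + (m%:R ^+ 0)^-1) => _ [k _ <-].
apply: le_trans (expansion_trunc_tail xm (leq0n k)).
by rewrite lerDl invr_ge0 exprn_ge0// ltW.
Qed.

Lemma expansion_itv x k : (forall i, (x i < m)%N) ->
  expansion_trunc x k <= expansion x <= expansion_trunc x k + (m%:R ^+ k)^-1.
Proof.
move=> xm; have cx := expansion_cvg xm; apply/andP; split.
  have <- := cvg_lim (@Rhausdorff R) cx; apply: nondecreasing_cvgn_le.
    exact: expansion_trunc_nd.
  by apply/cvg_ex; eexists; exact: cx.
rewrite -(cvg_lim (@Rhausdorff R) cx); apply: limr_le.
  by apply/cvg_ex; eexists; exact: cx.
exists k => // j /= kj; apply: le_trans (expansion_trunc_tail xm kj).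
by rewrite lerDl invr_ge0 exprn_ge0// ltW.
Qed.

Lemma expansion01 x : (forall i, (x i < m)%N) -> 0 <= expansion x <= 1.
Proof.
move=> xm; have := expansion_itv 0 xm.
by rewrite /expansion_trunc big_ord0 expr0 add0r invr1.
Qed.

(** The rate [2^-k] does not depend on the base, so that both coordinates share it. *)
Lemma expansion_dist x k : (forall i, (x i < m)%N) ->
  `|expansion x - expansion_trunc x k| <= (2%:R ^+ k)^-1.
Proof.
move=> xm; have /andP[h1 h2] := expansion_itv k xm.
rewrite ger0_norm ?subr_ge0// lerBlDl (le_trans h2)// lerD2l.
rewrite lef_pV2 ?posrE ?exprn_gt0//.
by rewrite lerXn2r ?nnegrE ?(ltW m0)// ler_nat.
Qed.

End digit_expansions.

Section bernoulli_measures.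
Context {R : realType} (D : finType) (a : D) (p : D -> R).
Context (P : probability (measurable_shift a) R).
Hypothesis Pp : is_bernoulli p P.
Local Notation W := (measurable_shift a).

Lemma measurable_coordinate_set (k : nat) (A : set D) : measurable [set w : W | A (w k)].
Proof.
have -> : [set w : W | A (w k)] = \big[setU/set0]_(c : D | c \in A) [set w : W | w k = c].
  rewrite -bigcup_seq_cond/=; apply/seteqP; split=> w /=.
    by move=> Aw; exists (w k) => //=; rewrite mem_index_enum mem_set.
  by move=> [c /= /andP[_]]; rewrite inE => Ac ->.
apply: bigsetU_measurable => c _; apply: sub_sigma_algebra; by exists k, c.
Qed.

Lemma measurable_coordinate (k : nat) (f : D -> R) : measurable_fun setT (fun w : W => f (w k)).
Proof.
move=> _ Y mY; rewrite setTI.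
exact: (@measurable_coordinate_set k (f @^-1` Y)).
Qed.

Lemma mean_prefix (k : nat) (G : {ffun 'I_k -> D} -> R) :
  bounded_mfun (fun w : W => G [ffun i : 'I_k => w i]) /\
  mean P (fun w : W => G [ffun i : 'I_k => w i]) = \sum_(f : {ffun 'I_k -> D}) G f * \prod_i p
      (f i).
Proof.
(* [is_bernoulli] describes cylinders by infinite words; a finite word is continued by the letter
   [a], which leaves its cylinder unchanged. *)
pose ext (f : {ffun 'I_k -> D}) (i : nat) : D := if insub i is Some j then f j else a.
pose C f : set W := [set w : W | forall i, (i < k)%N -> w i = ext f i].
have mC f : measurable (C f).
  have -> : C f = \bigcap_(i in `I_k) [set w : W | [set ext f i] (w i)].
    by apply/seteqP; split=> w /= h i ik; exact: h.
  apply: fin_bigcap_measurable => [|i _]; first exact: finite_II.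
  exact: measurable_coordinate_set.
have inC (w : W) f : (w \in C f) = ([ffun i : 'I_k => w i] == f).
  apply/idP/idP => [|/eqP <-].
    rewrite inE /= => h; apply/eqP/ffunP => i; rewrite ffunE h// /ext.
    by rewrite insubT//= => ik; congr (f _); apply: val_inj.
  rewrite inE /= => i ik; rewrite /ext insubT ffunE //.
have GE (w : W) : G [ffun i : 'I_k => w i] = \sum_(f : {ffun 'I_k -> D}) G f * \1_(C f) w.
  rewrite (bigD1 [ffun i : 'I_k => w i])//= big1 ?addr0 => [|f /negPf hf].
    by rewrite indicE inC eqxx mulr1.
  by rewrite indicE inC eq_sym hf mulr0.
under eq_fun do rewrite GE.
have bC f : bounded_mfun (fun w : W => G f * \1_(C f) w).
  by apply: bounded_mfunZ; exact: bounded_mfun_indic.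
split; first exact: bounded_mfun_sum.
rewrite mean_sum//; apply: eq_bigr => f _; rewrite meanZ; last exact: bounded_mfun_indic.
congr (_ * _); apply: EFin_inj; rewrite mean_indic// Pp; congr (_%:E).
by apply: eq_bigr => i _; rewrite /ext insubT//= => ik; congr (p (f _)); apply: val_inj.
Qed.

End bernoulli_measures.

Section bernoulli_characteristic_functions.
Context {R : realType} (D : finType) (a : D) (p : D -> R).
Context (P : probability (measurable_shift a) R) (u v : D -> nat) (m n : nat).
Hypothesis Pp : is_bernoulli p P.
Hypotheses (m1 : (1 < m)%N) (n1 : (1 < n)%N).
Hypotheses (um : forall c, (u c < m)%N) (vn : forall c, (v c < n)%N).
Local Notation W := (measurable_shift a).

Definition coord_expansion (q : nat) (f : D -> nat) (w : W) : R := expansion q (fun k => f (w k)).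
Local Notation X := (coord_expansion m u).
Local Notation Y := (coord_expansion n v).
Local Notation Xk k := (fun w : W => expansion_trunc m (fun i => u (w i)) k : R).
Local Notation Yk k := (fun w : W => expansion_trunc n (fun i => v (w i)) k : R).

Lemma measurable_expansion_trunc (q : nat) (f : D -> nat) k :
  measurable_fun setT (fun w : W => expansion_trunc q (fun k => f (w k)) k : R).
Proof.
rewrite /expansion_trunc; apply: measurable_sum => i.
apply: measurable_funM; last exact: measurable_cst.
exact: (measurable_coordinate i (fun c => (f c)%:R)).
Qed.

Lemma measurable_coord_expansion (q : nat) (f : D -> nat) : (1 < q)%N -> (forall c, (f c < q)%N) ->
  measurable_fun setT (coord_expansion q f).
Proof.
move=> q1 fq; apply: (@measurable_fun_cvg _ _ _ _
  (fun k (w : W) => expansion_trunc q (fun k => f (w k)) k)) => [k|w _].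
  exact: measurable_expansion_trunc.
exact: expansion_cvg.
Qed.

Let mX : measurable_fun setT X. Proof. exact: measurable_coord_expansion. Qed.
Let mY : measurable_fun setT Y. Proof. exact: measurable_coord_expansion. Qed.

Definition digit_phi (s t : R) : R[i] := Complex (digit_re p u v s t) (digit_im p u v s t).

Lemma digit_phiE s t : digit_phi s t = \sum_c (p c)%:C%C * cis ((u c)%:R * s + (v c)%:R * t).
Proof.
apply/eqP; rewrite eq_complex Re_sum Im_sum /=; apply/andP; split; apply/eqP;
  by apply: eq_bigr => c _ /=; rewrite mul0r ?subr0 ?addr0.
Qed.

(** Independence of the digits, in the form of distributivity: a sum over words of products is a
    product of sums over letters. *)
Lemma charf_trunc k s t :
  charf P (Xk k) (Yk k) s t = \prod_(i < k) digit_phi (s / m%:R ^+ i.+1) (t / n%:R ^+ i.+1).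
Proof.
pose A (f : {ffun 'I_k -> D}) : R := s * (\sum_(i < k) (u (f i))%:R / m%:R ^+ i.+1)
  + t * (\sum_(i < k) (v (f i))%:R / n%:R ^+ i.+1).
have AE (w : W) : s * expansion_trunc m (fun k => u (w k)) k + t * expansion_trunc n (fun k => v
    (w k)) k
    = A [ffun i : 'I_k => w i].
  by rewrite /A /expansion_trunc; congr (_ * _ + _ * _); apply: eq_bigr => i _; rewrite ffunE.
have -> : charf P (Xk k) (Yk k) s t = \sum_(f : {ffun 'I_k -> D}) (\prod_i p (f i))%:C%C * cis
    (A f).
  rewrite /charf; apply/eqP; rewrite eq_complex Re_sum Im_sum /=; apply/andP; split; apply/eqP.
    transitivity (mean P (fun w : W => cos1 (A [ffun i : 'I_k => w i]))).
      by congr mean; apply/funext => w; rewrite AE.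
    rewrite (mean_prefix Pp (fun f => cos1 (A f))).2.
    by apply: eq_bigr => f _; rewrite /= mul0r subr0 mulrC.
    transitivity (mean P (fun w : W => sin1 (A [ffun i : 'I_k => w i]))).
      by congr mean; apply/funext => w; rewrite AE.
    rewrite (mean_prefix Pp (fun f => sin1 (A f))).2.
  by apply: eq_bigr => f _; rewrite /= mul0r addr0 mulrC.
under [RHS]eq_bigr do rewrite digit_phiE.
rewrite bigA_distr_bigA/=; apply: eq_bigr => f _.
rewrite big_split/= -rmorph_prod; congr (_ * _).
rewrite -(big_morph (@cis R) (@cisD R) (@cis0 R)); congr cis.
rewrite /A !mulr_sumr -big_split/=; apply: eq_bigr => i _.
by congr (_ + _); ring.
Qed.

Lemma charf_trunc_dist k s t :
  nsq (charf P X Y s t - charf P (Xk k) (Yk k) s t) <=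
    2 * (pi *+ 2 * (`|s| + `|t|)) ^+ 2 * (2%:R ^+ k)^-1.
Proof.
have mXk : measurable_fun setT (Xk k) by exact: measurable_expansion_trunc.
have mYk : measurable_fun setT (Yk k) by exact: measurable_expansion_trunc.
have pp : 0 <= pi *+ 2 :> R by rewrite mulrn_wge0 ?pi_ge0.
set e : R := (2%:R ^+ k)^-1.
have e0 : 0 <= e by rewrite invr_ge0 exprn_ge0.
have e1 : e <= 1 by rewrite invf_le1 ?exprn_gt0// exprn_ege1// ler1n.
have ang (w : W) : `|(s * X w + t * Y w) - (s * Xk k w + t * Yk k w)| <= (`|s| + `|t|) * e.
  rewrite opprD addrACA -!mulrBr; apply: le_trans (ler_normD _ _) _.
  rewrite !normrM mulrDl lerD// ler_wpM2l//.
    by apply: (expansion_dist m1).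
  by apply: (expansion_dist n1).
set q := pi *+ 2 * (`|s| + `|t|).
have q0 : 0 <= q by rewrite mulr_ge0// addr_ge0.
apply: (@le_trans _ _ (2 * (q * e) ^+ 2)); last first.
  have ee : e ^+ 2 <= e by rewrite expr2 ler_piMr.
  by rewrite exprMn mulrA ler_wpM2l// mulr_ge0// sqr_ge0.
have angq (w : W) : pi *+ 2 * `|(s * X w + t * Y w) - (s * Xk k w + t * Yk k w)| <= q * e.
  by rewrite /q -mulrA ler_wpM2l.
rewrite mulr_natl mulr2n lerD//= -[X in X <= _]ger0_norm ?sqr_ge0// normrX lerXn2r ?nnegrE
    ?mulr_ge0//.
- have b1 := bounded_mfun_cos1 (measurable_ang mX mY s t).
  have b2 := bounded_mfun_cos1 (measurable_ang mXk mYk s t).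
  rewrite -meanN// -meanD//; last exact: bounded_mfunN.
  apply: mean_norm_le; first by apply: bounded_mfunD => //; exact: bounded_mfunN.
  by move=> w; apply: le_trans (cos1_lip _ _) _.
- have b1 := bounded_mfun_sin1 (measurable_ang mX mY s t).
  have b2 := bounded_mfun_sin1 (measurable_ang mXk mYk s t).
  rewrite -meanN// -meanD//; last exact: bounded_mfunN.
  apply: mean_norm_le; first by apply: bounded_mfunD => //; exact: bounded_mfunN.
  by move=> w; apply: le_trans (sin1_lip _ _) _.
Qed.

(** At a finite level the first digit splits off exactly; the error of truncation at level [k] is
    [O(2^-k)], so the two sides cannot differ. *)
Lemma charf_scaling s t :
  charf P X Y s t = digit_phi (s / m%:R) (t / n%:R) * charf P X Y (s / m%:R) (t / n%:R).
Proof.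
apply/eqP; rewrite -subr_eq0; apply/negPn/negP => /nsq_gt0.
set z := _ - _; set s' := s / m%:R; set t' := t / n%:R => z0.
have tr k : charf P (Xk k.+1) (Yk k.+1) s t = digit_phi s' t' * charf P (Xk k) (Yk k) s' t'.
  rewrite !charf_trunc big_ord_recl/= !expr1; congr (_ * _); apply: eq_bigr => i _.
  by rewrite /bump/= add1n /s' /t' -!mulrA -!invfM -!exprS.
pose K : R := 2 * (2 * (pi *+ 2 * (`|s| + `|t|)) ^+ 2) + 2 * (nsq (digit_phi s' t') * (2 * (pi
    *+ 2 * (`|s'| + `|t'|)) ^+ 2)).
have zK k : nsq z <= K * (2%:R ^+ k)^-1.
  have -> : z = (charf P X Y s t - charf P (Xk k.+1) (Yk k.+1) s t) +
     - (digit_phi s' t' * (charf P X Y s' t' - charf P (Xk k) (Yk k) s' t')).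
    by rewrite tr /z; ring.
  apply: le_trans (nsqD_le _ _) _; rewrite /K [in X in _ <= X]mulrDl lerD//.
    rewrite -mulrA ler_wpM2l//; apply: le_trans (charf_trunc_dist _ _ _) _.
    apply: ler_wpM2l; first by rewrite mulr_ge0// sqr_ge0.
    rewrite lef_pV2 ?posrE ?exprn_gt0//.
    by rewrite ler_weXn2l// ler1n.
  rewrite nsqN nsqM -[in X in _ <= X]mulrA ler_wpM2l// -[in X in _ <= X]mulrA.
  by rewrite ler_wpM2l ?nsq_ge0//; exact: charf_trunc_dist.
have [k hk] : exists k : nat, K / nsq z < k%:R.
  by exists (Num.truncn (K / nsq z)).+1; exact: Num.Theory.truncnS_gt.
have := zK k; rewrite leNgt => /negP; apply.
rewrite ltr_pdivrMr ?exprn_gt0//; move: hk; rewrite ltr_pdivrMr// => hk.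
apply: lt_le_trans hk _; rewrite mulrC ler_wpM2l ?nsq_ge0// -natrX ler_nat ltnW// ltn_expl//.
Qed.

Lemma nsq_charf_scaling : scaling_relation p u v m n (fun s t => nsq (charf P X Y s t)).
Proof. by move=> s t; rewrite {1}charf_scaling nsqM. Qed.

End bernoulli_characteristic_functions.

(** * Invariance and mixing on the Fourier side *)

Section integer_frequencies.
Context {R : realType} (D : finType) (a : D) (p : D -> R).
Context (P : probability (measurable_shift a) R) (u v : D -> nat) (m n : nat).
Hypotheses (p_prob : probability_vector p) (Pp : is_bernoulli p P).
Hypotheses (m1 : (1 < m)%N) (n1 : (1 < n)%N).
Hypotheses (um : forall c, (u c < m)%N) (vn : forall c, (v c < n)%N).
Local Notation W := (measurable_shift a).
Local Notation X := (@coord_expansion R D a m u).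
Local Notation Y := (@coord_expansion R D a n v).
Local Notation cf := (charf P X Y).

Let m0 : m%:R != 0 :> R. Proof. by rewrite pnatr_eq0; case: m m1. Qed.
Let n0 : n%:R != 0 :> R. Proof. by rewrite pnatr_eq0; case: n n1. Qed.

Lemma coord_expansion01 (q : nat) (f : D -> nat) (w : W) : (1 < q)%N -> (forall c, (f c < q)%N) ->
  0 <= (coord_expansion q f w : R) <= 1.
Proof. by move=> q1 fq; apply: expansion01. Qed.

Let mX : measurable_fun setT X. Proof. exact: measurable_coord_expansion. Qed.
Let mY : measurable_fun setT Y. Proof. exact: measurable_coord_expansion. Qed.
Let X01 w : 0 <= X w <= 1. Proof. exact: coord_expansion01. Qed.
Let Y01 w : 0 <= Y w <= 1. Proof. exact: coord_expansion01. Qed.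

Lemma digit_phi_periodic s t (h1 h2 : int) :
  digit_phi p u v (h1%:~R + s) (h2%:~R + t) = digit_phi p u v s t.
Proof.
rewrite !digit_phiE; apply: eq_bigr => c _; congr (_ * _).
have -> : (u c)%:R * (h1%:~R + s) + (v c)%:R * (h2%:~R + t) =
  ((u c)%:Z * h1 + (v c)%:Z * h2)%:~R + ((u c)%:R * s + (v c)%:R * t).
  by rewrite intrD !intrM; ring.
by rewrite cisD {1}/cis cos1_int sin1_int mul1r.
Qed.

Lemma digit_phi00 : digit_phi p u v 0 0 = 1.
Proof.
rewrite digit_phiE; under eq_bigr do rewrite !mulr0 addr0 cis0 mulr1.
by rewrite -rmorph_sum (_ : \sum_c p c = 1)//; case: p_prob.
Qed.

(** Invariance under the diagonal map with entries [m] and [n]: the digit polynomial equals 1 at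
    integer points. *)
Lemma charf_invariant (h1 h2 : int) k :
  cf (h1%:~R * m%:R ^+ k) (h2%:~R * n%:R ^+ k) = cf h1%:~R h2%:~R.
Proof.
elim: k => [|k IH]; first by rewrite !expr0 !mulr1.
rewrite (charf_scaling Pp m1 n1 um vn) !exprSr !mulrA !mulfK// IH.
have -> : h1%:~R * m%:R ^+ k = (h1 * m%:Z ^+ k)%:~R + 0 :> R.
  by rewrite intrM rmorphXn addr0.
have -> : h2%:~R * n%:R ^+ k = (h2 * n%:Z ^+ k)%:~R + 0 :> R.
  by rewrite intrM rmorphXn addr0.
by rewrite digit_phi_periodic digit_phi00 mul1r.
Qed.

(* Both sides contain the product of the digit polynomials at the first k
   scales, which may vanish; this is why the identity is not a quotient. *)
Lemma charf_decorrelation (h1 h2 : int) (s t : R) k :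
  cf (h1%:~R * m%:R ^+ k + s) (h2%:~R * n%:R ^+ k + t) * cf (s / m%:R ^+ k) (t / n%:R ^+ k) =
  cf s t * cf (h1%:~R + s / m%:R ^+ k) (h2%:~R + t / n%:R ^+ k).
Proof.
elim: k s t => [|k IH] s t; first by rewrite !expr0 !divr1 !mulr1 mulrC.
rewrite (charf_scaling Pp m1 n1 um vn (_ + _)) [cf s t](charf_scaling Pp m1 n1 um vn).
rewrite !mulrDl !exprSr !mulrA !mulfK//.
have -> : h1%:~R * m%:R ^+ k = (h1 * m%:Z ^+ k)%:~R :> R by rewrite intrM rmorphXn.
have -> : h2%:~R * n%:R ^+ k = (h2 * n%:Z ^+ k)%:~R :> R by rewrite intrM rmorphXn.
rewrite digit_phi_periodic -!mulrA; congr (_ * _).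
rewrite !invfM.
have -> : (h1 * m%:Z ^+ k)%:~R = h1%:~R * m%:R ^+ k :> R by rewrite intrM rmorphXn.
have -> : (h2 * n%:Z ^+ k)%:~R = h2%:~R * n%:R ^+ k :> R by rewrite intrM rmorphXn.
have := IH (s / m%:R) (t / n%:R); rewrite -!mulrA.
by rewrite ![_^-1 * (_ ^+ k)^-1]mulrC.
Qed.

(** Take [s = -h1] and [t = -h2] in [charf_decorrelation]. As [k] grows, the second factor on the
    left tends to [cf 0 0 = 1] and the right side to [c] times its conjugate, with [c = cf h1 h2],
    by the Lipschitz bound. *)
Lemma charf_mixing (h1 h2 : int) (e : R) : 0 < e -> exists J, forall k, (J <= k)%N ->
  complex.Re (cf (h1%:~R * m%:R ^+ k - h1%:~R) (h2%:~R * n%:R ^+ k - h2%:~R)) <= nsq (cf h1%:~R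
      h2%:~R) + e.
Proof.
move=> e0; set c := cf h1%:~R h2%:~R.
pose q : R := pi *+ 2 * (`|h1%:~R| + `|h2%:~R|).
have pp : 0 <= pi *+ 2 :> R by rewrite mulrn_wge0 ?pi_ge0.
have q0 : 0 <= q by apply: mulr_ge0 => //; apply: addr_ge0.
have [J hJ] : exists J : nat, 4 * q / e < J%:R.
  by exists (Num.truncn (4 * q / e)).+1; exact: Num.Theory.truncnS_gt.
exists J => k Jk; set Q := cf (_ - _) (_ - _).
pose f : R := (2%:R ^+ k)^-1.
have f0 : 0 <= f by rewrite invr_ge0 exprn_ge0.
have qf : 4 * (q * f) <= e.
  rewrite mulrA -[f]mul1r mulrA ler_pdivrMr ?exprn_gt0// mulr1.
  move: hJ; rewrite ltr_pdivrMr// => /ltW hJ; apply: le_trans hJ _.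
  rewrite mulrC ler_wpM2l ?(ltW e0)//; apply: (@le_trans _ _ k%:R); first by rewrite ler_nat.
  by rewrite -natrX ler_nat ltnW// ltn_expl.
have fm (l : nat) (h : int) : (1 < l)%N -> `|h%:~R / l%:R ^+ k| <= `|h%:~R| * f :> R.
  move=> l1; rewrite normrM ler_wpM2l// ger0_norm ?invr_ge0 ?exprn_ge0//.
  by rewrite lef_pV2 ?posrE ?exprn_gt0 ?ltr0n 1?ltnW// lerXn2r ?nnegrE// ler_nat.
have lip s t s' t' : `|s - s'| <= `|h1%:~R| * f -> `|t - t'| <= `|h2%:~R| * f ->
    nsq (cf s t - cf s' t') <= 2 * (q * f) ^+ 2.
  move=> h h'; apply: le_trans (charf_lip _ mX mY X01 Y01 _ _ _ _) _.
  have g0 : 0 <= pi *+ 2 * (`|s - s'| + `|t - t'|).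
    by apply: mulr_ge0 => //; apply: addr_ge0.
  have g1 : pi *+ 2 * (`|s - s'| + `|t - t'|) <= q * f.
    by rewrite /q -mulrA ler_wpM2l// mulrDl lerD.
  by rewrite ler_wpM2l// !expr2 ler_pM.
pose d1 := cf (- h1%:~R / m%:R ^+ k) (- h2%:~R / n%:R ^+ k) - 1.
pose d2 := cf (h1%:~R + - h1%:~R / m%:R ^+ k) (h2%:~R + - h2%:~R / n%:R ^+ k) - c.
have nd1 : nsq d1 <= 2 * (q * f) ^+ 2.
  rewrite /d1 -[X in _ - X](charf00 P X Y); apply: lip; rewrite subr0 mulNr normrN; exact: fm.
have nd2 : nsq d2 <= 2 * (q * f) ^+ 2.
  by apply: lip; rewrite addrC addKr mulNr normrN; exact: fm.
have QE : Q - c * c^*%C = c^*%C * d2 + - (Q * d1).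
  have := charf_decorrelation h1 h2 (- h1%:~R) (- h2%:~R) k; rewrite charfN// -/c -/Q => E.
  by rewrite /d1 /d2 mulrBr mulrBr -E; ring.
have /andP[_ nc] := nsq_charf_le2 P mX mY h1%:~R h2%:~R.
have /andP[_ nQ] := nsq_charf_le2 P mX mY (h1%:~R * m%:R ^+ k - h1%:~R) (h2%:~R * n%:R ^+ k -
    h2%:~R).
have nconj (z : R[i]) : nsq z^*%C = nsq z by case: z => x y; rewrite /nsq/= sqrrN.
(* Each of the two products is at most [2 * (2 (q f)^2)], and [nsqD_le] doubles both: 16 in all. *)
have bound : nsq (Q - c * c^*%C) <= (4 * (q * f)) ^+ 2.
  rewrite QE; apply: le_trans (nsqD_le _ _) _; rewrite nsqN !nsqM nconj.
  have h1' : nsq c * nsq d2 <= 2 * (2 * (q * f) ^+ 2) by rewrite ler_pM ?nsq_ge0.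
  have h2' : nsq Q * nsq d1 <= 2 * (2 * (q * f) ^+ 2) by rewrite ler_pM ?nsq_ge0.
  by rewrite exprMn; lra.
have : complex.Re (Q - c * c^*%C) <= e.
  have : complex.Re (Q - c * c^*%C) ^+ 2 <= e ^+ 2.
    apply: (@le_trans _ _ (nsq (Q - c * c^*%C))); first by rewrite lerDl sqr_ge0.
    apply: le_trans bound _; rewrite lerXn2r ?nnegrE ?(ltW e0)//.
    by rewrite !mulr_ge0.
  by rewrite -ler_sqrt ?sqr_ge0// !sqrtr_sqr (gtr0_norm e0); exact: le_trans (ler_norm _).
rewrite nsqE -/c; case: (Q) (c * c^*%C) => [x y] [x' y'] /=; lra.
Qed.

End integer_frequencies.

(** * Mutual singularity from Fourier decay *)

Section singularity_criterion.

Lemma measure_lim_sup_half {R : realType} {d : measure_display} {T : measurableType d} (mu :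
    {measure set T -> \bar R}) (F : nat -> set T) :
  (forall k, measurable (F k)) -> (forall k, mu (F k) <= ((2^-1) ^+ k.+1)%:E)%E ->
  mu (lim_sup_set F) = 0%E.
Proof.
move=> mF Fk; apply: lim_sup_set_cvg0 => //.
apply: (@le_lt_trans _ _ 1%E); last exact: ltry.
apply: (@le_trans _ _ (\sum_(0 <= k <oo) ((2^-1) ^+ k.+1)%:E)%E).
  by apply: lee_nneseries => k _ //; exact: Fk.
apply: lime_le; first by apply: is_cvg_nneseries => k _ _; rewrite lee_fin exprn_ge0.
by apply: nearW => J; rewrite sumEFin lee_fin big_mkord sum_half_le1.
Qed.

Context {R : realType} {d d' : measure_display} {T : measurableType d} {T' : measurableType d'}.

(** Borel-Cantelli on both sides: the upper limit of sets [A k] with summable bounds is null for the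
    first measure, and its complement lies in the upper limit of the complements, which is null for
    [nu]. *)
Lemma mutually_singular_of_small (mu : {measure set T -> \bar R}) (nu : {measure set T' -> \bar R})
    (f : T -> T') : measurable_fun setT f ->
  (forall e : R, 0 < e -> exists A : set T',
     [/\ measurable A, (mu (f @^-1` A) <= e%:E)%E & (nu (~` A) <= e%:E)%E]) ->
  mutually_singular (pushforward mu f) nu.
Proof.
move=> mf small.
have /choice[A hA] : forall k : nat, exists A : set T',
    [/\ measurable A, (mu (f @^-1` A) <= ((2^-1) ^+ k.+1)%:E)%E & (nu (~` A) <= ((2^-1) ^+
        k.+1)%:E)%E].
  by move=> k; apply: small; rewrite exprn_gt0.
have mA k : measurable (A k) by case: (hA k).
exists (lim_sup_set A); split.
- by apply: bigcapT_measurable => n; apply: bigcup_measurable => k _.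
- rewrite /pushforward (_ : _ @^-1` _ = lim_sup_set (fun k => f @^-1` A k)).
    apply: measure_lim_sup_half => k; last by case: (hA k).
    by rewrite -[X in measurable X]setTI; exact: mf.
  apply/seteqP; split=> x h n _; have [k nk Ak] := h n I; by exists k.
- apply/eqP; rewrite eq_le measure_ge0 andbT.
  rewrite -(@measure_lim_sup_half _ _ _ nu (fun k => ~` A k)) => [|k|k]; last 2 first.
  + exact: measurableC.
  + by case: (hA k).
  apply: le_measure; rewrite ?inE.
  + by apply: measurableC; apply: bigcapT_measurable => n; apply: bigcup_measurable => k _.
  + by apply: bigcapT_measurable => n; apply: bigcup_measurable => k _; exact: measurableC.
  move=> x nx n _; have [j hj] : exists j, forall k, (j <= k)%N -> ~ A k x.
    apply: contrapT => hn; apply: nx => j _; apply: contrapT => hj.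
    by apply: hn; exists j => k jk Akx; apply: hj; exists k.
  exists (maxn n j) => /=; first exact: leq_maxl.
  by apply: hj; exact: leq_maxr.
Qed.

End singularity_criterion.

(** * Quadratic means of sparse averages of characters *)

Section lacunary_averages.
Context {R : realType} (D : finType) (a : D) (p : D -> R).
Context (P : probability (measurable_shift a) R) (u v : D -> nat) (m n : nat).
Hypotheses (p_prob : probability_vector p) (Pp : is_bernoulli p P).
Hypotheses (m1 : (1 < m)%N) (n1 : (1 < n)%N).
Hypotheses (um : forall c, (u c < m)%N) (vn : forall c, (v c < n)%N).
Local Notation W := (measurable_shift a).
Local Notation X := (@coord_expansion R D a m u).
Local Notation Y := (@coord_expansion R D a n v).
Local Notation cf := (charf P X Y).

Let mX : measurable_fun setT X. Proof. exact: measurable_coord_expansion. Qed.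
Let mY : measurable_fun setT Y. Proof. exact: measurable_coord_expansion. Qed.

(** Invariance removes the common power, which leaves [charf_mixing] for the difference of the
    exponents; the opposite order is a complex conjugate, with the same real part. *)
Lemma charf_separated (h1 h2 : int) (e : R) : 0 < e -> exists2 J, (0 < J)%N & forall q q' : nat,
  (J <= q - q')%N || (J <= q' - q)%N ->
  complex.Re (cf (h1%:~R * m%:R ^+ q - h1%:~R * m%:R ^+ q') (h2%:~R * n%:R ^+ q - h2%:~R * n%:R
      ^+ q'))
   <= nsq (cf h1%:~R h2%:~R) + e.
Proof.
move=> e0; have [J hJ] := charf_mixing Pp m1 n1 um vn h1 h2 e0.
exists J.+1 => // q q'.
have key q1 q2 : (J.+1 <= q1 - q2)%N ->
   complex.Re (cf (h1%:~R * m%:R ^+ q1 - h1%:~R * m%:R ^+ q2) (h2%:~R * n%:R ^+ q1 - h2%:~R *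
       n%:R ^+ q2))
   <= nsq (cf h1%:~R h2%:~R) + e.
  move=> Jq; have -> : q1 = ((q1 - q2) + q2)%N by lia.
  move: (q1 - q2)%N Jq => l Jl; rewrite !exprD.
  have fE (h : int) (x : nat) : h%:~R * (x%:R ^+ l * x%:R ^+ q2) - h%:~R * x%:R ^+ q2 =
     (h * x%:Z ^+ l - h)%:~R * x%:R ^+ q2 :> R.
    by rewrite intrB intrM rmorphXn/=; ring.
  rewrite !fE (charf_invariant p_prob Pp)// !intrB !intrM !rmorphXn/=; apply: hJ; exact: ltnW.
move=> /orP[/key//|/key].
rewrite -[X in complex.Re (cf X _) <= _ -> _]opprB -[X in complex.Re (cf _ X) <= _ -> _]opprB
    charfN//.
Qed.

(** A variance bound for nearly uncorrelated terms; [1 / K] is the diagonal. That [J] depends on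
    neither [K] nor [r] is essential, since [r] is later dictated by the other measure. *)
Lemma lacunary_mean_deviation (h1 h2 : int) (e : R) : 0 < e -> exists2 J, (0 < J)%N & forall K r
    : nat,
  (0 < K)%N -> let dev w := nsq (\sum_(k < K) (K%:R^-1)%:C%C *
      cis (h1%:~R * m%:R ^+ (r + k * J) * X w + h2%:~R * n%:R ^+ (r + k * J) * Y w)
      - cf h1%:~R h2%:~R) in
  bounded_mfun dev /\ mean P dev <= K%:R^-1 + e.
Proof.
move=> e0; have [J J0 hJ] := charf_separated h1 h2 e0.
exists J => // K r K0; move: hJ; have [c cE] : exists c, c = cf h1%:~R h2%:~R by eexists.
rewrite -cE /= => hJ.
(* The constant [- c] is treated as the coefficient of the zero frequency, at index 0. *)
pose al (i : nat) : R[i] := if i is _.+1 then (K%:R^-1)%:C%C else - c.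
pose fr (h : int) (x : nat) (i : nat) : R := if i is k.+1 then h%:~R * x%:R ^+ (r + k * J) else 0.
have devE w : nsq (\sum_(k < K) (K%:R^-1)%:C%C *
      cis (h1%:~R * m%:R ^+ (r + k * J) * X w + h2%:~R * n%:R ^+ (r + k * J) * Y w) - c) =
   nsq (\sum_(i < K.+1) al i * cis (fr h1 m i * X w + fr h2 n i * Y w)).
  rewrite big_ord_recl !mul0r addr0 cis0 mulr1 addrC; congr (nsq (_ + _)).
have [bd mE] := mean_trig_polynomial P mX mY (fun i : 'I_K.+1 => al i) (fun i : 'I_K.+1 => fr h1
    m i)
  (fun i : 'I_K.+1 => fr h2 n i).
under eq_fun do rewrite devE; split=> //; rewrite mE.
have Kn0 : K%:R != 0 :> R by rewrite pnatr_eq0 -lt0n.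
have KV0 : 0 <= K%:R^-1 :> R by [].
have sumK (x : R) : (K%:R^-1 * x) *+ K = x.
  by rewrite -[LHS]mulr_natl mulrA divff// mul1r.
have nc0 := nsq_ge0 c.
have ReZ (x : R) z : complex.Re (x%:C%C * z) = x * complex.Re z.
  by case: z => y y' /=; rewrite mul0r subr0.
have alE (i : 'I_K) : al (lift ord0 i) = (K%:R^-1)%:C%C by rewrite lift0.
have frE (h : int) (x : nat) (i : 'I_K) : fr h x (lift ord0 i) = h%:~R * x%:R ^+ (r + i * J) by
    rewrite lift0.
have fr0 (h : int) (x : nat) : fr h x (@ord0 K) = 0 by [].
have al0 : al (@ord0 K) = - c by [].
rewrite big_ord_recl [X in X + _]big_ord_recl !fr0 al0 !subrr charf00 mulr1.
under [X in _ + X + _]eq_bigr do rewrite alE !frE.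
have -> : complex.Re (- c * (- c)^*%C) = nsq c by rewrite -nsqE nsqN.
have -> : \sum_(j < K) complex.Re (- c * ((K%:R^-1)%:C%C)^*%C *
    cf (0 - h1%:~R * m%:R ^+ (r + j * J)) (0 - h2%:~R * n%:R ^+ (r + j * J))) = - nsq c.
  under eq_bigr => j _.
    rewrite !sub0r charfN// (charf_invariant p_prob Pp)// -cE conjc_real mulrAC mulrC ReZ mulNr.
    have -> : complex.Re (- (c * c^*%C)) = - nsq c by rewrite nsqE; case: (c * _).
    over.
  by rewrite sumr_const card_ord sumK.
rewrite subrr add0r.
(* The row of the zero frequency has summed to 0. In every other row the term with [- c] cancels the
   [nsq c] that the [K] pairs contribute. *)
have rest (i : 'I_K) : \sum_(j < K.+1) complex.Re (al (lift ord0 i) * (al j)^*%C *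
    cf (fr h1 m (lift ord0 i) - fr h1 m j) (fr h2 n (lift ord0 i) - fr h2 n j)) <= K%:R^-1 *
        (K%:R^-1 + e).
  rewrite big_ord_recl !fr0 al0 alE !frE !subr0 (charf_invariant p_prob Pp)// -cE.
  under eq_bigr do rewrite alE !frE.
  have -> : complex.Re ((K%:R^-1)%:C%C * (- c)^*%C * c) = - (K%:R^-1 * nsq c).
    rewrite -mulrA ReZ nsqE -mulrN; congr (_ * _); case: (c) => x y /=; ring.
  have ub (j : 'I_K) : complex.Re ((K%:R^-1)%:C%C * ((K%:R^-1)%:C%C)^*%C *
     cf (h1%:~R * m%:R ^+ (r + i * J) - h1%:~R * m%:R ^+ (r + j * J))
        (h2%:~R * n%:R ^+ (r + i * J) - h2%:~R * n%:R ^+ (r + j * J))) <=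
     K%:R^-1 * (K%:R^-1 * (nsq c + e)) + K%:R^-1 * K%:R^-1 * (i == j)%:R.
    rewrite conjc_real -!mulrA !ReZ -mulrDr ler_wpM2l// -mulrDr ler_wpM2l//.
    have [->|ij] := eqVneq i j.
      by rewrite !subrr charf00 /= lerDr addr_ge0// ltW.
    rewrite addr0; apply: hJ.
    rewrite !subnDl -!mulnBl -[J in (J <= _)%N]mul1n -[X in _ || (X <= _)%N]mul1n !leq_pmul2r//.
    by move: ij; rewrite -val_eqE /= neq_ltn => /orP[] h; apply/orP; [right|left]; rewrite subn_gt0.
  apply: le_trans (lerD (lexx _) (ler_sum _ (fun j _ => ub j))) _.
  rewrite big_split/= sumr_const card_ord -mulr_sumr.
  have -> : \sum_(j < K) (i == j)%:R = 1 :> R.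
    by rewrite (bigD1 i)//= eqxx big1 ?addr0// => j /negPf ji; rewrite eq_sym ji.
  by rewrite mulr1 sumK; lra.
apply: le_trans (ler_sum _ (fun i _ => rest i)) _.
by rewrite sumr_const card_ord sumK.
Qed.

End lacunary_averages.

Section decaying_correlations.
Context {R : realType}.

Definition avg_null (f : nat -> R) := forall e : R, 0 < e ->
  exists N0, forall N, (N0 <= N)%N -> \sum_(0 <= r < N) f r <= e * N%:R.

(** Provides a single shift [r] that serves all pairs of indices of a window at once: an average of
    at most [e] forces some term to be at most [e]. *)
Lemma avg_null_small (I : finType) (f : I -> nat -> R) (e : R) :
  (forall i, avg_null (f i)) -> 0 < e -> exists r, \sum_i f i r <= e.
Proof.
move=> fn e0; have : avg_null (fun r => \sum_i f i r).
  elim: (index_enum I) => [|i s IH] e' e'0.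
    by exists 0%N => N _; rewrite big1 ?mulr_ge0 ?(ltW e'0)// => r _; rewrite big_nil.
  have e2 : 0 < e' / 2 by rewrite divr_gt0.
  have [N1 h1] := fn i _ e2; have [N2 h2] := IH _ e2.
  exists (maxn N1 N2) => N; rewrite geq_max => /andP[/h1 h /h2 h'].
  under eq_bigr do rewrite big_cons; rewrite big_split/=; lra.
move=> /(_ _ e0)[N0 /(_ N0.+1 (leqnSn _)) h]; apply: contrapT => hn.
have : e * N0.+1%:R < \sum_(0 <= r < N0.+1) \sum_i f i r.
  rewrite mulr_natr -[X in e *+ X]subn0 -sumr_const_nat big_nat_recr//= [X in _ < X]big_nat_recr//=.
  apply: ler_ltD; last by rewrite ltNge; apply/negP => ?; apply: hn; exists N0.
  by apply: ler_sum => r _; rewrite leNgt; apply/negP => /ltW ?; apply: hn; exists r.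
by rewrite ltNge h.
Qed.

Context {d : measure_display} {T : measurableType d} (P : probability T R).
Context (X Y : T -> R).
Hypotheses (mX : measurable_fun setT X) (mY : measurable_fun setT Y).

(** The diagonal contributes [1 / K]; the other correlations are small for a well chosen [r]. The
    phases [ph] have modulus 1 and leave room for the translation part of an affine map. *)
Lemma small_shifted_averages (xi et ph : nat -> R) :
  (forall k l, k != l -> avg_null (fun r => nsq (charf P X Y (xi (r + k)%N - xi (r + l)%N) (et
      (r + k)%N - et (r + l)%N)))) ->
  forall (e : R) (J K : nat), 0 < e -> (0 < J)%N -> (0 < K)%N -> exists r,
  let V w := nsq (\sum_(k < K) (K%:R^-1)%:C%C * cis (ph (r + k * J)%N) *
    cis (xi (r + k * J)%N * X w + et (r + k * J)%N * Y w)) in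
  bounded_mfun V /\ mean P V <= K%:R^-1 + e.
Proof.
move=> dec e J K e0 J0 K0.
(* The correlations are made to sum to at most [de * de], so that [Re_le_nsq] at level [de] costs
   [de] twice. *)
pose de := e / 2; have de0 : 0 < de by rewrite divr_gt0.
pose M (ij : 'I_K * 'I_K) r := if ij.1 == ij.2 then 0 else
  nsq (charf P X Y (xi (r + ij.1 * J)%N - xi (r + ij.2 * J)%N) (et (r + ij.1 * J)%N - et (r +
      ij.2 * J)%N)).
have [|r hr] := @avg_null_small _ M (de * de) _ (mulr_gt0 de0 de0).
  move=> [i j] /=; rewrite /M /=; have [_|ij] := eqVneq i j.
    by move=> e' e'0; exists 0%N => N _; rewrite big1// mulr_ge0 ?(ltW e'0).
  apply: dec; rewrite eqn_pmul2r//.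
exists r => /=; have [bd mE] := mean_trig_polynomial P mX mY
  (fun k : 'I_K => (K%:R^-1)%:C%C * cis (ph (r + k * J)%N))
  (fun k : 'I_K => xi (r + k * J)%N) (fun k : 'I_K => et (r + k * J)%N).
split=> //; rewrite mE.
have Kn0 : K%:R != 0 :> R by rewrite pnatr_eq0 -lt0n.
have KV0 : 0 <= K%:R^-1 :> R by [].
have KV1 : K%:R^-1 <= 1 :> R by rewrite invf_le1 ?ltr0n// ler1n.
have ReZ (x : R) z : complex.Re (x%:C%C * z) = x * complex.Re z.
  by case: z => y y' /=; rewrite mul0r subr0.
have ub (i j : 'I_K) : complex.Re ((K%:R^-1)%:C%C * cis (ph (r + i * J)%N) *
     ((K%:R^-1)%:C%C * cis (ph (r + j * J)%N))^*%C *
     charf P X Y (xi (r + i * J)%N - xi (r + j * J)%N) (et (r + i * J)%N - et (r + j * J)%N)) <=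
   K%:R^-1 * (K%:R^-1 * (de + M (i, j) r / de + (i == j)%:R)).
  rewrite conjcM conjc_real -cis_conj.
  rewrite [X in complex.Re X](_ : _ = (K%:R^-1)%:C%C * ((K%:R^-1)%:C%C *
     (cis (ph (r + i * J)%N - ph (r + j * J)%N) * charf P X Y (xi (r + i * J)%N - xi (r + j *
         J)%N) (et (r + i * J)%N - et (r + j * J)%N)))); last first.
    by rewrite cisD; ring.
  have -> : M (i, j) r = if i == j then 0 else
    nsq (charf P X Y (xi (r + i * J)%N - xi (r + j * J)%N) (et (r + i * J)%N - et (r + j *
        J)%N)) by [].
  rewrite !ReZ ler_wpM2l// ler_wpM2l//.
  have [->|ij] := eqVneq i j.
    by rewrite !subrr cis0 charf00 mul1r /= mul0r addr0 lerDr ltW.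
  rewrite addr0; apply: le_trans (Re_le_nsq _ de0) _.
  by rewrite nsqM nsq_cis mul1r.
apply: (@le_trans _ _ (\sum_(i < K) \sum_(j < K) K%:R^-1 * (K%:R^-1 * (de + M (i, j) r / de + (i
    == j)%:R)))).
  by apply: ler_sum => i _; apply: ler_sum => j _; exact: ub.
under eq_bigr => i _.
  rewrite -mulr_sumr -mulr_sumr !big_split/= sumr_const card_ord.
  have -> : \sum_(j < K) (i == j)%:R = 1 :> R.
    by rewrite (bigD1 i)//= eqxx big1 ?addr0// => j /negPf ji; rewrite eq_sym ji.
  over.
rewrite -!mulr_sumr !big_split/= !sumr_const card_ord pair_big/= -mulr_suml.
have -> : \sum_(q : 'I_K * 'I_K) M (q.1, q.2) r = \sum_q M q r by apply: eq_bigr => -[].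
set S := \sum_q M q r in hr *.
have S0 : 0 <= S by apply: sumr_ge0 => q _; rewrite /M; case: ifP => // _; exact: nsq_ge0.
have Sde : S / de <= de by rewrite ler_pdivrMr.
have KK : K%:R^-1 * (K%:R^-1 * (S / de)) <= de.
  have inner : K%:R^-1 * (S / de) <= S / de by rewrite ler_piMl// divr_ge0// ltW.
  by apply: le_trans (le_trans inner Sde); exact: le_trans (ler_wpM2l KV0 inner) _.
rewrite -[de *+ K *+ K]mulr_natr -[de *+ K]mulr_natr.
have -> : K%:R^-1 * (K%:R^-1 * (de * K%:R * K%:R + S / de + K%:R)) =
   de + K%:R^-1 + K%:R^-1 * (K%:R^-1 * (S / de)).
  by rewrite !mulrDr; field; rewrite Kn0 gt_eqF.
have ee : e = de + de by rewrite /de; field.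
lra.
Qed.

End decaying_correlations.

Section singularity_from_decay.
Context {R : realType}.

Lemma measurable_affine_map (L : 'M[R]_2) (b : R * R) : measurable_fun setT (affine_map L b).
Proof.
apply/measurable_fun_pairP; split.
  apply: measurable_funD; last exact: measurable_cst.
  exact: (measurable_ang measurable_fst measurable_snd).
apply: measurable_funD; last exact: measurable_cst.
exact: (measurable_ang measurable_fst measurable_snd).
Qed.

Context (mu nu : probability (R * R)%type R).
Context {d : measure_display} {T : measurableType d} (P1 : probability T R) (X1 Y1 : T -> R).
Hypotheses (mX1 : measurable_fun setT X1) (mY1 : measurable_fun setT Y1).
Hypothesis muE : forall A, measurable A -> mu A = P1 ((fun w => (X1 w, Y1 w)) @^-1` A).
Context (D : finType) (a : D) (p : D -> R).
Context (P : probability (measurable_shift a) R) (u v : D -> nat) (m n : nat).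
Hypotheses (p_prob : probability_vector p) (Pp : is_bernoulli p P).
Hypotheses (m1 : (1 < m)%N) (n1 : (1 < n)%N).
Hypotheses (um : forall c, (u c < m)%N) (vn : forall c, (v c < n)%N).
Local Notation W := (measurable_shift a).
Local Notation X := (@coord_expansion R D a m u).
Local Notation Y := (@coord_expansion R D a n v).
Hypothesis nuE : forall A, measurable A -> nu A = P ((fun w => (X w, Y w)) @^-1` A).

(* With respect to nu a sparse average of the characters (h1 m^q, h2 n^q) is
   close to its mean, while along the affine image of mu it is close to 0. *)
Lemma singular_of_decay (L : 'M[R]_2) (b : R * R) (h1 h2 : int) :
  charf P X Y h1%:~R h2%:~R != 0 ->
  (let xi q : R := L 0 0 * (h1%:~R * m%:R ^+ q) + L 1 0 * (h2%:~R * n%:R ^+ q) in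
   let et q : R := L 0 1 * (h1%:~R * m%:R ^+ q) + L 1 1 * (h2%:~R * n%:R ^+ q) in
   forall k l, k != l -> avg_null (fun r =>
     nsq (charf P1 X1 Y1 (xi (r + k)%N - xi (r + l)%N) (et (r + k)%N - et (r + l)%N)))) ->
  mutually_singular (pushforward mu (affine_map L b)) nu.
Proof.
move=> c0 dec; set c := charf _ _ _ _ _ in c0.
apply: mutually_singular_of_small; first exact: measurable_affine_map.
(* From [nsq c <= 2 nsq F + 2 nsq (F - c)]: where [nsq F < q], the deviation from [c] exceeds [q].
   Both means below are at most [e * q], so Markov at level [q] gives [e]. *)
move=> e e0; pose q := nsq c / 4; have q0 : 0 < q by rewrite divr_gt0// nsq_gt0.
have e'0 : 0 < e * q / 2 by rewrite divr_gt0// mulr_gt0.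
have [J J0 hJ] := lacunary_mean_deviation p_prob Pp m1 n1 um vn h1 h2 e'0.
pose K := (Num.truncn (e * q / 2)^-1).+1.
have KV : K%:R^-1 <= e * q / 2.
  by rewrite -[X in _ <= X]invrK lef_pV2 ?posrE ?invr_gt0// ltW// Num.Theory.truncnS_gt.
(* The phase that the translation [b] adds to the character of index [k]. *)
pose ph (k : nat) : R := h1%:~R * m%:R ^+ k * b.1 + h2%:~R * n%:R ^+ k * b.2.
have [r] := small_shifted_averages mX1 mY1 ph dec e'0 J0 (ltn0Sn _ : (0 < K)%N).
set V1 := fun w => nsq _ => -[bV1 mV1].
have := hJ K r (ltn0Sn _); rewrite -/c.
set V2 := fun w => nsq _ => -[bV2 mV2].
pose F (z : R * R) : R[i] := \sum_(k < K) (K%:R^-1)%:C%C *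
    cis (h1%:~R * m%:R ^+ (r + k * J) * z.1 + h2%:~R * n%:R ^+ (r + k * J) * z.2).
have mF : measurable_fun setT (fun z => nsq (F z)).
  exact: (mean_trig_polynomial mu measurable_fst measurable_snd
    (fun k : 'I_K => (K%:R^-1)%:C%C) (fun k : 'I_K => h1%:~R * m%:R ^+ (r + k * J))
    (fun k : 'I_K => h2%:~R * n%:R ^+ (r + k * J))).1.1.
pose A := [set z | q <= nsq (F z)].
have mA : measurable A.
  rewrite (_ : A = setT `&` (fun z => nsq (F z)) @^-1` `[q, +oo[%classic).
    by apply: mF => //; exact: measurable_itv.
  by rewrite setTI; apply/seteqP; split=> z /=; rewrite /A /= in_itv/= andbT.
exists A; split=> //.
- have mgA : measurable (affine_map L b @^-1` A).
    by rewrite -[X in measurable X]setTI; exact: measurable_affine_map.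
  suff : (P1 ((fun w => (X1 w, Y1 w)) @^-1` (affine_map L b @^-1` A)) <= e%:E)%E.
    by rewrite -(muE mgA).
  apply: (@le_trans _ _ ((mean P1 V1 / q)%:E)).
    apply: mean_markov => //.
    - by move=> w; exact: nsq_ge0.
    - rewrite -[X in measurable X]setTI.
      have mXY : measurable_fun setT (fun w => (X1 w, Y1 w)) by exact/measurable_fun_pairP.
      exact: mXY.
    move=> w; suff -> : V1 w = nsq (F (affine_map L b (X1 w, Y1 w))) by [].
    rewrite /V1 /F; congr nsq; apply: eq_bigr => k _.
    by rewrite -[LHS]mulrA -cisD; congr (_ * cis _); rewrite /ph /affine_map /=; ring.
  by rewrite lee_fin ler_pdivrMr//; lra.
- suff : (P ((fun w => (X w, Y w)) @^-1` (~` A)) <= e%:E)%E.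
    by rewrite -(nuE (measurableC mA)).
  apply: (@le_trans _ _ ((mean P V2 / q)%:E)).
    apply: mean_markov => //.
    - by move=> w; exact: nsq_ge0.
    - rewrite -[X in measurable X]setTI.
      have mXY : measurable_fun setT (fun w => (X w, Y w)).
        by apply/measurable_fun_pairP; split; exact: measurable_coord_expansion.
      by apply: mXY => //; exact: measurableC.
    move=> w /= /negP; rewrite -ltNge => hF.
    have : nsq c <= 2 * nsq (F (X w, Y w)) + 2 * V2 w.
      have -> : c = F (X w, Y w) + - (F (X w, Y w) - c) by ring.
      by apply: le_trans (nsqD_le _ _) _; rewrite nsqN.
    by rewrite /q in hF *; lra.
  by rewrite lee_fin ler_pdivrMr//; lra.
Qed.

End singularity_from_decay.

(** * Measures with vanishing Fourier coefficients *)

Section dirichlet_kernel.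
Context {R : realType}.

Definition dirichlet (N : nat) (t : R) : R[i] := \sum_(k < N) cis (k%:R * t).

Lemma cis_natM (k : nat) (t : R) : cis (k%:R * t) = cis t ^+ k.
Proof.
elim: k => [|k IH]; first by rewrite mul0r cis0.
by rewrite exprSr -IH -cisD -natr1 mulrDl mul1r.
Qed.

(** A geometric sum: its product with [cis t - 1] has squared modulus at most 4, and
    [nsq (cis t - 1) = 2 - 2 cos1 t >= 2 g]. *)
Lemma nsq_dirichlet_le (N : nat) (t g : R) : 0 < g -> cos1 t <= 1 - g ->
  nsq (dirichlet N t) <= 2 / g.
Proof.
move=> g0 tg; have : nsq ((cis t - 1) * dirichlet N t) <= 4.
  rewrite /dirichlet; under eq_bigr do rewrite cis_natM.
  rewrite -subrX1 -cis_natM; apply: le_trans (nsqD_le _ _) _.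
  by rewrite nsqN nsq_cis /nsq/=; lra.
rewrite nsqM => h; rewrite ler_pdivlMr//.
have : 2 * g <= nsq (cis t - 1).
  rewrite /nsq/=; have := cos1_sin1 t; rewrite oppr0 addr0; lra.
have := nsq_ge0 (dirichlet N t); nra.
Qed.

Lemma nsq_dirichlet_le_sqr (N : nat) (t : R) : nsq (dirichlet N t) <= N%:R ^+ 2.
Proof.
rewrite nsq_sum; apply: (@le_trans _ _ (\sum_(i < N) \sum_(j < N) 1)).
  apply: ler_sum => i _; apply: ler_sum => j _.
  by rewrite -cis_conj -cisD; exact: le_trans (ler_norm _) (cos1_max _).
by rewrite !sumr_const card_ord -[X in X <= _]mulr_natr expr2.
Qed.

End dirichlet_kernel.

Section bernoulli_digits.
Context {R : realType} (D : finType) (a : D) (p : D -> R).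
Context (P : probability (measurable_shift a) R) (u v : D -> nat) (m n : nat).
Hypotheses (p_prob : probability_vector p) (Pp : is_bernoulli p P).
Hypotheses (m1 : (1 < m)%N) (n1 : (1 < n)%N).
Hypotheses (um : forall c, (u c < m)%N) (vn : forall c, (v c < n)%N).
Local Notation W := (measurable_shift a).
Local Notation X := (@coord_expansion R D a m u).
Local Notation Y := (@coord_expansion R D a n v).
Local Notation cf := (charf P X Y).

Let mX : measurable_fun setT X. Proof. exact: measurable_coord_expansion. Qed.
Let mY : measurable_fun setT Y. Proof. exact: measurable_coord_expansion. Qed.

Lemma null_digit (k : nat) : P [set w : W | p (w k) = 0] = 0%E.
Proof.
pose G (f : {ffun 'I_k.+1 -> D}) : R := (p (f ord_max) == 0)%:R.
have mN : measurable [set w : W | p (w k) = 0] by exact: (measurable_coordinate_set k [set c | p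
    c = 0]).
rewrite -mean_indic//; congr (_%:E).
have -> : \1_[set w : W | p (w k) = 0] = (fun w : W => G [ffun i : 'I_k.+1 => w i]) :> (W -> R).
  apply/funext => w; rewrite indicE /G ffunE /=; congr (_%:R); congr nat_of_bool.
  by apply/idP/eqP; rewrite inE.
rewrite (mean_prefix Pp G).2 big1// => f _; rewrite /G.
have [p0|] := eqVneq (p (f ord_max)) 0; last by rewrite mul0r.
by rewrite (bigD1 ord_max)//= p0 mul0r mulr0.
Qed.

(** The reference point is the centre of the [i]-th cell of length [1 / q]. Points of the other
    cells are, even modulo 1, at distance at least [1 / (2 q)] from it. *)
Lemma first_digit_gap (q : nat) (f : D -> nat) (i : nat) : (1 < q)%N -> (forall c, (f c < q)%N)
    -> (i < q)%N ->
  exists2 g : R, 0 < g & forall w : W, f (w 0%N) != i ->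
    cos1 (coord_expansion q f w - (i%:R + 2^-1) / q%:R) <= 1 - g.
Proof.
move=> q1 fq iq; have q0 : 0 < q%:R :> R by rewrite ltr0n ltnW.
have q2 : 2 <= q%:R :> R by rewrite ler_nat.
have [||g g0 hg] := @cos1_gap R (2^-1 / q%:R).
- by rewrite divr_gt0.
- by rewrite ler_pdivrMr//; lra.
exists g => // w fi; apply: hg => k.
have := @expansion_itv R q q1 (fun k => f (w k)) 1 (fun i => fq _).
rewrite /expansion_trunc big_ord1 !expr1 -/(coord_expansion q f w).
set x := coord_expansion q f w; set c := f (w 0%N) in fi * => /andP[h1 h2].
(* Both digits lie in [[0, q)], so equality would force [k = 0] and [c = i]. *)
have z0 : (c%:Z - i%:Z - q%:Z * k != 0)%R.
  have cq : (c < q)%N by exact: fq.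
  apply/negP => /eqP h.
  have k0 : k = 0 by nia.
  by move: fi; rewrite -eqz_nat; move: h; rewrite k0; lia.
rewrite ler_pdivrMr// -[X in _ * X](gtr0_norm q0) -normrM.
have -> : (x - (i%:R + 2^-1) / q%:R - k%:~R) * q%:R =
    (x * q%:R - c%:R - 2^-1) + (c%:Z - i%:Z - q%:Z * k)%:~R.
  by rewrite !intrB intrM -![(Posz _)%:~R]/(_%:R); field; rewrite gt_eqF.
set y := x * q%:R - c%:R.
have y0 : 0 <= y by rewrite subr_ge0 -ler_pdivrMr.
have y1 : y <= 1.
  by rewrite /y lerBlDl -ler_pdivlMr// mulrDl div1r.
have [zp|zn] : (1 <= c%:Z - i%:Z - q%:Z * k) \/ (c%:Z - i%:Z - q%:Z * k <= -1) by lia.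
  have : 1 <= (c%:Z - i%:Z - q%:Z * k)%:~R :> R by rewrite -[1]/(1%:~R) ler_int.
  by move=> ?; apply: le_trans (ler_norm _); lra.
have : (c%:Z - i%:Z - q%:Z * k)%:~R <= -1 :> R by rewrite -[-1]/((-1)%:~R) ler_int.
by move=> ?; rewrite -normrN; apply: le_trans (ler_norm _); lra.
Qed.

(** Parseval: when the coefficients at the differences vanish, only the diagonal remains; the shifts
    [x0], [y0] are mere phases. *)
Lemma mean_orthogonal_characters (I : finType) (xi et : I -> int) (x0 y0 : R) :
  (forall i j, i != j -> cf (xi i - xi j)%:~R (et i - et j)%:~R = 0) ->
  let V w := nsq (\sum_i cis ((xi i)%:~R * (X w - x0) + (et i)%:~R * (Y w - y0))) in
  bounded_mfun V /\ mean P V = #|I|%:R.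
Proof.
move=> orth /=; pose al i : R[i] := cis (- ((xi i)%:~R * x0 + (et i)%:~R * y0)).
have VE w : nsq (\sum_i cis ((xi i)%:~R * (X w - x0) + (et i)%:~R * (Y w - y0))) =
    nsq (\sum_i al i * cis ((xi i)%:~R * X w + (et i)%:~R * Y w)).
  by congr nsq; apply: eq_bigr => i _; rewrite -cisD; congr cis; ring.
have [bV mV] := mean_trig_polynomial P mX mY al (fun i => (xi i)%:~R) (fun i => (et i)%:~R).
under eq_fun do rewrite VE; split=> //; rewrite mV.
transitivity (\sum_(i : I) (1 : R)); last by rewrite sumr_const.
apply: eq_bigr => i _; rewrite (bigD1 i)// big1 ?addr0 => [|j ji].
  rewrite !subrr charf00 mulr1 /al -cis_conj -cisD subrr cis0; exact: addr0.
by rewrite -!intrB orth ?mulr0// eq_sym.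
Qed.

Lemma le_mean_off_null (f : W -> R) (C K : R) (g : W -> R) : bounded_mfun f -> bounded_mfun g ->
  (forall w, 0 < p (w 0%N) -> f w <= g w) -> (forall w, f w <= g w + K) -> mean P f <= mean P g.
Proof.
move=> bf bg fg fK; pose N := [set w : W | p (w 0%N) = 0].
have mN : measurable N by exact: (measurable_coordinate_set 0 [set c | p c = 0]).
have bN : bounded_mfun (\1_N : W -> R) by exact: bounded_mfun_indic.
have mN0 : mean P (\1_N) = 0 by apply: EFin_inj; rewrite mean_indic//; exact: null_digit.
apply: (@le_trans _ _ (mean P (fun w => g w + K * \1_N w))); last first.
  by rewrite meanD ?meanZ ?mN0 ?mulr0 ?addr0//; exact: bounded_mfunZ.
apply: le_mean => // [|w]; first by apply: bounded_mfunD => //; exact: bounded_mfunZ.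
rewrite indicE; have [|/negP wN] := boolP (w \in N); first by rewrite mulr1.
rewrite mulr0 addr0; apply: fg; rewrite lt_neqAle (p_prob.1 _) andbT eq_sym.
by apply/negP => /eqP h; apply: wN; rewrite inE.
Qed.

(** If the digit [i] had no weight, [X] would almost surely avoid a neighbourhood of the centre of
    its cell. The squared Dirichlet kernel centred there would be bounded by [2 / g], while
    orthogonality gives it mean [N]. *)
Lemma all_first_digits : (forall h : int, h != 0 -> cf h%:~R 0 = 0) ->
  forall i, (i < m)%N -> exists2 c, 0 < p c & u c = i.
Proof.
move=> cf0 i im; apply: contrapT => hn.
have [g g0 hg] := first_digit_gap m1 um im.
have [N hN] : exists N : nat, 2 / g < N%:R.
  by exists (Num.truncn (2 / g)).+1; exact: Num.Theory.truncnS_gt.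
have [|bV mV] := @mean_orthogonal_characters 'I_N (fun k => (k : nat)%:Z) (fun=> 0) ((i%:R +
    2^-1) / m%:R) 0.
  move=> k l kl; rewrite subrr; apply: cf0.
  by rewrite subr_eq0; apply: contra kl => /eqP[] /val_inj ->.
move: hN; rewrite ltNge => /negP; apply; rewrite -[N]card_ord -mV.
rewrite -[X in _ <= X](mean_cst P).
have VE w : \sum_(k < N) cis ((k : nat)%:~R * (X w - (i%:R + 2^-1) / m%:R) + 0%:~R * (Y w - 0)) =
   dirichlet N (X w - (i%:R + 2^-1) / m%:R).
  by apply: eq_bigr => k _; rewrite mul0r addr0.
apply: (@le_mean_off_null _ 0 (N%:R ^+ 2)) => //; first exact: bounded_mfun_cst.
  move=> w pw; rewrite VE; apply: nsq_dirichlet_le => //; apply: hg.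
  by apply/negP => /eqP h; apply: hn; exists (w 0%N).
by move=> w; rewrite VE; apply: le_trans (nsq_dirichlet_le_sqr _ _) _; rewrite lerDr divr_ge0// ltW.
Qed.

(** If the pair [(i, j)] had no weight, almost surely at least one of the two kernels would be
    bounded, so their product would be dominated by [2 / g] times one plus [2 / g'] times the other.
    The product has mean [N^2], the bound only a multiple of [N]. *)
Lemma all_digit_pairs :
  (forall h1 h2 : int, (h1, h2) != (0, 0) -> cf h1%:~R h2%:~R = 0) ->
  forall i j, (i < m)%N -> (j < n)%N -> exists2 c, 0 < p c & u c = i /\ v c = j.
Proof.
move=> cf0 i j im jn; apply: contrapT => hn.
have [g g0 hg] := first_digit_gap m1 um im.
have [g' g'0 hg'] := first_digit_gap n1 vn jn.
have [N hN] : exists N : nat, 2 / g + 2 / g' < N%:R.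
  by exists (Num.truncn (2 / g + 2 / g')).+1; exact: Num.Theory.truncnS_gt.
set x0 : R := (i%:R + 2^-1) / m%:R in hg; set y0 : R := (j%:R + 2^-1) / n%:R in hg'.
have N0 : 0 < N%:R :> R.
  by apply: le_lt_trans hN; rewrite addr_ge0// divr_ge0// ltW.
have [|bV mV] := @mean_orthogonal_characters ('I_N * 'I_N)%type (fun k => (k.1 : nat)%:Z) (fun k
    => (k.2 : nat)%:Z) x0 y0.
  move=> [k1 k2] [l1 l2] kl; apply: cf0; apply: contra kl.
  by rewrite !xpair_eqE !subr_eq0 => /andP[/eqP[] /val_inj -> /eqP[] /val_inj ->]; rewrite !eqxx.
have [|bX mVX] := @mean_orthogonal_characters 'I_N (fun k => (k : nat)%:Z) (fun=> 0) x0 0.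
  move=> k l kl; apply: cf0.
  by rewrite xpair_eqE subrr eqxx andbT subr_eq0; apply: contra kl => /eqP[] /val_inj ->.
have [|bY mVY] := @mean_orthogonal_characters 'I_N (fun=> 0) (fun k => (k : nat)%:Z) 0 y0.
  move=> k l kl; apply: cf0.
  by rewrite xpair_eqE subrr eqxx subr_eq0; apply: contra kl => /eqP[] /val_inj ->.
have VX w : \sum_(k < N) cis ((k : nat)%:~R * (X w - x0) + 0%:~R * (Y w - 0)) = dirichlet N (X w
    - x0).
  by apply: eq_bigr => k _; rewrite mul0r addr0.
have VY w : \sum_(k < N) cis (0%:~R * (X w - 0) + (k : nat)%:~R * (Y w - y0)) = dirichlet N (Y w
    - y0).
  by apply: eq_bigr => k _; rewrite mul0r add0r.
have VXY w : \sum_(k : 'I_N * 'I_N) cis ((k.1 : nat)%:~R * (X w - x0) + (k.2 : nat)%:~R * (Y w -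
    y0)) =
   dirichlet N (X w - x0) * dirichlet N (Y w - y0).
  rewrite /dirichlet mulr_suml; under [RHS]eq_bigr do rewrite mulr_sumr.
  by rewrite pair_big/=; apply: eq_bigr => k _; rewrite cisD.
have bDX : bounded_mfun (fun w => nsq (dirichlet N (X w - x0))) by under eq_fun do rewrite -VX.
have bDY : bounded_mfun (fun w => nsq (dirichlet N (Y w - y0))) by under eq_fun do rewrite -VY.
have mDX : mean P (fun w => nsq (dirichlet N (X w - x0))) = N%:R.
  by rewrite -{2}[N]card_ord -mVX; congr mean; apply/funext => w; rewrite VX.
have mDY : mean P (fun w => nsq (dirichlet N (Y w - y0))) = N%:R.
  by rewrite -{2}[N]card_ord -mVY; congr mean; apply/funext => w; rewrite VY.
have bG : bounded_mfun (fun w => 2 / g * nsq (dirichlet N (Y w - y0)) + 2 / g' * nsq (dirichlet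
    N (X w - x0))).
  by apply: bounded_mfunD; apply: bounded_mfunZ.
have c0 : 0 <= 2 / g by rewrite divr_ge0// ltW.
have c'0 : 0 <= 2 / g' by rewrite divr_ge0// ltW.
have G0 w : 0 <= 2 / g * nsq (dirichlet N (Y w - y0)) + 2 / g' * nsq (dirichlet N (X w - x0)).
  by rewrite addr_ge0// mulr_ge0// nsq_ge0.
have : N%:R * N%:R <= (2 / g + 2 / g') * N%:R.
  rewrite -[X in X <= _]natrM -{1 2}[N]card_ord -card_prod -mV.
  have -> : (2 / g + 2 / g') * N%:R =
     mean P (fun w => 2 / g * nsq (dirichlet N (Y w - y0)) + 2 / g' * nsq (dirichlet N (X w - x0))).
    by rewrite meanD ?meanZ ?mDX ?mDY ?mulrDl//; exact: bounded_mfunZ.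
  apply: (@le_mean_off_null _ 0 (N%:R ^+ 2 * N%:R ^+ 2)) => //.
    move=> w pw; rewrite VXY nsqM.
    have [uw|uw] := eqVneq (u (w 0%N)) i; last first.
      apply: ler_wpDr; first by rewrite mulr_ge0// nsq_ge0.
      by rewrite ler_wpM2r ?nsq_ge0//; apply: nsq_dirichlet_le => //; exact: hg.
    apply: ler_wpDl; first by rewrite mulr_ge0// nsq_ge0.
    rewrite mulrC ler_wpM2r ?nsq_ge0//; apply: nsq_dirichlet_le => //; apply: hg'.
    by apply/negP => /eqP vw; apply: hn; exists (w 0%N).
  move=> w; rewrite VXY nsqM; apply: ler_wpDl => //.
  by rewrite ler_pM ?nsq_ge0 ?nsq_dirichlet_le_sqr.
by rewrite ler_pM2r// leNgt hN.
Qed.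

End bernoulli_digits.

(** * Hausdorff dimension *)

Section hausdorff_dimension_bounds.
Context {R : realType}.
Local Open Scope ereal_scope.

Section upper.
Context {T : Type} (dist : T -> T -> R).
Hypothesis dist_ge0 : forall x y, (0 <= dist x y)%R.

Lemma diameter_ge0 (A : set T) : A !=set0 -> 0 <= diameter dist A.
Proof.
move=> [x Ax]; apply: (@le_trans _ _ (dist x x)%:E); first by rewrite lee_fin.
by apply: ereal_sup_ubound; exists x => //; exists x.
Qed.

Lemma hausdorff_weight_ge0 (s : R) (A : set T) : 0 <= hausdorff_weight dist s A.
Proof. by rewrite /hausdorff_weight; case: ifP => // _; exact: poweR_ge0. Qed.

Lemma hausdorff_weight_le (s r : R) (A : set T) : (0 <= s)%R -> (0 <= r)%R ->
  diameter dist A <= r%:E -> hausdorff_weight dist s A <= (r `^ s)%:E.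
Proof.
move=> s0 r0 Ar; rewrite /hausdorff_weight; case: ifPn => [_|/set0P/diameter_ge0].
  by rewrite lee_fin powR_ge0.
case: (diameter dist A) Ar => [x| |]//=; rewrite !lee_fin => xr x0.
by rewrite ge0_ler_powR.
Qed.

Lemma hausdorff_measure_ge0 (s : R) (A : set T) : 0 <= hausdorff_measure dist s A.
Proof.
apply: (@le_trans _ _ (hausdorff_content dist s 1 A)).
  by apply: le_ereal_inf_tmp => _ [U _ <-]; apply: nneseries_ge0 => i _ _; exact:
      hausdorff_weight_ge0.
by apply: ereal_sup_ubound; exists 1%R => //=.
Qed.

Lemma hausdorff_dim_le (A : set T) (k : nat) :
  (forall N, (0 < N)%N -> exists U : nat -> set T,
     A `<=` \bigcup_(i in `I_(N ^ k)) U i /\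
     forall i, (i < N ^ k)%N -> diameter dist (U i) <= (2 / N%:R)%:E) ->
  hausdorff_dim dist A <= k%:R%:E.
Proof.
move=> cover; apply/lee_addgt0Pr => e e0; rewrite -EFinD.
have s0 : (0 < k%:R + e)%R by rewrite ltr_wpDl.
apply: ereal_inf_lbound; exists (k%:R + e)%R => //; split; first exact: ltW.
apply/eqP; rewrite eq_le hausdorff_measure_ge0 andbT.
apply: ge_ereal_sup => _ [del /= del0 <-].
apply/lee_addgt0Pr => eta eta0; rewrite add0e.
set s := (k%:R + e)%R in s0 *.
(* Solves [2^s / q^e = eta]: the [N^k] pieces of diameter at most [2 / N] have total weight at most
   [2^s / N^e], as [s = k + e]. *)
pose q : R := ((2 `^ s / eta) `^ (e^-1))%R.
pose N := (Num.truncn (Num.max q (2 / del))%R).+1.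
have N0 : (0 < N)%N by [].
have Nmax : (Num.max q (2 / del) <= N%:R)%R by rewrite ltW// Num.Theory.truncnS_gt.
have [qN delN] : (q <= N%:R /\ 2 / del <= N%:R)%R.
  by move: Nmax; rewrite ge_max => /andP[].
have NR0 : (0 < N%:R :> R)%R by rewrite ltr0n.
have [U [AU dU]] := cover N N0.
(* Contents are defined by infinite coverings; the empty sets added here have weight 0. *)
pose V i := if (i < N ^ k)%N then U i else set0.
have Vd i : diameter dist (V i) <= (2 / N%:R)%:E.
  rewrite /V; case: ifP => [/dU//|_].
  rewrite /diameter (_ : [set _ | _ in _ & _ in _] = set0) ?ereal_sup0 ?leNye//.
  by apply/seteqP; split=> // x [y []].
apply: (@le_trans _ _ (\sum_(0 <= i <oo) hausdorff_weight dist s (V i))).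
  apply: ereal_inf_lbound; exists V => //=; split.
    by move=> x /AU[i /= iN Ui]; exists i => //; rewrite /V iN.
  move=> i; apply: le_trans (Vd i) _; rewrite lee_fin.
  by rewrite ler_pdivrMr// mulrC -ler_pdivrMr.
rewrite (@nneseries_split _ _ 0 (N ^ k)%N) => [|i _]; last exact: hausdorff_weight_ge0.
rewrite add0n [X in _ + X](_ : _ = 0) ?adde0; last first.
  apply: eseries0 => i; rewrite /V; move=> Ni _; rewrite ltnNge Ni /=.
  by rewrite /hausdorff_weight eqxx.
apply: (@le_trans _ _ (\sum_(0 <= i < N ^ k) ((2 / N%:R) `^ s)%:E)).
  by apply: lee_sum => i _; apply: hausdorff_weight_le => //; exact: ltW.
rewrite sumEFin lee_fin sumr_const_nat subn0.
have -> : ((2 / N%:R) `^ s *+ (N ^ k) = 2 `^ s / N%:R `^ e :> R)%R.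
  rewrite -mulr_natr natrX powRM ?invr_ge0// -powR_inv1// -powRrM.
  rewrite -mulrA; congr (_ * _)%R; rewrite -powR_mulrn// -powRD; last by rewrite (gt_eqF NR0)
      implybT.
  by rewrite mulN1r /s opprD addrAC addNr add0r powRN.
rewrite ler_pdivrMr ?powR_gt0// mulrC -ler_pdivrMr//.
have -> : (2 `^ s / eta = q `^ e :> R)%R.
  by rewrite /q -powRrM mulVf ?gt_eqF// powRr1// divr_ge0 ?powR_ge0// ltW.
by rewrite ge0_ler_powR ?nnegrE ?powR_ge0// ltW.
Qed.

End upper.

(** A set of diameter [r <= 1] lies in an interval of length [2 r], and [r <= r^s] for [s < 1].
    Subadditivity of Lebesgue measure keeps the [s]-content at scale 1 above [1/2]. *)
Lemma dimH_line_ge1 (A : set R) : `[0%R, 1%R[ `<=` A -> 1 <= dimH_line A.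
Proof.
move=> A01; apply: le_ereal_inf_tmp => _ [s [s0 Hs] <-]; rewrite lee_fin leNgt; apply/negP => s1.
have : (2^-1)%:E <= hausdorff_measure (@dist_line R) s A.
  apply: (@le_trans _ _ (hausdorff_content (@dist_line R) s 1 A)); last first.
    by apply: ereal_sup_ubound; exists 1%R => //=.
  apply: le_ereal_inf_tmp => _ [U [AU dU] <-].
  have /choice[B hB] : forall i, exists B : set R, [/\ measurable B, U i `<=` B &
      lebesgue_measure B <= 2%:E * hausdorff_weight (@dist_line R) s (U i)].
    move=> i; have [->|/set0P[x Ux]] := eqVneq (U i) set0.
      by exists set0; split=> //; rewrite measure0 mule_ge0// hausdorff_weight_ge0.
    have d0 : 0 <= diameter (@dist_line R) (U i).
      by apply: diameter_ge0; [move=> *; exact: normr_ge0 | exists x].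
    have wE : hausdorff_weight (@dist_line R) s (U i) = diameter (@dist_line R) (U i) `^ s.
      by rewrite /hausdorff_weight ifF//; apply/negP => /eqP h; move: Ux; rewrite h.
    have ub y : U i y -> (`|x - y|)%:E <= diameter (@dist_line R) (U i).
      by move=> Uy; apply: ereal_sup_ubound; exists x => //; exists y.
    rewrite wE; move: (dU i) d0 ub; case: (diameter _ _) => [r| |]//.
    rewrite !lee_fin => r1 r0 ub.
    exists `[(x - r)%R, (x + r)%R]%classic; split=> //.
      move=> y /ub; rewrite lee_fin distrC ler_distl /= in_itv/= => /andP[h1 h2].
      by apply/andP; split.
    rewrite lebesgue_measure_itv/= lte_fin; case: ifPn => [_|_]; last first.
      by rewrite mule_ge0// lee_fin powR_ge0.
    rewrite /= -EFinD -EFinM lee_fin.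
    have -> : (x + r - (x - r) = 2 * r)%R by lra.
    rewrite ler_wpM2l//.
    have [->|rn0] := eqVneq r 0%R; first exact: powR_ge0.
    have rpos : (0 < r)%R by rewrite lt_neqAle eq_sym rn0.
    rewrite -{1}(powRr1 r0) /powR (negPf rn0) ler_expR.
    by have := ln_le0 r1; nra.
  have w0 i : 0 <= hausdorff_weight (@dist_line R) s (U i) by exact: hausdorff_weight_ge0.
  have h1 : 1 <= \sum_(0 <= i <oo) lebesgue_measure (B i).
    have -> : 1 = lebesgue_measure (`[0%R, 1%R[%classic : set R) :> \bar R.
      by rewrite lebesgue_measure_itv/= lte_fin ltr01 oppr0 adde0.
    apply: measure_sigma_subadditive => //.
    - by move=> i; case: (hB i).
    - by move=> x /A01/AU[i _ Ux]; exists i => //; case: (hB i) => _ h _; exact: h.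
  have h2 : \sum_(0 <= i <oo) lebesgue_measure (B i) <=
      \sum_(0 <= i <oo) (2%:E * hausdorff_weight (@dist_line R) s (U i)).
    by apply: lee_nneseries => [i _ _|i _]; [exact: measure_ge0 | case: (hB i)].
  have := le_trans h1 h2; rewrite nneseriesZl//.
  have : 0 <= \sum_(0 <= i <oo) hausdorff_weight (@dist_line R) s (U i).
    by apply: nneseries_ge0.
  case: (\sum_(0 <= i <oo) _) => [r| |]//; last by move=> _ _; exact: leey.
  by rewrite -EFinM !lee_fin => _; lra.
by rewrite Hs lee_fin leNgt invr_gt0 ltr0n.
Qed.

End hausdorff_dimension_bounds.

Section subsets_of_the_unit_square.
Context {R : realType}.

Lemma dist_plane_ge0 (z w : R * R) : 0 <= dist_plane z w.
Proof. exact: sqrtr_ge0. Qed.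

Lemma dist_plane_le (z w : R * R) : dist_plane z w <= `|z.1 - w.1| + `|z.2 - w.2|.
Proof.
rewrite /dist_plane -[X in _ <= X]ger0_norm ?addr_ge0// -[X in _ <= X]sqrtr_sqr.
apply: ler_wsqrtr; rewrite [X in _ <= X]sqrrD !real_normK ?num_real// -addrA lerD2l.
by rewrite lerDr mulrn_wge0// mulr_ge0.
Qed.

Definition grid_cell (N i : nat) : set R := [set x | i%:R <= x * N%:R <= i.+1%:R].

Lemma grid_cell_cover (N : nat) (x : R) : (0 < N)%N -> 0 <= x <= 1 ->
  exists2 i, (i < N)%N & grid_cell N i x.
Proof.
move=> N0 /andP[x0 x1]; have NR : 0 < N%:R :> R by rewrite ltr0n.
have [xlt|] := ltP x 1.
  exists (Num.truncn (x * N%:R)).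
    by rewrite Num.Theory.truncn_lt_nat ?mulr_ge0// gtr_pMl.
  have /andP[h1 h2] := Num.Theory.truncn_itv (mulr_ge0 x0 (ltW NR)).
  by rewrite /grid_cell /= h1 ltW.
move=> x1'; have -> : x = 1 by apply/eqP; rewrite eq_le x1.
by exists N.-1; rewrite ?prednK// /grid_cell/= mul1r prednK// lexx ler_nat leq_pred.
Qed.

Lemma grid_cell_dist (N i : nat) (x y : R) : (0 < N)%N -> grid_cell N i x -> grid_cell N i y ->
  `|x - y| <= N%:R^-1.
Proof.
move=> N0; have NR : 0 < N%:R :> R by rewrite ltr0n.
rewrite /grid_cell/= -natr1 => /andP[h1 h2] /andP[h3 h4].
rewrite -(ler_pM2r NR) mulVf ?gt_eqF// -{1}(gtr0_norm NR) -normrM mulrBl ler_norml.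
by apply/andP; split; lra.
Qed.

Lemma dimH_plane_le (A : set (R * R)) (k : nat) :
  (forall N, (0 < N)%N -> exists U : nat -> set (R * R),
    A `<=` \bigcup_(i in `I_(N ^ k)) U i /\
    forall i z w, U i z -> U i w -> `|z.1 - w.1| <= N%:R^-1 /\ `|z.2 - w.2| <= N%:R^-1) ->
  (dimH_plane A <= k%:R%:E)%E.
Proof.
move=> cover; apply: hausdorff_dim_le; first exact: dist_plane_ge0.
move=> N N0; have [U [AU dU]] := cover N N0; exists U; split=> // i _.
apply: ge_ereal_sup => _ [z Uz [w Uw <-]]; rewrite lee_fin.
apply: le_trans (dist_plane_le _ _) _; have [h1 h2] := dU _ _ _ Uz Uw.
by rewrite -[2]/(1 + 1) mulrDl mul1r lerD.
Qed.

Lemma dimH_plane_point (z0 : R * R) : (dimH_plane [set z0] <= 0)%E.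
Proof.
apply: (@dimH_plane_le _ 0) => N N0; exists (fun=> [set z0]); split.
  by move=> z ->; exists 0%N.
by move=> _ z w -> ->; rewrite !subrr normr0 invr_ge0 ler0n.
Qed.

Lemma dimH_plane_horizontal (c : R) : (dimH_plane [set z | (0 <= z.1 <= 1)%R /\ z.2 = c] <= 1)%E.
Proof.
apply: (@dimH_plane_le _ 1) => N N0.
exists (fun i => [set z | grid_cell N i z.1 /\ z.2 = c]); split.
  by move=> z [/(grid_cell_cover N0)[i iN zi] zc]; exists i; rewrite //= expn1.
move=> i z w [zi zc] [wi wc]; rewrite zc wc subrr normr0 invr_ge0 ler0n; split=> //.
exact: grid_cell_dist zi wi.
Qed.

Lemma dimH_plane_vertical (c : R) : (dimH_plane [set z | z.1 = c /\ (0 <= z.2 <= 1)%R] <= 1)%E.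
Proof.
apply: (@dimH_plane_le _ 1) => N N0.
exists (fun i => [set z | z.1 = c /\ grid_cell N i z.2]); split.
  by move=> z [zc /(grid_cell_cover N0)[i iN zi]]; exists i; rewrite //= expn1.
move=> i z w [zc zi] [wc wi]; rewrite zc wc subrr normr0 invr_ge0 ler0n; split=> //.
exact: grid_cell_dist zi wi.
Qed.

Lemma dimH_plane_square :
  (dimH_plane [set z : R * R | (0 <= z.1 <= 1)%R /\ (0 <= z.2 <= 1)%R] <= 2%:R%:E)%E.
Proof.
apply: (@dimH_plane_le _ 2) => N N0.
exists (fun i => [set z | grid_cell N (i %/ N) z.1 /\ grid_cell N (i %% N) z.2]); split.
  move=> z [/(grid_cell_cover N0)[i iN zi] /(grid_cell_cover N0)[j jN zj]].
  exists (i * N + j)%N => /=; last by rewrite divnMDl// divn_small// addn0 modnMDl modn_small.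
  rewrite expnS expn1; nia.
move=> i z w [z1 z2] [w1 w2]; split; [exact: grid_cell_dist z1 w1 | exact: grid_cell_dist z2 w2].
Qed.

(** The greedy digits, differences [t k.+1 - n * t k] of the integer parts of [y n^k]; by [tn] this
    subtraction of natural numbers is exact. *)
Lemma expansion_surjective (n : nat) (y : R) : (1 < n)%N -> 0 <= y < 1 ->
  exists d : nat -> nat, (forall k, (d k < n)%N) /\ expansion n d = y.
Proof.
move=> n1 /andP[y0 y1]; have n0 : 0 < n%:R :> R by rewrite ltr0n ltnW.
pose t k := Num.truncn (y * n%:R ^+ k).
have tk k : (t k)%:R <= y * n%:R ^+ k < (t k).+1%:R.
  by apply: Num.Theory.truncn_itv; rewrite mulr_ge0// exprn_ge0// ltW.
have tn k : (n * t k <= t k.+1)%N.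
  have /andP[h1 _] := tk k; rewrite /t Num.Theory.truncn_ge_nat.
    by rewrite natrM exprS mulrCA ler_pM2l.
  by rewrite mulr_ge0// exprn_ge0// ltW.
pose d k := (t k.+1 - n * t k)%N.
have dn k : (d k < n)%N.
  rewrite /d ltn_subLR// -mulnSr -(ltr_nat R) natrM.
  have /andP[h1 _] := tk k.+1; have /andP[_ h2] := tk k; apply: le_lt_trans h1 _.
  by rewrite exprS mulrCA ltr_pM2l.
have tr k : expansion_trunc n d k = (t k)%:R / n%:R ^+ k :> R.
  elim: k => [|k IH].
    rewrite /expansion_trunc big_ord0 expr0 divr1 /t expr0 mulr1.
    by have /eqP -> : Num.truncn y == 0%N by rewrite Num.Theory.truncn_eq// y0.
  rewrite /expansion_trunc big_ord_recr/= -/(expansion_trunc n d k) IH /d natrB// natrM exprS.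

  have -> : (t k)%:R / n%:R ^+ k = n%:R * (t k)%:R / (n%:R * n%:R ^+ k) :> R.
    by rewrite -mulf_div divff ?mul1r// gt_eqF.
  by rewrite -mulrDl addrC subrK.
exists d; split=> //; apply/eqP; rewrite -subr_eq0 -normr_le0; apply/ler_addgt0Pr => e e0.
rewrite add0r; have [k hk] : exists k : nat, 2 / e < k%:R.
  by exists (Num.truncn (2 / e)).+1; exact: Num.Theory.truncnS_gt.
have b1 := @expansion_dist R n n1 d k dn.
have nk : 0 < n%:R ^+ k :> R by rewrite exprn_gt0.
have b2 : `|expansion_trunc n d k - y| <= (2%:R ^+ k)^-1.
  rewrite tr -normrN opprB ger0_norm; last first.
    by rewrite subr_ge0 ler_pdivrMr//; case/andP: (tk k).
  apply: (@le_trans _ _ (n%:R ^+ k)^-1).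
    rewrite lerBlDl -[X in _ + X]mul1r -mulrDl ler_pdivlMr//.
    by rewrite natr1 ltW//; case/andP: (tk k).
  by rewrite lef_pV2 ?posrE ?exprn_gt0// lerXn2r ?nnegrE ?(ltW n0)// ler_nat.
have : `|expansion n d - y| <= (2%:R ^+ k)^-1 + (2%:R ^+ k)^-1.
  have -> : expansion n d - y = (expansion n d - expansion_trunc n d k) + (expansion_trunc n d k
      - y) by ring.
  by apply: le_trans (ler_normD _ _) _; exact: lerD.
have : (2%:R ^+ k)^-1 <= e / 2.
  rewrite -[e / 2]invrK lef_pV2 ?posrE ?exprn_gt0 ?invr_gt0 ?divr_gt0// invf_div.
  by rewrite (le_trans (ltW hk))// -natrX ler_nat ltnW// ltn_expl.
by move=> h1 h2; lra.
Qed.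

End subsets_of_the_unit_square.

(** * Self-affine measures on carpets *)

Section self_affine_measures.
Context {R : realType} (m n : nat) (Gamma : {set 'I_m * 'I_n}).
Hypotheses (m1 : (1 < m)%N) (n1 : (1 < n)%N).
Local Notation D := {c | c \in Gamma}.

Definition xdigit (c : D) : nat := (val c).1.
Definition ydigit (c : D) : nat := (val c).2.

Lemma xdigit_lt c : (xdigit c < m)%N. Proof. exact: ltn_ord. Qed.
Lemma ydigit_lt c : (ydigit c < n)%N. Proof. exact: ltn_ord. Qed.

Definition nondegenerate (p : D -> R) (f : D -> nat) : Prop :=
  exists c d, [/\ 0 < p c, 0 < p d & f c != f d].

Definition onto_digits (p : D -> R) (f : D -> nat) (q : nat) : Prop :=
  forall i, (i < q)%N -> exists2 c, 0 < p c & f c = i.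

Lemma onto_digits_nondegenerate p f q : (1 < q)%N -> onto_digits p f q -> nondegenerate p f.
Proof.
move=> q1 fq; have [c pc fc] := fq 0%N (ltnW q1); have [d pd fd] := fq 1%N q1.
by exists c, d; split=> //; rewrite fc fd.
Qed.

Lemma row_dim_full (j : 'I_n) : (forall i : 'I_m, (i, j) \in Gamma) -> row_dim R Gamma j = 1%E.
Proof.
move=> row; rewrite /row_dim (_ : row_digits Gamma j = [set: 'I_m]%SET).
  rewrite cardsT card_ord /= ifF; last by rewrite leNgt ltr0n ltnW.
  rewrite -EFinM divff// gt_eqF// ln_gt0// ltr1n//.
by apply/setP => i; rewrite !inE row.
Qed.

Lemma dimH_projection_ge1 : (forall j, (j < n)%N -> exists c : D, ydigit c = j) ->
  (1 <= dimH_line (snd @` carpet R Gamma))%E.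
Proof.
move=> rows; apply: dimH_line_ge1 => y; rewrite /= in_itv/= => y01.
have [d [dn dy]] := expansion_surjective n1 y01.
have /choice[c cE] : forall k, exists c : D, ydigit c = d k by move=> k; exact: rows.
exists (coding R (fun k => val (c k))); last first.
  by rewrite -dy /expansion /=; congr (limn (series _)); apply/funext => k; rewrite -cE.
by exists (fun k => val (c k)) => // k; exact: valP (c k).
Qed.

Context (mu : probability (R * R)%type R) (a : D) (p : D -> R).
Context (P : probability (measurable_shift a) R).
Hypotheses (p_prob : probability_vector p) (Pp : is_bernoulli p P).
Hypothesis muE : forall A, measurable A ->
  mu A = pushforward P (fun w : measurable_shift a => coding R (fun k => val (w k))) A.
Local Notation W := (measurable_shift a).
Local Notation X := (@coord_expansion R D a m xdigit).
Local Notation Y := (@coord_expansion R D a n ydigit).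

Lemma self_affine_coordsE A : measurable A -> mu A = P ((fun w => (X w, Y w)) @^-1` A).
Proof. exact: muE. Qed.

Lemma exists_positive_weight : exists c, 0 < p c.
Proof.
case: p_prob => p0 p1; apply: contrapT => hn; have : (0 : R) = 1.
  rewrite -p1 big1// => c _; apply/eqP; rewrite eq_le p0 andbT leNgt.
  by apply/negP => ?; apply: hn; exists c.
by move/eqP; rewrite eq_sym oner_eq0.
Qed.

(** The words with some letter of weight 0 form a countable union of null sets, so such an [A] has
    full measure. *)
Lemma dimH_measure_le (A : set (R * R)) (k : \bar R) : measurable A ->
  (forall w : W, (forall i, 0 < p (w i)) -> A (X w, Y w)) ->
  (dimH_plane A <= k)%E -> (dimH_measure mu <= k)%E.
Proof.
move=> mA fullA; apply: le_trans; apply: ereal_inf_lbound; exists A => //; split=> //.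
rewrite self_affine_coordsE//; set B := _ @^-1` A.
have mB : measurable B.
  have mXY : measurable_fun setT (fun w => (X w, Y w)).
    by apply/measurable_fun_pairP; split; apply: measurable_coord_expansion => //;
       [exact: xdigit_lt | exact: ydigit_lt].
  by rewrite -[B]setTI; exact: mXY.
pose N i := [set w : W | p (w i) = 0].
have mN i : measurable (N i) by exact: (measurable_coordinate_set i [set c | p c = 0]).
have CB : ~` B `<=` \bigcup_i N i.
  move=> w nB; apply: contrapT => nN; apply: nB; apply: fullA => i.
  rewrite lt_neqAle (p_prob.1 _) andbT eq_sym; apply/negP => /eqP h.
  by apply: nN; exists i.
have PCB : (P (~` B) <= 0)%E.
  have := @measure_sigma_subadditive _ _ _ P (~` B) N mN (measurableC mB) CB.
  by rewrite eseries0// => i _ _; exact: null_digit.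
have PCB0 : P (~` B) = 0%E by apply/eqP; rewrite eq_le PCB measure_ge0.
by rewrite -[B]setCK (probability_setC P (measurableC mB)) PCB0 sube0 lte_fin ltr01.
Qed.

Lemma degenerate_digit f : ~ nondegenerate p f -> exists i, forall c, 0 < p c -> f c = i.
Proof.
move=> nd; have [c0 pc0] := exists_positive_weight; exists (f c0) => c pc.
by apply/eqP/negPn/negP => h; apply: nd; exists c, c0.
Qed.

Lemma coord_expansion_degenerate (q : nat) f i (w : W) :
  (forall c, 0 < p c -> f c = i) -> (forall k, 0 < p (w k)) ->
  coord_expansion q f w = expansion q (fun=> i) :> R.
Proof. by move=> fi pw; rewrite /coord_expansion; congr expansion; apply/funext => k; exact: fi.
    Qed.

Lemma xcoord_itv (w : W) : 0 <= X w <= 1.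
Proof. by apply: coord_expansion01 => //; exact: xdigit_lt. Qed.

Lemma ycoord_itv (w : W) : 0 <= Y w <= 1.
Proof. by apply: coord_expansion01 => //; exact: ydigit_lt. Qed.

Lemma measurable_fst_itv : measurable [set z : R * R | 0 <= z.1 <= 1].
Proof.
rewrite (_ : mkset _ = setT `&` fst @^-1` `[0, 1]%classic).
  by apply: measurable_fst => //; exact: measurable_itv.
by rewrite setTI; apply/seteqP; split=> z /=; rewrite in_itv.
Qed.

Lemma measurable_snd_itv : measurable [set z : R * R | 0 <= z.2 <= 1].
Proof.
rewrite (_ : mkset _ = setT `&` snd @^-1` `[0, 1]%classic).
  by apply: measurable_snd => //; exact: measurable_itv.
by rewrite setTI; apply/seteqP; split=> z /=; rewrite in_itv.
Qed.

Lemma measurable_fst_point (c : R) : measurable [set z : R * R | z.1 = c].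
Proof.
rewrite (_ : mkset _ = setT `&` fst @^-1` [set c]); last by rewrite setTI.
exact: measurable_fst.
Qed.

Lemma measurable_snd_point (c : R) : measurable [set z : R * R | z.2 = c].
Proof.
rewrite (_ : mkset _ = setT `&` snd @^-1` [set c]); last by rewrite setTI.
exact: measurable_snd.
Qed.

Lemma dimH_measure_le2 : (dimH_measure mu <= 2%:R%:E)%E.
Proof.
apply: dimH_measure_le (dimH_plane_square (R := R)).
  by apply: measurableI; [exact: measurable_fst_itv | exact: measurable_snd_itv].
by move=> w _; split; [exact: xcoord_itv | exact: ycoord_itv].
Qed.

Lemma dimH_measure_xdegenerate : ~ nondegenerate p xdigit -> (dimH_measure mu <= 1)%E.
Proof.
move=> /degenerate_digit[i xi].
apply: dimH_measure_le (dimH_plane_vertical (expansion m (fun=> i))).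
  by apply: measurableI; [exact: measurable_fst_point | exact: measurable_snd_itv].
by move=> w pw; split; [exact: coord_expansion_degenerate | exact: ycoord_itv].
Qed.

Lemma dimH_measure_ydegenerate : ~ nondegenerate p ydigit -> (dimH_measure mu <= 1)%E.
Proof.
move=> /degenerate_digit[j yj].
apply: dimH_measure_le (dimH_plane_horizontal (expansion n (fun=> j))).
  by apply: measurableI; [exact: measurable_fst_itv | exact: measurable_snd_point].
by move=> w pw; split; [exact: xcoord_itv | exact: coord_expansion_degenerate].
Qed.

Lemma dimH_measure_degenerate : ~ nondegenerate p xdigit -> ~ nondegenerate p ydigit ->
  (dimH_measure mu <= 0)%E.
Proof.
move=> /degenerate_digit[i xi] /degenerate_digit[j yj].
apply: dimH_measure_le (dimH_plane_point (expansion m (fun=> i), expansion n (fun=> j))).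
  rewrite (_ : [set _] = [set z | z.1 = expansion m (fun=> i)] `&` [set z | z.2 = expansion n
      (fun=> j)]).
    by apply: measurableI; [exact: measurable_fst_point | exact: measurable_snd_point].
  by apply/seteqP; split=> [z ->//|[z1 z2] /= [-> ->]].
by move=> w pw /=; congr pair; exact: coord_expansion_degenerate.
Qed.

(** All letters of positive weight lie in one row, and their x-digits exhaust the alphabet, so this
    row is full. *)
Lemma row_dim_of_xonto : onto_digits p xdigit m -> ~ nondegenerate p ydigit ->
  exists j, row_dim R Gamma j = 1%E.
Proof.
move=> xo /degenerate_digit[j yj]; have [c0 pc0] := exists_positive_weight.
exists (val c0).2; apply: row_dim_full => i; have [c pc xc] := xo i (ltn_ord i).
have -> : (i, (val c0).2) = val c; last exact: valP c.
rewrite [RHS]surjective_pairing; congr pair; apply: val_inj => //=.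
by rewrite -[LHS]/(ydigit c0) -[RHS]/(ydigit c) !yj.
Qed.

Lemma row_dim_of_pairs :
  (forall i j, (i < m)%N -> (j < n)%N -> exists2 c, 0 < p c & xdigit c = i /\ ydigit c = j) ->
  exists j, row_dim R Gamma j = 1%E.
Proof.
move=> pairs; have [c0 pc0] := exists_positive_weight.
exists (val c0).2; apply: row_dim_full => i.
have [c pc [xc yc]] := pairs i (val c0).2 (ltn_ord _) (ltn_ord _).
have -> : (i, (val c0).2) = val c; last exact: valP c.
by rewrite [RHS]surjective_pairing; congr pair; apply: val_inj.
Qed.

Lemma dimH_projection_onto : onto_digits p ydigit n -> (1 <= dimH_line (snd @` carpet R Gamma))%E.
Proof. by move=> yo; apply: dimH_projection_ge1 => j /yo[c _ yc]; exists c. Qed.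

End self_affine_measures.

(** * Pairs of measures that are not singular *)

Section nonsingular_pairs.
Context {R : realType}.

Definition mx22 (x y z t : R) : 'M[R]_2 :=
  \matrix_(i, j) (if i == 0 then (if j == 0 then x else y) else (if j == 0 then z else t)).

Lemma mx22E x y z t : [/\ mx22 x y z t 0 0 = x, mx22 x y z t 0 1 = y,
  mx22 x y z t 1 0 = z & mx22 x y z t 1 1 = t].
Proof. by split; rewrite mxE. Qed.

Lemma det_mx22 (L : 'M[R]_2) : \det L = L 0 0 * L 1 1 - L 0 1 * L 1 0.
Proof.
rewrite (expand_det_row _ 0) !big_ord_recl big_ord0 addr0 /cofactor !det_mx11 !mxE.
rewrite expr0 mul1r /= expr1 mulN1r mulrN.
by congr (L _ _ * L _ _ - L _ _ * L _ _); apply: val_inj.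
Qed.

Lemma irrational_inv (x y : R) : irrational (x / y) -> irrational (y / x).
Proof.
move=> irr /rationalP[i [k yx]]; apply: irr; apply/rationalP.
rewrite -invf_div yx invf_div; case: i yx => i yx; first by exists k%:Z, i.
(* Denominators in [rationalP] are natural numbers, so the sign moves to the numerator. *)
exists (- k%:Z), i.+1; rewrite NegzE !mulrNz invrN mulrN mulNr.
by rewrite -!pmulrn.
Qed.

Section two_measures.
Context (m1 n1 m2 n2 : nat) (Gamma : {set 'I_m1 * 'I_n1}) (Lambda : {set 'I_m2 * 'I_n2}).
Context (mu nu : probability (R * R)%type R).
Hypotheses (hn1 : (2 <= n1)%N) (hm1 : (n1 < m1)%N) (hn2 : (2 <= n2)%N) (hm2 : (n2 < m2)%N).
Context (a1 : {c | c \in Gamma}) (p1 : {c | c \in Gamma} -> R).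
Context (P1 : probability (measurable_shift a1) R).
Hypotheses (p1_prob : probability_vector p1) (Pp1 : is_bernoulli p1 P1).
Hypothesis muE : forall A, measurable A ->
  mu A = pushforward P1 (fun w : measurable_shift a1 => coding R (fun k => val (w k))) A.
Context (a2 : {c | c \in Lambda}) (p2 : {c | c \in Lambda} -> R).
Context (P2 : probability (measurable_shift a2) R).
Hypotheses (p2_prob : probability_vector p2) (Pp2 : is_bernoulli p2 P2).
Hypothesis nuE : forall A, measurable A ->
  nu A = pushforward P2 (fun w : measurable_shift a2 => coding R (fun k => val (w k))) A.
Local Notation u1 := (@xdigit m1 n1 Gamma).
Local Notation v1 := (@ydigit m1 n1 Gamma).
Local Notation u2 := (@xdigit m2 n2 Lambda).
Local Notation v2 := (@ydigit m2 n2 Lambda).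
Local Notation cf1 := (charf P1 (@coord_expansion R _ a1 m1 u1) (@coord_expansion R _ a1 n1 v1)).
Local Notation cf2 := (charf P2 (@coord_expansion R _ a2 m2 u2) (@coord_expansion R _ a2 n2 v2)).

Let gm1 : (1 < m1)%N. Proof. exact: leq_trans hn1 (ltnW hm1). Qed.
Let gm2 : (1 < m2)%N. Proof. exact: leq_trans hn2 (ltnW hm2). Qed.
Let mX1 : measurable_fun setT (@coord_expansion R _ a1 m1 u1).
Proof. by apply: measurable_coord_expansion => //; exact: xdigit_lt. Qed.
Let mY1 : measurable_fun setT (@coord_expansion R _ a1 n1 v1).
Proof. by apply: measurable_coord_expansion => //; exact: ydigit_lt. Qed.

Lemma exprn_nat_neq (q k l : nat) : (1 < q)%N -> k != l -> q%:R ^+ k - q%:R ^+ l != 0 :> R.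
Proof.
move=> q1 kl; rewrite subr_eq0 -!natrX eqr_nat eqn_exp2l//.
Qed.

Lemma nsq_charf_avg_null (A B : R) (P Q : nat) : (1 < P)%N -> (1 < Q)%N ->
  irrational (ln P%:R / ln m1%:R : R) -> irrational (ln Q%:R / ln n1%:R : R) ->
  A != 0 \/ B != 0 -> (A != 0 -> nondegenerate p1 u1) -> (B != 0 -> nondegenerate p1 v1) ->
  avg_null (fun r => nsq (cf1 (A * P%:R ^+ r) (B * Q%:R ^+ r))).
Proof.
move=> gP gQ irrP irrQ AB hA hB.
have mn1 : m1 != n1 by rewrite gtn_eqF.
have bd s t : 0 <= nsq (cf1 s t) <= 2 by exact: nsq_charf_le2.
have sc : scaling_relation p1 u1 v1 m1 n1 (fun s t => nsq (cf1 s t)).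
  by apply: nsq_charf_scaling => //; [exact: xdigit_lt | exact: ydigit_lt].
exact: (average_decay p1_prob gm1 hn1 mn1 gP gQ irrP irrQ AB hA hB bd sc).
Qed.

(** The differences of pulled-back frequencies are constants times [m2^r] and [n2^r]; the constants
    vanish exactly where [h1] or [h2] does, so nondegeneracy of a marginal is asked only where its
    coordinate is involved. *)
Lemma singular_diag (L : 'M[R]_2) (b : R * R) (h1 h2 : int) :
  L 0 0 != 0 -> L 1 1 != 0 -> L 0 1 = 0 -> L 1 0 = 0 ->
  irrational (ln m2%:R / ln m1%:R : R) -> irrational (ln n2%:R / ln n1%:R : R) ->
  h1 != 0 \/ h2 != 0 -> (h1 != 0 -> nondegenerate p1 u1) -> (h2 != 0 -> nondegenerate p1 v1) ->
  cf2 h1%:~R h2%:~R != 0 -> mutually_singular (pushforward mu (affine_map L b)) nu.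
Proof.
move=> L00 L11 L01 L10 irrx irry h12 hx hy c0.
apply: (singular_of_decay mX1 mY1 (self_affine_coordsE muE) p2_prob Pp2 gm2 hn2
  (@xdigit_lt _ _ _) (@ydigit_lt _ _ _) (self_affine_coordsE nuE) b c0) => xi et k l kl.
have := @nsq_charf_avg_null (L 0 0 * h1%:~R * (m2%:R ^+ k - m2%:R ^+ l)) (L 1 1 * h2%:~R *
    (n2%:R ^+ k - n2%:R ^+ l))
  m2 n2 gm2 hn2 irrx irry.
rewrite !mulf_eq0 !negb_or L00 L11 !exprn_nat_neq// !andbT !intr_eq0.
move=> /(_ h12 hx hy); congr avg_null; apply/funext => r.
by rewrite /xi /et L01 L10; congr (nsq (cf1 _ _)); rewrite !exprD; ring.
Qed.

(** The transposed matrix swaps the coordinates: the x-frequencies seen by [mu] are multiples of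
    [n2^r], hence the crossed ratios of logarithms. *)
Lemma singular_antidiag (L : 'M[R]_2) (b : R * R) (h1 h2 : int) :
  L 0 0 = 0 -> L 1 1 = 0 -> L 0 1 != 0 -> L 1 0 != 0 ->
  irrational (ln n2%:R / ln m1%:R : R) -> irrational (ln m2%:R / ln n1%:R : R) ->
  h1 != 0 \/ h2 != 0 -> (h2 != 0 -> nondegenerate p1 u1) -> (h1 != 0 -> nondegenerate p1 v1) ->
  cf2 h1%:~R h2%:~R != 0 -> mutually_singular (pushforward mu (affine_map L b)) nu.
Proof.
move=> L00 L11 L01 L10 irrx irry h12 hx hy c0.
apply: (singular_of_decay mX1 mY1 (self_affine_coordsE muE) p2_prob Pp2 gm2 hn2
  (@xdigit_lt _ _ _) (@ydigit_lt _ _ _) (self_affine_coordsE nuE) b c0) => xi et k l kl.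
have := @nsq_charf_avg_null (L 1 0 * h2%:~R * (n2%:R ^+ k - n2%:R ^+ l)) (L 0 1 * h1%:~R *
    (m2%:R ^+ k - m2%:R ^+ l))
  n2 m2 hn2 gm2 irrx irry.
rewrite !mulf_eq0 !negb_or L01 L10 !exprn_nat_neq// !andbT !intr_eq0.
have h21 : h2 != 0 \/ h1 != 0 by case: h12; [right|left].
move=> /(_ h21 hx hy); congr avg_null; apply/funext => r.
by rewrite /xi /et L00 L11; congr (nsq (cf1 _ _)); rewrite !exprD; ring.
Qed.

Lemma nonsingular_diag (L : 'M[R]_2) (b : R * R) :
  L 0 0 != 0 -> L 1 1 != 0 -> L 0 1 = 0 -> L 1 0 = 0 ->
  irrational (ln m2%:R / ln m1%:R : R) -> irrational (ln n2%:R / ln n1%:R : R) ->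
  ~ mutually_singular (pushforward mu (affine_map L b)) nu ->
  [/\ nondegenerate p1 u1 -> onto_digits p2 u2 m2,
      nondegenerate p1 v1 -> onto_digits p2 v2 n2 &
      nondegenerate p1 u1 -> nondegenerate p1 v1 -> forall i j, (i < m2)%N -> (j < n2)%N ->
        exists2 c, 0 < p2 c & u2 c = i /\ v2 c = j].
Proof.
move=> L00 L11 L01 L10 irrx irry ns.
have zero (h1 h2 : int) : h1 != 0 \/ h2 != 0 -> (h1 != 0 -> nondegenerate p1 u1) ->
    (h2 != 0 -> nondegenerate p1 v1) -> cf2 h1%:~R h2%:~R = 0.
  move=> h12 hx hy; apply: contrapT => /eqP c0.
  by apply: ns; exact: singular_diag L00 L11 L01 L10 irrx irry h12 hx hy c0.
split=> [nu1|nv1|nu1 nv1].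
- apply: (all_first_digits p2_prob Pp2 gm2 hn2 (@xdigit_lt _ _ _) (@ydigit_lt _ _ _)) => h h0.
  by apply: (zero h 0); [left| |rewrite eqxx].
- apply: (all_first_digits p2_prob Pp2 hn2 gm2 (@ydigit_lt _ _ _) (@xdigit_lt _ _ _)) => h h0.
  rewrite charfC; by apply: (zero 0 h); [right|rewrite eqxx|].
- apply: (all_digit_pairs p2_prob Pp2 gm2 hn2 (@xdigit_lt _ _ _) (@ydigit_lt _ _ _)) => h1 h2 h12.
  by apply: zero => //; move: h12; rewrite xpair_eqE negb_and => /orP.
Qed.

Lemma nonsingular_antidiag (L : 'M[R]_2) (b : R * R) :
  L 0 0 = 0 -> L 1 1 = 0 -> L 0 1 != 0 -> L 1 0 != 0 ->
  irrational (ln n2%:R / ln m1%:R : R) -> irrational (ln m2%:R / ln n1%:R : R) ->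
  ~ mutually_singular (pushforward mu (affine_map L b)) nu ->
  [/\ nondegenerate p1 u1 -> onto_digits p2 v2 n2,
      nondegenerate p1 v1 -> onto_digits p2 u2 m2 &
      nondegenerate p1 u1 -> nondegenerate p1 v1 -> forall i j, (i < m2)%N -> (j < n2)%N ->
        exists2 c, 0 < p2 c & u2 c = i /\ v2 c = j].
Proof.
move=> L00 L11 L01 L10 irrx irry ns.
have zero (h1 h2 : int) : h1 != 0 \/ h2 != 0 -> (h2 != 0 -> nondegenerate p1 u1) ->
    (h1 != 0 -> nondegenerate p1 v1) -> cf2 h1%:~R h2%:~R = 0.
  move=> h12 hx hy; apply: contrapT => /eqP c0.
  by apply: ns; exact: singular_antidiag L00 L11 L01 L10 irrx irry h12 hx hy c0.
split=> [nu1|nv1|nu1 nv1].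
- apply: (all_first_digits p2_prob Pp2 hn2 gm2 (@ydigit_lt _ _ _) (@xdigit_lt _ _ _)) => h h0.
  rewrite charfC; by apply: (zero 0 h); [right| |rewrite eqxx].
- apply: (all_first_digits p2_prob Pp2 gm2 hn2 (@xdigit_lt _ _ _) (@ydigit_lt _ _ _)) => h h0.
  by apply: (zero h 0); [left|rewrite eqxx|].
- apply: (all_digit_pairs p2_prob Pp2 gm2 hn2 (@xdigit_lt _ _ _) (@ydigit_lt _ _ _)) => h1 h2 h12.
  by apply: zero => //; move: h12; rewrite xpair_eqE negb_and => /orP.
Qed.

End two_measures.

(** Lets the results on [nu] be applied to [mu], through the inverse map. *)
Lemma mutually_singular_inverse (mu nu : probability (R * R)%type R) (f g : R * R -> R * R) :
  measurable_fun setT g -> cancel f g ->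
  mutually_singular (pushforward nu g) mu -> mutually_singular (pushforward mu f) nu.
Proof.
move=> mg fg [A [mA nA mu0]]; exists (~` (g @^-1` A)).
have mgA : measurable (g @^-1` A) by rewrite -[X in measurable X]setTI; exact: mg.
split; [exact: measurableC | | by rewrite setCK].
rewrite /pushforward (_ : f @^-1` _ = ~` A)//.
by apply/seteqP; split=> z /=; rewrite fg.
Qed.

End nonsingular_pairs.

Section dimension_arithmetic.
Context {R : realType}.
Local Open Scope ereal_scope.

Lemma bigmaxe_ge0 (I : finType) (F : I -> \bar R) : 0 <= \big[maxe/0]_i F i.
Proof. exact: bigmax_ge_id. Qed.

Lemma bigmaxe_ge (I : finType) (F : I -> \bar R) i (x : \bar R) :
  x <= F i -> x <= \big[maxe/0]_i F i.
Proof. by move=> xF; apply: le_trans xF _; exact: le_bigmax. Qed.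

Lemma sub1_ge1 (x y : \bar R) : 1 <= x -> 1 <= y -> 1 <= x + y - 1.
Proof.
move=> x1 y1; have : 1 + 1 <= x + y by exact: leeD.
by move=> xy; rewrite -[X in X <= _](@addeK _ 1 1)// leeB.
Qed.

End dimension_arithmetic.

Local Open Scope ereal_scope.

Theorem theorem1p5 (R : realType) (m1 n1 m2 n2 : nat)
    (Gamma : {set 'I_m1 * 'I_n1}) (Lambda : {set 'I_m2 * 'I_n2})
    (mu nu : probability (R * R)%type R)
    (hn1 : (2 <= n1)%N) (hm1 : (n1 < m1)%N)
    (hn2 : (2 <= n2)%N) (hm2 : (n2 < m2)%N)
    (hF : ~ on_axis_parallel_line (carpet R Gamma))
    (hE : ~ on_axis_parallel_line (carpet R Lambda))
    (hinc : incommensurable R m1 n1 m2 n2)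
    (hmu : self_affine_measure Gamma mu)
    (hnu : self_affine_measure Lambda nu) :
  let F := carpet R Gamma in
  let E := carpet R Lambda in
  let kappa := maxe (dimH_measure mu) (dimH_measure nu) in
  let dimP2F := dimH_line (snd @` F) in
  let dimP2E := dimH_line (snd @` E) in
  (\big[maxe/0]_(ij : 'I_n1 * 'I_n2)
        (row_dim R Gamma ij.1 + row_dim R Lambda ij.2 - 1)
      + maxe (dimP2F + dimP2E - 1) 0 < kappa ->
   forall (L : 'M[R]_2) (b : R * R), L \in unitmx -> is_diag_mx L ->
     mutually_singular (pushforward mu (affine_map L b)) nu)
  /\
  (\big[maxe/0]_(i < n1) (row_dim R Gamma i + dimP2E - 1)
      + \big[maxe/0]_(j < n2) (row_dim R Lambda j + dimP2F - 1) < kappa ->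
   forall (L : 'M[R]_2) (b : R * R), L \in unitmx -> is_antidiag_mx L ->
     mutually_singular (pushforward mu (affine_map L b)) nu).
Proof.
move: hmu hnu => [a1 [p1 [P1 [p1_prob Pp1 muE]]]] [a2 [p2 [P2 [p2_prob Pp2 nuE]]]].
have [irrmm irrmn irrnm irrnn] := hinc.
have gm1 : (1 < m1)%N by exact: leq_trans hn1 (ltnW hm1).
have gm2 : (1 < m2)%N by exact: leq_trans hn2 (ltnW hm2).
move=> F E kappa dimP2F dimP2E.
have kappa_le k : dimH_measure mu <= k -> dimH_measure nu <= k -> kappa <= k.
  by move=> h1 h2; rewrite /kappa ge_max h1.
have mu2 := dimH_measure_le2 gm1 hn1 p1_prob Pp1 muE.
have nu2 := dimH_measure_le2 gm2 hn2 p2_prob Pp2 nuE.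
have two : 2%:R%:E = 1 + 1 :> \bar R by rewrite -EFinD.
have max01 : forall x y : \bar R, 1 <= x -> 1 <= y -> 1 <= maxe (x + y - 1) 0.
  by move=> x y x1 y1; rewrite le_max sub1_ge1.
have max0 : forall x : \bar R, 0 <= maxe x 0 by move=> x; rewrite le_max lexx orbT.
have det0 (L : 'M[R]_2) : L \in unitmx -> (L 0 0 * L 1 1 - L 0 1 * L 1 0 != 0)%R.
  by rewrite unitmxE unitfE det_mx22.
split=> [lt_kappa L b /det0 detL|lt_kappa L b /det0 detL].
- move=> /is_diag_mxP diagL.
  have L01 : L 0%R 1%R = 0%R by apply: diagL.
  have L10 : L 1%R 0%R = 0%R by apply: diagL.
  move: detL; rewrite L01 mul0r subr0 mulf_eq0 negb_or => /andP[L00 L11].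
  apply: contrapT => ns.
  (* [L'] and [b'] are the inverse affine map. *)
  pose L' : 'M[R]_2 := mx22 (L 0%R 0%R)^-1%R 0%R 0%R (L 1%R 1%R)^-1%R.
  pose b' : R * R := (- ((L 0%R 0%R)^-1 * b.1), - ((L 1%R 1%R)^-1 * b.2))%R.
  have [L'00 L'01 L'10 L'11] := mx22E (L 0%R 0%R)^-1%R 0%R 0%R (L 1%R 1%R)^-1%R.
  have inv : cancel (affine_map L b) (affine_map L' b').
    move=> [x y]; rewrite /affine_map L'00 L'01 L'10 L'11 L01 L10 /=.
    by congr pair; field.
  have ns' : ~ mutually_singular (pushforward nu (affine_map L' b')) mu.
    by move=> /(mutually_singular_inverse (measurable_affine_map L' b') inv).
  have [A1 B1 C1] := nonsingular_diag hn1 hm1 hn2 hm2 p1_prob Pp1 muE p2_prob Pp2 nuE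
    L00 L11 L01 L10 (irrational_inv irrmm) (irrational_inv irrnn) ns.
  have L'00n : L' 0%R 0%R != 0%R by rewrite L'00 invr_eq0.
  have L'11n : L' 1%R 1%R != 0%R by rewrite L'11 invr_eq0.
  have [A2 B2 C2] := nonsingular_diag hn2 hm2 hn1 hm1 p2_prob Pp2 nuE p1_prob Pp1 muE
    L'00n L'11n L'01 L'10 irrmm irrnn ns'.
  move: lt_kappa; rewrite ltNge => /negP; apply.
  (* Going from [mu] to [nu] and back, nondegeneracy of one marginal yields that both matched
     marginals use all digits; degeneracy passes across by contraposition. *)
  have [xu1|nxu1] := pselect (nondegenerate p1 (@xdigit m1 n1 Gamma)).
    have xo2 := A1 xu1; have xu2 := onto_digits_nondegenerate gm2 xo2.
    have xo1 := A2 xu2.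
    have [yv1|nyv1] := pselect (nondegenerate p1 (@ydigit m1 n1 Gamma)).
      have yo2 := B1 yv1; have yv2 := onto_digits_nondegenerate hn2 yo2; have yo1 := B2 yv2.
      have [i ri] := row_dim_of_pairs gm1 p1_prob (C2 xu2 yv2).
      have [j rj] := row_dim_of_pairs gm2 p2_prob (C1 xu1 yv1).
      (* The trivial bound 2 for [kappa] is split evenly: full rows make the first summand at least
         1, full projections the second. *)
      apply: (@le_trans _ _ (1 + 1)); first by apply: kappa_le; rewrite -two.
      apply: leeD; first by apply: (@bigmaxe_ge _ _ _ (i, j)); apply: sub1_ge1; rewrite ?ri ?rj.
      by apply: max01; [exact: (dimH_projection_onto hn1 yo1) | exact: (dimH_projection_onto hn2
          yo2)].
    have nyv2 : ~ nondegenerate p2 (@ydigit m2 n2 Lambda).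
      by move=> /B2 /(onto_digits_nondegenerate hn1).
    have [i ri] := row_dim_of_xonto gm1 p1_prob xo1 nyv1.
    have [j rj] := row_dim_of_xonto gm2 p2_prob xo2 nyv2.
    apply: (@le_trans _ _ (1 + 0)).
      rewrite adde0; apply: kappa_le.
        exact: (dimH_measure_ydegenerate gm1 hn1 p1_prob Pp1 muE nyv1).
      exact: (dimH_measure_ydegenerate gm2 hn2 p2_prob Pp2 nuE nyv2).
    by apply: leeD => //; apply: (@bigmaxe_ge _ _ _ (i, j)); apply: sub1_ge1; rewrite ?ri ?rj.
  have nxu2 : ~ nondegenerate p2 (@xdigit m2 n2 Lambda).
    by move=> /A2 /(onto_digits_nondegenerate gm1).
  have [yv1|nyv1] := pselect (nondegenerate p1 (@ydigit m1 n1 Gamma)).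
    have yo2 := B1 yv1; have yv2 := onto_digits_nondegenerate hn2 yo2; have yo1 := B2 yv2.
    apply: (@le_trans _ _ (0 + 1)).
      rewrite add0e; apply: kappa_le.
        exact: (dimH_measure_xdegenerate gm1 hn1 p1_prob Pp1 muE nxu1).
      exact: (dimH_measure_xdegenerate gm2 hn2 p2_prob Pp2 nuE nxu2).
    apply: leeD; first exact: bigmaxe_ge0.
    by apply: max01; [exact: (dimH_projection_onto hn1 yo1) | exact: (dimH_projection_onto hn2
        yo2)].
  have nyv2 : ~ nondegenerate p2 (@ydigit m2 n2 Lambda).
    by move=> /B2 /(onto_digits_nondegenerate hn1).
  apply: (@le_trans _ _ 0); last by apply: adde_ge0; [exact: bigmaxe_ge0 | exact: max0].
  apply: kappa_le.
    exact: (dimH_measure_degenerate gm1 hn1 p1_prob Pp1 muE nxu1 nyv1).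
  exact: (dimH_measure_degenerate gm2 hn2 p2_prob Pp2 nuE nxu2 nyv2).
- move=> antiL.
  have L00 : L 0%R 0%R = 0%R by apply: antiL.
  have L11 : L 1%R 1%R = 0%R by apply: antiL.
  move: detL; rewrite L00 mul0r sub0r oppr_eq0 mulf_eq0 negb_or => /andP[L01 L10].
  apply: contrapT => ns.
  pose L' : 'M[R]_2 := mx22 0%R (L 1%R 0%R)^-1%R (L 0%R 1%R)^-1%R 0%R.
  pose b' : R * R := (- ((L 1%R 0%R)^-1 * b.2), - ((L 0%R 1%R)^-1 * b.1))%R.
  have [L'00 L'01 L'10 L'11] := mx22E 0 (L 1%R 0%R)^-1%R (L 0%R 1%R)^-1%R 0%R.
  have inv : cancel (affine_map L b) (affine_map L' b').
    move=> [x y]; rewrite /affine_map L'00 L'01 L'10 L'11 L00 L11 /=.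
    by congr pair; field.
  have ns' : ~ mutually_singular (pushforward nu (affine_map L' b')) mu.
    by move=> /(mutually_singular_inverse (measurable_affine_map L' b') inv).
  have [A1 B1 C1] := nonsingular_antidiag hn1 hm1 hn2 hm2 p1_prob Pp1 muE p2_prob Pp2 nuE
    L00 L11 L01 L10 (irrational_inv irrmn) (irrational_inv irrnm) ns.
  have L'01n : L' 0%R 1%R != 0%R by rewrite L'01 invr_eq0.
  have L'10n : L' 1%R 0%R != 0%R by rewrite L'10 invr_eq0.
  have [A2 B2 C2] := nonsingular_antidiag hn2 hm2 hn1 hm1 p2_prob Pp2 nuE p1_prob Pp1 muE
    L'00 L'11 L'01n L'10n irrnm irrmn ns'.
  move: lt_kappa; rewrite ltNge => /negP; apply.
  (* The x-digits of [mu] are now matched with the y-digits of [nu]. If they are all used, a full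
     row of [Gamma] meets [dimP2E >= 1] in the first summand; the other match feeds the second
     summand in the same way. *)
  have [xu1|nxu1] := pselect (nondegenerate p1 (@xdigit m1 n1 Gamma)).
    have yo2 := A1 xu1; have yv2 := onto_digits_nondegenerate hn2 yo2; have xo1 := B2 yv2.
    have dE : 1 <= dimP2E by exact: (dimH_projection_onto hn2 yo2).
    have [yv1|nyv1] := pselect (nondegenerate p1 (@ydigit m1 n1 Gamma)).
      have xo2 := B1 yv1; have xu2 := onto_digits_nondegenerate gm2 xo2; have yo1 := A2 xu2.
      have dF : 1 <= dimP2F by exact: (dimH_projection_onto hn1 yo1).
      have [i ri] := row_dim_of_pairs gm1 p1_prob (C2 xu2 yv2).
      have [j rj] := row_dim_of_pairs gm2 p2_prob (C1 xu1 yv1).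
      apply: (@le_trans _ _ (1 + 1)); first by apply: kappa_le; rewrite -two.
      apply: leeD; first by apply: (@bigmaxe_ge _ _ _ i); apply: sub1_ge1; rewrite ?ri.
      by apply: (@bigmaxe_ge _ _ _ j); apply: sub1_ge1; rewrite ?rj.
    have nxu2 : ~ nondegenerate p2 (@xdigit m2 n2 Lambda).
      by move=> /A2 /(onto_digits_nondegenerate hn1).
    have [i ri] := row_dim_of_xonto gm1 p1_prob xo1 nyv1.
    apply: (@le_trans _ _ (1 + 0)).
      rewrite adde0; apply: kappa_le.
        exact: (dimH_measure_ydegenerate gm1 hn1 p1_prob Pp1 muE nyv1).
      exact: (dimH_measure_xdegenerate gm2 hn2 p2_prob Pp2 nuE nxu2).
    apply: leeD; last exact: bigmaxe_ge0.
    by apply: (@bigmaxe_ge _ _ _ i); apply: sub1_ge1; rewrite ?ri.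
  have nyv2 : ~ nondegenerate p2 (@ydigit m2 n2 Lambda).
    by move=> /B2 /(onto_digits_nondegenerate gm1).
  have [yv1|nyv1] := pselect (nondegenerate p1 (@ydigit m1 n1 Gamma)).
    have xo2 := B1 yv1; have xu2 := onto_digits_nondegenerate gm2 xo2; have yo1 := A2 xu2.
    have dF : 1 <= dimP2F by exact: (dimH_projection_onto hn1 yo1).
    have [j rj] := row_dim_of_xonto gm2 p2_prob xo2 nyv2.
    apply: (@le_trans _ _ (0 + 1)).
      rewrite add0e; apply: kappa_le.
        exact: (dimH_measure_xdegenerate gm1 hn1 p1_prob Pp1 muE nxu1).
      exact: (dimH_measure_ydegenerate gm2 hn2 p2_prob Pp2 nuE nyv2).
    apply: leeD; first exact: bigmaxe_ge0.
    by apply: (@bigmaxe_ge _ _ _ j); apply: sub1_ge1; rewrite ?rj.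
  have nxu2 : ~ nondegenerate p2 (@xdigit m2 n2 Lambda).
    by move=> /A2 /(onto_digits_nondegenerate hn1).
  apply: (@le_trans _ _ 0); last by apply: adde_ge0; exact: bigmaxe_ge0.
  apply: kappa_le.
    exact: (dimH_measure_degenerate gm1 hn1 p1_prob Pp1 muE nxu1 nyv1).
  exact: (dimH_measure_degenerate gm2 hn2 p2_prob Pp2 nuE nxu2 nyv2).
Qed.
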